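(* Let $X$ be a nonempty compact metrizable space and $\varphi:X\to X$ a continuous, locally injective surjection. Let $D=D_{\Gamma_\varphi}$, let $\widehat D$ be its Gelfand spectrum, and let $\psi:\widehat D\to\widehat D$ be the surjective local homeomorphism given by $\psi(c)(g)=c(g\circ\varphi)$, $c\in\widehat D$, $g\in D$. Then there is a $*$-isomorphism $C^*_r(\Gamma_\varphi)\to C^*_r(\Gamma_\psi)$ which is the identity on $D_{\Gamma_\varphi}$ (where $D_{\Gamma_\varphi}=C(\widehat D)=D_{\Gamma_\psi}$ via the Gelfand transform) and takes the isometry $V_\varphi\in C^*_r(\Gamma_\varphi)$ to the isometry $V_\psi\in C^*_r(\Gamma_\psi)$.
   Context: $\mathbb N=\{0,1,2,\dots\}$. Locally injective means that the topology of $X$ has a basis consisting of sets on which $\varphi$ is injective. Groupoid: $\Gamma_\varphi=\{(x,k,y)\in X\times\mathbb Z\times X:\exists a,b\in\mathbb N,\ k=a-b,\ \varphi^a(x)=\varphi^b(y)\}$, with product $(x,k,y)(y,k',y')=(x,k+k',y')$ and inverse $(x,k,y)^{-1}=(y,-k,x)$. For $k\in\mathbb Z$ and $n\in\mathbb N$ with $n+k\ge 0$ let $\Gamma_\varphi(k,n)=\{(x,l,y)\in X\times\mathbb Z\times X: l=k,\ \varphi^{k+i}(x)=\varphi^i(y)\ \text{for all } i\ge n\}$ with the relative topology from $X\times\mathbb Z\times X$; $\Gamma_\varphi(k,n)$ is open in $\Gamma_\varphi(k,n+1)$. $\Gamma_\varphi(k)=\bigcup_{n}\Gamma_\varphi(k,n)$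 has the inductive limit topology, and $\Gamma_\varphi=\bigsqcup_k\Gamma_\varphi(k)$ has the topology in which each $\Gamma_\varphi(k)$ is open and closed. The unit space is identified with $X$ via $x\mapsto(x,0,x)$. Algebras: $\mathrm{alg}^*\Gamma_\varphi$ is the $*$-algebra of functions on $\Gamma_\varphi$ generated by the continuous compactly supported functions under the convolution $f\star g(x,k,y)=\sum_{z,\,n+m=k}f(x,n,z)g(z,m,y)$ and the involution $f^*(x,k,y)=\overline{f(y,-k,x)}$. $C^*_r(\Gamma_\varphi)$ is its completion in the reduced norm $\|f\|=\sup_{x\in X}\|\pi_x(f)\|$, where $\pi_x$ is the representation on $\ell^2(\{(z,k,y)\in\Gamma_\varphi:y=x\})$ given by $(\pi_x(f)\xi)(\gamma)=\sum_{\gamma_1\gamma_2=\gamma}f(\gamma_1)\xi(\gamma_2)$. $D_{\Gamma_\varphi}$ is the closure in $C^*_r(\Gamma_\varphi)$ of the set of elements of $\mathrm{alg}^*\Gamma_\varphi$ supported in the unit space; it is a separable abelian $C^*$-algebra of bounded functions on $X$ (pointwise operations, supremum norm) containing $C(X)$, and $g\circ\varphi\in D_{\Gamma_\varphi}$ for $g\in D_{\Gamma_\varphi}$. The isometry $V_\varphi\in C^*_r(\Gamma_\varphi)$ is the function $V_\varphi(x,k,y)=m(x)^{-1/2}$ if $k=1$ and $y=\varphi(x)$, and $0$ otherwise, where $m(x)=\#\varphi^{-1}(\varphi(x))$. $\widehat D$ is the set of unital $*$-homomorphisms $c:D\to\mathbb C$ with the weak* topology, a compact metrizable space; $D$ is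 identified with $C(\widehat D)$ via $d(c)=c(d)$. The objects $\Gamma_\psi$, $C^*_r(\Gamma_\psi)$, $D_{\Gamma_\psi}$, $V_\psi$ are obtained by the same constructions applied to $(\widehat D,\psi)$ in place of $(X,\varphi)$; since $\psi$ is a local homeomorphism, $D_{\Gamma_\psi}=C(\widehat D)$. *)

(* Defs.v *)
From HB Require Import structures.
From mathcomp Require Import all_boot all_order all_algebra finmap.
From mathcomp Require Import complex.
From mathcomp Require Import all_classical all_reals all_analysis.

Set Implicit Arguments.
Unset Strict Implicit.
Unset Printing Implicit Defensive.

Import Order.TTheory GRing.Theory Num.Theory.
Import numFieldNormedType.Exports.

Local Open Scope classical_set_scope.
Local Open Scope complex_scope.
Local Open Scope ring_scope.

(* R[i] only carries its numClosedFieldType structure; equip it with the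
   topology and norm that MathComp-Analysis puts on any numFieldType. *)
HB.instance Definition _ (R : realType) :=
  PseudoPointedMetric.copy R[i] (R[i] : numClosedFieldType)^o.
HB.instance Definition _ (R : realType) :=
  GRing.ComAlgebra.copy R[i] (R[i] : numClosedFieldType)^o.
HB.instance Definition _ (R : realType) :=
  Vector.copy R[i] (R[i] : numClosedFieldType)^o.
HB.instance Definition _ (R : realType) :=
  NormedModule.copy R[i] (R[i] : numClosedFieldType)^o.

(* Not necessarily unital C*-algebras. The product is an operation of its own:
   Hierarchy-Builder rejects the join of the ring and the normed module
   structures. *)
HB.mixin Record isCStarAlgebra (R : realType) A
    & CompleteNormedModule R[i] A := {
  cmul : A -> A -> A;
  star : A -> A;
  cmulA : associative cmul;
  cmulDl : left_distributive cmul +%R;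
  cmulDr : right_distributive cmul +%R;
  cmulZl : forall (z : R[i]) (a b : A), cmul (z *: a) b = z *: cmul a b;
  cmulZr : forall (z : R[i]) (a b : A), cmul a (z *: b) = z *: cmul a b;
  starK : involutive star;
  starD : {morph star : a b / a + b};
  starZ : forall (z : R[i]) (a : A), star (z *: a) = z^* *: star a;
  starM : forall a b : A, star (cmul a b) = cmul (star b) (star a);
  cstar_normM : forall a b : A, `|cmul a b| <= `|a| * `|b|;
  cstar_norm : forall a : A, `|cmul (star a) a| = `|a| ^+ 2
}.

#[short(type="cstarAlgType")]
HB.structure Definition CStarAlgebra (R : realType) :=
  { A of CompleteNormedModule R[i] A & isCStarAlgebra R A }.

Definition star_isomorphism (R : realType) (A B : cstarAlgType R)
    (F : {linear A -> B}) : Prop :=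
  [/\ bijective F, {morph F : a b / cmul a b} & {morph F : a / star a}].

Definition locally_injective (X : topologicalType) (Y : Type) (phi : X -> Y) :=
  exists2 B : set (set X), basis B & forall U, B U -> set_inj U phi.

Definition gpd_rel (X : Type) (phi : X -> X) (g : X * int * X) : Prop :=
  exists a b : nat,
    g.1.2 = a%:Z - b%:Z /\ iter a phi g.1.1 = iter b phi g.2.

Definition groupoid (X : Type) (phi : X -> X) := {g : X * int * X | gpd_rel phi g}.

Section groupoid.
Context {X : Type} {phi : X -> X}.
Implicit Types g : groupoid phi.

HB.instance Definition _ := gen_eqMixin (groupoid phi).
HB.instance Definition _ := gen_choiceMixin (groupoid phi).

Definition rng g : X := (sval g).1.1.
Definition deg g : int := (sval g).1.2.
Definition src g : X := (sval g).2.

(* [gmul_to g1 g2 g] : g1 and g2 are composable and g1 g2 = g. *)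
Definition gmul_to (g1 g2 g : groupoid phi) : Prop :=
  [/\ src g1 = rng g2, rng g = rng g1, deg g = deg g1 + deg g2
    & src g = src g2].

Lemma ginv_subproof g : gpd_rel phi (src g, - deg g, rng g).
Proof.
case: g => [[[x k] y] [a [b [/= ek eab]]]]; exists b, a.
by rewrite /deg /rng /src /= ek opprB eab.
Qed.

Definition ginv g : groupoid phi := exist _ _ (ginv_subproof g).

(* Gamma_phi(k, n), used for 0 <= n + k only, so that the exponent k + i is
   nonnegative for all i >= n. *)
Definition gpd_piece (k : int) (n : nat) : set (groupoid phi) :=
  [set g | deg g = k /\ forall i, (n <= i)%N ->
     iter `|(k + i%:Z)%R|%N phi (rng g) = iter i phi (src g)].

End groupoid.

Section groupoid_topology.
Context {X : topologicalType} {phi : X -> X}.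

(* Since deg is constantly k on Gamma_phi(k, n), its relative topology from
   X * int * X is its relative topology from X * X. A set is open in the
   inductive limit Gamma_phi(k) iff its trace on each Gamma_phi(k, n) is open,
   and open in the disjoint union iff its trace on each Gamma_phi(k) is. *)
Definition gpd_open (U : set (groupoid phi)) : Prop :=
  forall (k : int) (n : nat), 0 <= n%:Z + k ->
    exists2 W : set (X * X), open W
      & forall g, gpd_piece k n g -> (U g <-> W (rng g, src g)).

Lemma gpd_openT : gpd_open setT.
Proof. by move=> k n _; exists setT; [exact: openT|]. Qed.

Lemma gpd_openI : setI_closed gpd_open.
Proof.
move=> U V oU oV k n kn.
have [W oW UW] := oU k n kn; have [W' oW' VW'] := oV k n kn.
exists (W `&` W'); first exact: openI.
by move=> g gk; split=> -[/(UW g gk) ? /(VW' g gk) ?].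
Qed.

Lemma gpd_open_bigU (I : Type) (F : I -> set (groupoid phi)) :
  (forall i, gpd_open (F i)) -> gpd_open (\bigcup_i F i).
Proof.
move=> oF k n kn.
have /choice[W WP] i : exists W : set (X * X), open W /\
    forall g, gpd_piece k n g -> (F i g <-> W (rng g, src g)).
  by have [W] := oF i k n kn; exists W.
exists (\bigcup_i W i); first by apply: bigcup_open => i _; case: (WP i).
move=> g gk; split=> -[i _ h]; exists i => //; have [_ e] := WP i.
- exact/e.
- by apply/(e g gk).
Qed.

HB.instance Definition _ := isOpenTopological.Build (groupoid phi)
  gpd_openT gpd_openI gpd_open_bigU.

End groupoid_topology.

Section algebra.
Context {R : realType} {X : topologicalType} {phi : X -> X}.
Local Notation C := R[i].
Implicit Types f h : groupoid phi -> C.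

(* For each g the sum is finite for functions in alg^*; \sum_(p \in A) is the
   sum over a finite support (and 0 if the support is infinite). *)
Definition conv f h : groupoid phi -> C := fun g =>
  \sum_(p \in [set p : groupoid phi * groupoid phi | gmul_to p.1 p.2 g])
    f p.1 * h p.2.

Definition invol f : groupoid phi -> C := fun g => (f (ginv g))^*.

Definition compactly_supported f : Prop := compact (closure [set g | f g != 0]).

Inductive alg_star : set (groupoid phi -> C) :=
| alg_star_cc f of continuous f & compactly_supported f : alg_star f
| alg_starD f h of alg_star f & alg_star h : alg_star (f \+ h)
| alg_starZ (z : C) f of alg_star f : alg_star (z \*: f)
| alg_star_conv f h of alg_star f & alg_star h : alg_star (conv f h)
| alg_star_invol f of alg_star f : alg_star (invol f).

Definition l2norm (xi : groupoid phi -> C) : \bar R :=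
  sqrte (\esum_(g in [set: groupoid phi]) (complex.Re (`|xi g| ^+ 2))%:E)%E.

(* l^2 of the source fibre {g | src g = x}, as functions on the groupoid which
   vanish outside this fibre. *)
Definition ell2 (x : X) : set (groupoid phi -> C) :=
  [set xi | (forall g, src g <> x -> xi g = 0) /\ (l2norm xi < +oo)%E].

(* (pi_x(f) xi)(g) is the sum of f g1 * xi g2 over g1 g2 = g: with vectors of
   l^2 extended by 0 this is conv f xi, again supported in the fibre over x. *)
Definition pi_norm (x : X) f : \bar R :=
  ereal_sup [set l2norm (conv f xi) | xi in [set xi | ell2 x xi /\ (l2norm xi <= 1)%E]].

Definition reduced_norm f : \bar R := ereal_sup (range (pi_norm ^~ f)).

Definition supported_in_units f : Prop :=
  forall g, f g != 0 -> rng g = src g /\ deg g = 0.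

(* A function on X, viewed as a function on the groupoid living on the unit
   space {(x, 0, x)}. *)
Definition on_units (d : X -> C) : groupoid phi -> C :=
  fun g => if (rng g == src g) && (deg g == 0) then d (rng g) else 0.

Definition fibre_card (x : X) : nat := #|` fset_set (phi @^-1` [set phi x])|.

Definition V_isom : groupoid phi -> C := fun g =>
  if (deg g == 1) && (src g == phi (rng g))
  then ((Num.sqrt (fibre_card (rng g))%:R)^-1)%:C else 0.

End algebra.

(* The reduced C*-algebra: a completion of alg^* in the reduced norm, that is, a
   C*-algebra with an isometric *-homomorphism from alg^* with dense range
   (unique up to isomorphism). [red_emb] is only meaningful on alg_star. *)
Record reduced_cstar (R : realType) (X : topologicalType) (phi : X -> X) := {
  red_alg :> cstarAlgType R;
  red_emb : (groupoid phi -> R[i]) -> red_alg;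
  red_embD : forall f h, alg_star f -> alg_star h ->
    red_emb (f \+ h) = red_emb f + red_emb h;
  red_embZ : forall (z : R[i]) f, alg_star f ->
    red_emb (z \*: f) = z *: red_emb f;
  red_embM : forall f h, alg_star f -> alg_star h ->
    red_emb (conv f h) = cmul (red_emb f) (red_emb h);
  red_emb_star : forall f, alg_star f -> red_emb (invol f) = star (red_emb f);
  red_emb_norm : forall f, alg_star f ->
    (complex.Re `|red_emb f|)%:E = reduced_norm f;
  red_emb_dense : dense (red_emb @` alg_star)
}.

(* The element a of the completion is the function h on the groupoid: h and a
   are the limits, in the reduced norm, of the same elements of alg^*. For h in
   alg^* this says a = red_emb h. *)
Definition is_function (R : realType) (X : topologicalType) (phi : X -> X)
    (A : reduced_cstar R phi) (a : A) (h : groupoid phi -> R[i]) : Prop :=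
  forall e : R, 0 < e -> exists2 f, alg_star f
    & (reduced_norm (h \- f)%R < e%:E)%E /\ `|a - red_emb A f| < e%:C.

Section diagonal.
Context (R : realType) (X : topologicalType) (phi : X -> X).
Local Notation C := R[i].

(* D_{Gamma_phi}: closure, in the reduced norm, of the elements of alg^*
   supported in the unit space, as functions on X. *)
Definition diag : set (X -> C) := [set d | forall e : R, 0 < e ->
  exists2 f : groupoid phi -> C, alg_star f /\ supported_in_units f
    & (reduced_norm (on_units d \- f)%R < e%:E)%E].

(* A character of D is extended by 0 to all functions X -> C, which makes the
   extension unique. *)
Record is_character (c : (X -> C) -> C) : Prop := {
  char_out : forall d, ~ diag d -> c d = 0;
  char1 : c (cst 1) = 1;
  charD : forall d e, diag d -> diag e -> c (d \+ e) = c d + c e;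
  charZ : forall (z : C) d, diag d -> c (z \*: d) = z * c d;
  charM : forall d e, diag d -> diag e -> c (d \* e) = c d * c e;
  char_conj : forall d, diag d -> c (fun x => (d x)^*) = (c d)^*
}.

Definition spectrum := {c : (X -> C) -> C | is_character c}.

HB.instance Definition _ := gen_eqMixin spectrum.
HB.instance Definition _ := gen_choiceMixin spectrum.

(* Pointwise convergence on D, i.e. the weak* topology: evaluation at a function
   outside D is constantly 0 and contributes no open set. *)
HB.instance Definition _ := Topological.copy spectrum
  (initial_topology (sval : spectrum -> {ptws (X -> C) -> C})).

Definition gelfand (d : X -> C) : spectrum -> C := fun c => sval c d.

End diagonal.

(* Main.v *)
Require Import Defs.
From HB Require Import structures.
From mathcomp Require Import all_boot all_order all_algebra finmap.
From mathcomp Require Import complex.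
From mathcomp Require Import all_classical all_reals all_analysis.
From mathcomp Require Import ring lra zify.
Import Order.TTheory GRing.Theory Num.Theory.
Import numFieldNormedType.Exports.
Local Open Scope classical_set_scope.
Local Open Scope complex_scope.
Local Open Scope ring_scope.
Set Implicit Arguments.
Unset Strict Implicit.
Unset Printing Implicit Defensive.
Local Notation conv := Defs.conv.

(** Let D be the diagonal algebra of phi. Evaluation at the points of X maps X
    injectively into the spectrum of D and intertwines phi with psi. What makes
    the theorem true is that it also matches the fibres of the two maps. The
    transfer operator, which sums a function over the fibres of phi, preserves
    D, and the Gelfand transform carries it to the transfer operator of psi
    (transfer_gelfand). At the constant function 1 this says that the fibre of
    psi over the evaluation at x has as many points as the fibre of phi over x,
    so it consists of the evaluations at the points of that fibre
    (dual_fibre_eval). Hence the groupoid of phi embeds in the groupoid of psi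
    as the set of all arrows whose source is an evaluation, and restriction of
    functions along this embedding, called pull, respects convolution and
    involution (conv_pull).

    The map pull is studied on a subalgebra, core, of functions on the groupoid
    of psi. Let S be the shift, that is, the indicator function of the arrows
    from psi c to c of degree 1, and T its adjoint. Then core is the span of the
    products d S^a T^b e with d and e in D. It is closed under convolution
    because T d S is the transfer of d and S d = (d o psi) S (span_elem_conv).
    It is dense because the supports of the functions S^a T^b are compact open
    sets that cover the groupoid and on which the functions d(range) e(source)
    separate points, so that the Stone-Weierstrass theorem applies
    (cc_approximable, alg_star_approx_core); in the same way its image under
    pull is dense in the algebra of phi (approx_alg_star_pull,
    approx_pull_core).

    Restriction is isometric on core. It does not increase norms, since the
    source fibre of an evaluation is a source fibre of the groupoid of phi
    (op_le_pull). Conversely let h be in core, K a bound for pull h, and c any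
    character. A finitely supported vector on the source fibre of c is the
    restriction of some p in core, and the squared norms of p and h p on that
    fibre are c(d2) and c(d1), where d2 and d1 in D are the restrictions of
    p^* p and (h p)^* h p to the units. The function K^2 d2 - d1 is nonnegative
    on X by the choice of K, and characters of D are positive, so
    c(d1) <= K^2 c(d2) (op_le_of_pull).

    An isometric and multiplicative correspondence between dense subalgebras
    extends to the completions (completion_isomorphism). The diagonal elements
    belong to core, and so does the isometry: its weight is a polynomial in the
    cardinality of the fibres, which is the transfer of 1 composed with the map
    (V_isom_core). *)

(** * Squared moduli and finite covers *)

Section nsq.
Context {R : realType}.
Implicit Types z w : R[i].

Definition nsq z : R := (complex.Re z) ^+ 2 + (complex.Im z) ^+ 2.

Lemma nsq_ge0 z : 0 <= nsq z.
Proof. by rewrite addr_ge0 ?sqr_ge0. Qed.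

Lemma nsqE z : (nsq z)%:C = `|z| ^+ 2.
Proof. exact: add_Re2_Im2. Qed.

Lemma nsqJ_mul z : (nsq z)%:C = z^* * z.
Proof. by rewrite nsqE sqr_normc mulrC. Qed.

Lemma nsq0 : nsq (0 : R[i]) = 0.
Proof. by rewrite /nsq /= expr0n addr0. Qed.

Lemma nsq_eq0 z : (nsq z == 0) = (z == 0).
Proof.
rewrite /nsq paddr_eq0 ?sqr_ge0// !sqrf_eq0 [RHS]eq_complex /=.
by case: z.
Qed.

Lemma nsqM z w : nsq (z * w) = nsq z * nsq w.
Proof. by apply: complexI; rewrite rmorphM/= !nsqE normrM exprMn. Qed.

Lemma nsqN z : nsq (- z) = nsq z.
Proof. by apply: complexI; rewrite !nsqE normrN. Qed.

Lemma nsqJ z : nsq z^* = nsq z.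
Proof. by apply: complexI; rewrite !nsqE normcJ. Qed.

Lemma nsqR (r : R) : nsq r%:C = r ^+ 2.
Proof. by rewrite /nsq /= expr0n addr0. Qed.

Lemma nsq_lt z (e : R) : 0 < e -> (`|z| < e%:C) = (nsq z < e ^+ 2).
Proof.
move=> e0; rewrite -ltcR nsqE rmorphXn /= ltr_pXn2r ?nnegrE//.
by rewrite ler0c ltW.
Qed.

Lemma nsq_le z (e : R) : 0 <= e -> (`|z| <= e%:C) = (nsq z <= e ^+ 2).
Proof.
move=> e0; rewrite -lecR nsqE rmorphXn /= ler_pXn2r ?nnegrE//.
by rewrite ler0c.
Qed.

(** The weight t stays free because this replaces the triangle inequality of l^2
    after summation over a list: with t = L / K, the bounds K^2 and L^2 combine
    to (K + L)^2. *)
Lemma nsqD_le z w (t : R) : 0 < t ->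
  nsq (z + w) <= (1 + t) * nsq z + (1 + t^-1) * nsq w.
Proof.
move=> t0; case: z w => [a b] [c d]; rewrite /nsq /=.
have t1 : t * t^-1 = 1 by rewrite divff// gt_eqF.
have s0 : 0 < t^-1 by rewrite invr_gt0.
suff h (x y : R) : 2 * (x * y) <= t * x ^+ 2 + t^-1 * y ^+ 2.
  have := h a c; have := h b d; nra.
have e : t * x ^+ 2 + t^-1 * y ^+ 2 - 2 * (x * y) =
    t * (x - t^-1 * y) ^+ 2 + (t * t^-1 - 1) * (2 * x * y - t^-1 * y ^+ 2).
  by ring.
rewrite -subr_ge0 e t1 subrr mul0r addr0.
by rewrite mulr_ge0 ?sqr_ge0// ltW.
Qed.

Lemma nsqD_le2 z w : nsq (z + w) <= 2 * nsq z + 2 * nsq w.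
Proof. by have := nsqD_le z w ltr01; rewrite invr1. Qed.

Lemma nsqD_bound z w (r s : R) : 0 <= r -> 0 <= s ->
  nsq z <= r ^+ 2 -> nsq w <= s ^+ 2 -> nsq (z + w) <= (r + s) ^+ 2.
Proof.
move=> r0 s0; rewrite -!nsq_le// ?addr_ge0// => h1 h2.
by rewrite (le_trans (ler_normD _ _))// rmorphD /= lerD.
Qed.

(** Cauchy-Schwarz against the constant vector; the induction step is nsqD_le
    with the length of the tail as weight. *)
Lemma nsq_sum (I : Type) (s : seq I) (F : I -> R[i]) :
  nsq (\sum_(i <- s) F i) <= (size s)%:R * \sum_(i <- s) nsq (F i).
Proof.
elim: s => [|x s IH]; first by rewrite !big_nil nsq0 mul0r.
rewrite !big_cons; case: s IH => [|y s] IH.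
  by rewrite !big_nil addr0 addr0 mul1r.
set S := \sum_(i <- y :: s) F i in IH *.
set T := \sum_(i <- y :: s) nsq _ in IH *.
set n := size (y :: s) in IH *.
have n0 : (0 : R) < n%:R by rewrite ltr0n.
apply: (le_trans (nsqD_le _ _ n0)).
have -> : (size [:: x, y & s])%:R = 1 + n%:R :> R by rewrite -[1]/(1%:R) -natrD.
rewrite [leRHS]mulrDr lerD2l.
apply: (le_trans (ler_wpM2l _ IH)); first by rewrite addr_ge0// invr_ge0 ltW.
by rewrite mulrA mulrDl mulVf ?gt_eqF// mul1r addrC.
Qed.

End nsq.

Section lists.

(** Cardinalities are bounded by exhibiting a covering list, so that the bounds
    pass to subsets and images without any counting. *)
Definition at_most (n : nat) (T : eqType) (Q : set T) : Prop :=
  exists2 l : seq T, (size l <= n)%N & forall x, Q x -> x \in l.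

Lemma at_most_exact n (T : eqType) (Q : set T) : at_most n Q ->
  exists l : seq T, [/\ uniq l, (size l <= n)%N & forall x, x \in l <-> Q x].
Proof.
case=> l sl Ql; exists [seq x <- undup l | `[<Q x>]]; split.
- by rewrite filter_uniq// undup_uniq.
- by rewrite size_filter (leq_trans (count_size _ _))// (leq_trans (size_undup _)).
- move=> x; rewrite mem_filter mem_undup; split=> [/andP[/asboolP]//|Qx].
  by apply/andP; split; [apply/asboolP|exact: Ql].
Qed.

Lemma at_most_sub n (T : eqType) (P Q : set T) :
  P `<=` Q -> at_most n Q -> at_most n P.
Proof. by move=> PQ [l sl Ql]; exists l => // x /PQ/Ql. Qed.

Lemma at_mostW n m (T : eqType) (Q : set T) :
  (n <= m)%N -> at_most n Q -> at_most m Q.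
Proof. by move=> nm [l sl Ql]; exists l => //; exact: leq_trans nm. Qed.

Lemma at_mostU n m (T : eqType) (P Q : set T) :
  at_most n P -> at_most m Q -> at_most (n + m) (P `|` Q).
Proof.
move=> [l sl Pl] [k sk Qk]; exists (l ++ k); first by rewrite size_cat leq_add.
by move=> x [/Pl|/Qk] h; rewrite mem_cat h ?orbT.
Qed.

Lemma at_most_image n (T U : eqType) (f : T -> U) (P : set T) (Q : set U) :
  at_most n P -> (forall y, Q y -> exists2 x, P x & f x = y) -> at_most n Q.
Proof.
move=> [l sl Pl] h; exists (map f l); first by rewrite size_map.
by move=> y /h[x /Pl xl <-]; apply: map_f.
Qed.

Lemma at_most_bind n m (T U : eqType) (P : set T) (Q : T -> set U) (S : set U) :
  at_most n P -> (forall x, P x -> at_most m (Q x)) ->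
  (forall y, S y -> exists2 x, P x & Q x y) -> at_most (n * m) S.
Proof.
move=> Pn Qm h; have [l [ul sl Pl]] := at_most_exact Pn.
have /choice[k kP] x : exists k : seq U, (size k <= m)%N /\
    (P x -> forall y, Q x y -> y \in k).
  have [Px|nPx] := pselect (P x); last by exists [::].
  by have [k sk kQ] := Qm x Px; exists k.
exists (flatten [seq k x | x <- l]); last first.
  move=> y /h[x Px Qxy]; apply/flattenP; exists (k x); last first.
    by case: (kP x) => _ /(_ Px y Qxy).
  by apply: map_f; apply/Pl.
rewrite size_flatten /shape -map_comp sumnE big_map.
apply: (@leq_trans (\sum_(x <- l) m)).
  by apply: leq_sum => x _ /=; case: (kP x).
by rewrite big_const_seq count_predT iter_addn_0 mulnC leq_mul2r sl orbT.
Qed.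

Lemma finite_union n (T U : eqType) (l : seq T) (Q : T -> set U) :
  (forall x, x \in l -> at_most n (Q x)) ->
  exists M : seq U, uniq M /\ forall y, y \in M <-> exists2 x, x \in l & Q x y.
Proof.
move=> Qn; have [|M [uM _ MP]] := @at_most_exact (size l * n) U
    [set y | exists2 x, x \in l & Q x y].
  by apply: (at_most_bind (P := fun x => x \in l) (Q := Q)) => //; exists l.
by exists M.
Qed.

End lists.

(** * The groupoid law and finite convolution sums *)

Section groupoid_law.
Context {X : Type} {phi : X -> X}.
Implicit Types g h k : groupoid phi.

Lemma gpd_eq g h : rng g = rng h -> deg g = deg h -> src g = src h -> g = h.
Proof.
case: g h => [[[x k] y] p] [[[x' k'] y'] p']; rewrite /rng /deg /src /=.
move=> e1 e2 e3; subst x' k' y'; congr exist; exact: Prop_irrelevance.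
Qed.

Lemma gpd_rel_mul (x y z : X) (k l : int) :
  gpd_rel phi (x, k, y) -> gpd_rel phi (y, l, z) -> gpd_rel phi (x, k + l, z).
Proof.
move=> [a [b [/= -> e1]]] [c [d [/= -> e2]]].
exists (c + a)%N, (b + d)%N; split; first by rewrite /= !PoszD; ring.
by rewrite !iterD e1 -e2 -!iterD addnC.
Qed.

Lemma groupoid_rel g : gpd_rel phi (rng g, deg g, src g).
Proof. by case: g => [[[x k] y] p]. Qed.

(** Pairs that do not compose get the arbitrary value g, which makes the product
    a total function usable in reindexing maps. *)
Definition gmul g h : groupoid phi :=
  if pselect (src g = rng h) is left e then
    exist _ (rng g, deg g + deg h, src h)
      (gpd_rel_mul (groupoid_rel g) (eq_ind_r
         (fun y => gpd_rel phi (y, deg h, src h)) (groupoid_rel h) e))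
  else g.

Lemma gmulP g h : src g = rng h ->
  [/\ rng (gmul g h) = rng g, deg (gmul g h) = deg g + deg h
    & src (gmul g h) = src h].
Proof. by rewrite /gmul; case: pselect. Qed.

Lemma rng_gmul g h : src g = rng h -> rng (gmul g h) = rng g.
Proof. by case/gmulP. Qed.
Lemma deg_gmul g h : src g = rng h -> deg (gmul g h) = deg g + deg h.
Proof. by case/gmulP. Qed.
Lemma src_gmul g h : src g = rng h -> src (gmul g h) = src h.
Proof. by case/gmulP. Qed.

Lemma rng_ginv g : rng (ginv g) = src g. Proof. by []. Qed.
Lemma src_ginv g : src (ginv g) = rng g. Proof. by []. Qed.
Lemma deg_ginv g : deg (ginv g) = - deg g. Proof. by []. Qed.

Lemma ginvK : involutive (@ginv X phi).
Proof. by move=> g; apply: gpd_eq; rewrite // !deg_ginv opprK. Qed.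

Definition gpdE := (rng_ginv, src_ginv, deg_ginv).

Lemma gmulA g h k : src g = rng h -> src h = rng k ->
  gmul g (gmul h k) = gmul (gmul g h) k.
Proof.
move=> e1 e2.
have e3 : src g = rng (gmul h k) by rewrite rng_gmul.
have e4 : src (gmul g h) = rng k by rewrite src_gmul.
by apply: gpd_eq; rewrite ?(rng_gmul, deg_gmul, src_gmul) ?addrA.
Qed.

Lemma gmulKV g h : rng g = rng h -> gmul g (gmul (ginv g) h) = h.
Proof.
move=> e; have e1 : src (ginv g) = rng h by [].
have e2 : src g = rng (gmul (ginv g) h) by rewrite rng_gmul.
by apply: gpd_eq; rewrite ?(rng_gmul, deg_gmul, src_gmul)// deg_ginv addNKr.
Qed.

Lemma gmulVK g h : src g = rng h -> gmul (ginv g) (gmul g h) = h.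
Proof.
move=> e; have e2 : src (ginv g) = rng (gmul g h) by rewrite rng_gmul.
by apply: gpd_eq; rewrite ?(rng_gmul, deg_gmul, src_gmul)// deg_ginv addKr.
Qed.

Lemma ginvM g h : src g = rng h -> ginv (gmul g h) = gmul (ginv h) (ginv g).
Proof.
move=> e; have e2 : src (ginv h) = rng (ginv g) by [].
apply: gpd_eq; rewrite ?(gpdE, rng_gmul, deg_gmul, src_gmul)//.
by rewrite opprD addrC.
Qed.

Lemma gmulK g h : src g = rng h -> gmul (gmul g h) (ginv h) = g.
Proof.
move=> e; have e2 : src (gmul g h) = rng (ginv h) by rewrite src_gmul.
by apply: gpd_eq; rewrite ?(rng_gmul, deg_gmul, src_gmul)// deg_ginv addrK.
Qed.

Lemma gmulVr g h : src g = src h -> gmul (gmul g (ginv h)) h = g.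
Proof.
move=> e; have e1 : src g = rng (ginv h) by [].
have e2 : src (gmul g (ginv h)) = rng h by rewrite src_gmul.
by apply: gpd_eq; rewrite ?(rng_gmul, deg_gmul, src_gmul)// deg_ginv addrNK.
Qed.

Lemma gmul_toE g h k : gmul_to g h k <-> src g = rng h /\ k = gmul g h.
Proof.
split=> [[e e1 e2 e3]|[e ->]]; last first.
  by split=> //; rewrite ?(rng_gmul, deg_gmul, src_gmul).
by split=> //; apply: gpd_eq; rewrite ?(rng_gmul, deg_gmul, src_gmul).
Qed.

Lemma gpd_unit_subproof x : gpd_rel phi (x, 0, x).
Proof. by exists 0%N, 0%N. Qed.

Definition gunit x : groupoid phi := exist _ _ (gpd_unit_subproof x).

Lemma gunitP g : rng g = src g -> deg g = 0 -> g = gunit (src g).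
Proof. by move=> e1 e2; apply: gpd_eq. Qed.

Lemma gmulVg g : gmul (ginv g) g = gunit (src g).
Proof.
have e : src (ginv g) = rng g by [].
by apply: gpd_eq; rewrite ?(rng_gmul, deg_gmul, src_gmul)// deg_ginv addNr.
Qed.

End groupoid_law.

Section conv_sums.
Context {R : realType} {X : topologicalType} {phi : X -> X}.
Local Notation C := R[i].
Local Notation G := (groupoid phi).
Implicit Types f h : G -> C.

(** A pair with product g is determined by its first factor, an arrow with the
    range of g. *)
Lemma conv_row (f h : G -> C) (g : G) (l : seq G) : uniq l ->
  (forall k, k \in l -> rng k = rng g) ->
  (forall k, rng k = rng g -> k \notin l -> f k * h (gmul (ginv k) g) = 0) ->
  conv f h g = \sum_(k <- l) f k * h (gmul (ginv k) g).
Proof.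
move=> ul lg l0; rewrite /conv.
rewrite (@reindex_fsbig _ _ _ _ _ (fun k => (k, gmul (ginv k) g))
  [set k | rng k = rng g]); last first.
  split.
  - move=> k /= kg; apply/gmul_toE; split; last by rewrite gmulKV.
    by rewrite rng_gmul.
  - by move=> k k' _ _ [].
  - move=> [k k'] /= /gmul_toE[e ge]; exists k; first by rewrite /= ge rng_gmul.
    by rewrite ge gmulVK.
rewrite /= [RHS]fsbig_seq//; apply/esym/fsbig_widen => //.
by move=> k [/= kg /negP kl]; apply: l0.
Qed.

(** A pair with product g is determined by its second factor, an arrow with the
    source of g. *)
Lemma conv_col (f h : G -> C) (g : G) (l : seq G) : uniq l ->
  (forall k, k \in l -> src k = src g) ->
  (forall k, src k = src g -> k \notin l -> f (gmul g (ginv k)) * h k = 0) ->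
  conv f h g = \sum_(k <- l) f (gmul g (ginv k)) * h k.
Proof.
move=> ul lg l0; rewrite /conv.
rewrite (@reindex_fsbig _ _ _ _ _ (fun k => (gmul g (ginv k), k))
  [set k | src k = src g]); last first.
  split.
  - move=> k /= kg; apply/gmul_toE; rewrite gmulVr//; split=> //.
    by rewrite src_gmul.
  - by move=> k k' _ _ [].
  - move=> [k k'] /= /gmul_toE[e ge]; exists k'; first by rewrite /= ge src_gmul.
    by rewrite ge gmulK.
rewrite /= [RHS]fsbig_seq//; apply/esym/fsbig_widen => //.
by move=> k [/= kg /negP kl]; apply: l0.
Qed.

Lemma conv_neq0 f h g : conv f h g != 0 ->
  exists k l, [/\ src k = rng l, g = gmul k l, f k != 0 & h l != 0].
Proof.
move=> n0; apply: contrapT => H; move: n0; rewrite /conv fsbig1 ?eqxx//.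
move=> [k l] /= /gmul_toE[e ge]; apply: contrapT => /eqP; rewrite mulf_eq0.
by case/norP => h1 h2; apply: H; exists k, l.
Qed.

Definition rows (n : nat) f := forall y, at_most n [set g | rng g = y /\ f g != 0].
Definition cols (n : nat) f := forall y, at_most n [set g | src g = y /\ f g != 0].

Definition unif_finite_by (n : nat) (s : R) f := [/\ rows n f, cols n f
  & forall g, nsq (f g) <= s].
(** On this class convolution sums are finite and convolution is associative,
    and it contains all of alg_star together with the functions used to
    approximate it. *)
Definition unif_finite f := exists n s, unif_finite_by n s f.

Lemma unif_finite_by_invol n s f : unif_finite_by n s f -> unif_finite_by n s (invol f).
Proof.
move=> [rf cf sf]; split.
- move=> y; apply: (at_most_image (f := @ginv _ _) (cf y)) => g /= [gy fg].
  exists (ginv g); last exact: ginvK.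
  by rewrite /=; split=> //; move: fg; rewrite /invol conjc_eq0.
- move=> y; apply: (at_most_image (f := @ginv _ _) (rf y)) => g /= [gy fg].
  exists (ginv g); last exact: ginvK.
  by rewrite /=; split=> //; move: fg; rewrite /invol conjc_eq0.
- by move=> g; rewrite /invol nsqJ.
Qed.

Lemma unif_finite_invol f : unif_finite f -> unif_finite (invol f).
Proof. by move=> [n [s /unif_finite_by_invol h]]; exists n, s. Qed.

Lemma unif_finite_add f h : unif_finite f -> unif_finite h -> unif_finite (f \+ h).
Proof.
move=> [n [s [rf cf sf]]] [m [t [rh ch sh]]]; exists (n + m)%N, (2 * s + 2 * t).
have sub (P : G -> Prop) : [set g | P g /\ (f \+ h) g != 0] `<=`
    [set g | P g /\ f g != 0] `|` [set g | P g /\ h g != 0].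
  move=> g [Pg]; have [f0|] := eqVneq (f g) 0; last by left.
  by move=> h0; right; split=> //; move: h0; rewrite /= f0 add0r.
split.
- by move=> y; apply: at_most_sub (at_mostU (rf y) (rh y)); exact: sub.
- by move=> y; apply: at_most_sub (at_mostU (cf y) (ch y)); exact: sub.
- by move=> g; rewrite (le_trans (nsqD_le2 _ _))// lerD// ler_wpM2l.
Qed.

Lemma unif_finite_scale (z : C) f : unif_finite f -> unif_finite (z \*: f).
Proof.
move=> [n [s [rf cf sf]]]; exists n, (nsq z * s); split.
- move=> y; apply: at_most_sub (rf y) => g [gy /=]; rewrite mulf_eq0.
  by case/norP.
- move=> y; apply: at_most_sub (cf y) => g [gy /=]; rewrite mulf_eq0.
  by case/norP.
- by move=> g; rewrite [X in nsq X]/GRing.scale/= nsqM ler_wpM2l ?nsq_ge0.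
Qed.

Lemma unif_finite_conv f h : unif_finite f -> unif_finite h -> unif_finite (conv f h).
Proof.
move=> [n [s [rf cf sf]]] [m [t [rh ch sh]]]; exists (n * m)%N, (n%:R * (n%:R * (s * t))).
split.
- move=> y; apply: (at_most_bind (rf y)
    (Q := fun k => [set g | rng g = y /\ h (gmul (ginv k) g) != 0])).
    move=> k [ky fk]; apply: (at_most_image (f := gmul k) (rh (src k))).
    move=> g [gy hg]; exists (gmul (ginv k) g); last by rewrite gmulKV// ky.
    by split=> //; rewrite rng_gmul// src_ginv ky.
  move=> g [gy /conv_neq0[k [l [kl ge fk hl]]]]; exists k.
    by split=> //; rewrite -gy ge rng_gmul.
  by rewrite /= ge gmulVK//; split=> //; rewrite -ge.
- move=> y; rewrite mulnC; apply: (at_most_bind (ch y)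
    (Q := fun k => [set g | src g = y /\ f (gmul g (ginv k)) != 0])).
    move=> k [ky fk]; apply: (at_most_image (f := fun l => gmul l k) (cf (rng k))).
    move=> g [gy hg]; exists (gmul g (ginv k)); last by rewrite gmulVr// ky.
    by split=> //; rewrite src_gmul// rng_ginv ky.
  move=> g [gy /conv_neq0[k [l [kl ge fk hl]]]]; exists l.
    by split=> //; rewrite -gy ge src_gmul.
  by rewrite /= ge gmulK//; split=> //; rewrite -ge.
- move=> g; have [l [ul sl lP]] := at_most_exact (rf (rng g)).
  have ls : s * t >= 0.
    by apply: mulr_ge0; [apply: le_trans (sf g)|apply: le_trans (sh g)]; exact: nsq_ge0.
  rewrite (@conv_row _ _ _ l)//; first last.
  + move=> k kg kl; apply/eqP; rewrite mulf_eq0; apply/orP; left.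
    by apply: contraNT kl => fk; apply/lP.
  + by move=> k /lP[].
  apply: (le_trans (nsq_sum _ _)); apply: ler_pM => //.
  + by rewrite sumr_ge0// => k _; exact: nsq_ge0.
  + by rewrite ler_nat.
  apply: (@le_trans _ _ (\sum_(k <- l) s * t)).
    by apply: ler_sum => k _; rewrite nsqM ler_pM ?nsq_ge0.
  rewrite big_const_seq count_predT iter_addr_0 -[leLHS]mulr_natl ler_wpM2r//.
  by rewrite ler_nat.
Qed.

End conv_sums.

(** * Operator bounds without square roots *)

Section conv_algebra.
Context {R : realType} {X : topologicalType} {phi : X -> X}.
Local Notation C := R[i].
Local Notation G := (groupoid phi).
Implicit Types (f h xi : G -> C) (K L : R).

Definition row_list f y (l : seq G) := [/\ uniq l,
  forall k, k \in l -> rng k = y & forall k, rng k = y -> f k != 0 -> k \in l].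

Lemma unif_finite_row_list f y : unif_finite f -> exists l, row_list f y l.
Proof.
move=> [n [s [rf _ _]]]; have [l [ul _ lP]] := at_most_exact (rf y).
by exists l; split=> // k; [move/lP => []|move=> ky fk; apply/lP].
Qed.

Lemma unif_finite_row_list2 f h y : unif_finite f -> unif_finite h ->
  exists l, row_list f y l /\ row_list h y l.
Proof.
move=> [n [s [rf _ _]]] [m [t [rh _ _]]].
have [l [ul _ lP]] := at_most_exact (at_mostU (rf y) (rh y)).
exists l; split; split=> // k; first by move/lP => [[]|[]].
- by move=> ky fk; apply/lP; left.
- by move/lP => [[]|[]].
- by move=> ky fk; apply/lP; right.
Qed.

Lemma conv_rowl f xi g l : row_list f (rng g) l ->
  conv f xi g = \sum_(k <- l) f k * xi (gmul (ginv k) g).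
Proof.
move=> [ul lr lP]; apply: conv_row => // k kg kl; apply/eqP.
by rewrite mulf_eq0; apply/orP; left; apply: contraNT kl; exact: lP.
Qed.

Lemma convDl f h xi : unif_finite f -> unif_finite h ->
  conv (f \+ h) xi = conv f xi \+ conv h xi.
Proof.
move=> Ff Fh; apply/funext => g.
have [l [lf lh]] := unif_finite_row_list2 (rng g) Ff Fh.
rewrite /= (conv_rowl _ lf) (conv_rowl _ lh) -big_split /=.
case: lf lh => ul lr lf [_ _ lh].
rewrite (@conv_row _ _ _ _ _ _ l)//; last first.
  move=> k kg kl /=; have /eqP -> : f k == 0 by apply: contraNT kl; exact: lf.
  have /eqP -> : h k == 0 by apply: contraNT kl; exact: lh.
  by rewrite addr0 mul0r.
by apply: eq_bigr => k _; rewrite mulrDl.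
Qed.

Lemma convZl (z : C) f xi : conv (z \*: f) xi = z \*: conv f xi.
Proof.
apply/funext => g; rewrite /conv /= [RHS]mulr_fsumr.
by apply: eq_fsbigr => p _; rewrite [X in X * _]/GRing.scale/= mulrA.
Qed.

Lemma convZr (z : C) f xi : conv f (z \*: xi) = z \*: conv f xi.
Proof.
apply/funext => g; rewrite /conv /= [RHS]mulr_fsumr.
by apply: eq_fsbigr => p _; rewrite [X in _ * X]/GRing.scale/= mulrCA.
Qed.

Lemma convDr f xi eta : unif_finite f -> conv f (xi \+ eta) = conv f xi \+ conv f eta.
Proof.
move=> Ff; apply/funext => g; have [l lf] := unif_finite_row_list (rng g) Ff.
rewrite /= !(conv_rowl _ lf) -big_split /=.
by apply: eq_bigr => k _; rewrite mulrDr.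
Qed.

(** The row bounds of f and h provide finite lists of arrows that contain all
    nonzero terms whatever xi is, and the sums over them may be exchanged. *)
Lemma convA f h xi : unif_finite f -> unif_finite h ->
  conv (conv f h) xi = conv f (conv h xi).
Proof.
move=> Ff Fh; apply/funext => g.
have [l lf] := unif_finite_row_list (rng g) Ff; have [ul lr lP] := lf.
have [M [uM Mr MP]] : exists M : seq G, [/\ uniq M,
    forall k, k \in M -> rng k = rng g &
    forall k m, k \in l -> src k = rng m -> h m != 0 -> gmul k m \in M].
  have [n [s [rh _ _]]] := Fh.
  have [|M [uM MP]] := @finite_union n G G l
      (fun k => [set m | exists2 m', m = gmul k m' & rng m' = src k /\ h m' != 0]).
    move=> k _; apply: (at_most_image (f := gmul k) (rh (src k))).
    by move=> m [m' -> [? ?]]; exists m'.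
  exists M; split=> //.
  - by move=> k /MP[k' /lr e [m -> [em _]]]; rewrite rng_gmul.
  - by move=> k m kl e hm0; apply/MP; exists k => //; exists m.
rewrite (@conv_row _ _ _ _ _ _ M)//; last first.
  move=> k kg kM; apply/eqP; rewrite mulf_eq0; apply/orP; left.
  apply: contraNT kM => /conv_neq0[k' [m [e ke fk hm]]].
  by rewrite ke; apply: MP => //; apply: lP => //; rewrite -kg ke rng_gmul.
rewrite [RHS](conv_rowl _ lf).
transitivity (\sum_(k <- M) \sum_(m <- l)
    f m * h (gmul (ginv m) k) * xi (gmul (ginv k) g)).
  apply: eq_big_seq => k kM.
  by rewrite (@conv_rowl _ _ _ l) ?mulr_suml// (Mr k kM).
rewrite exchange_big /=; apply: eq_big_seq => m ml.
rewrite (@conv_row _ _ _ _ _ _ [seq gmul (ginv m) k | k <- M]).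
- rewrite mulr_sumr big_map; apply: eq_big_seq => k kM.
  have mk : rng m = rng k by rewrite (lr m)// (Mr k).
  have kg : rng k = rng g by rewrite (Mr k).
  rewrite -mulrA; congr (_ * (_ * xi _)).
  by rewrite ginvM ?ginvK// -gmulA ?gmulKV// ?mk ?kg// rng_gmul ?src_ginv ?mk.
- rewrite map_inj_in_uniq// => k k' kM kM' e.
  have mk : rng m = rng k by rewrite (lr m)// (Mr k).
  have mk' : rng m = rng k' by rewrite (lr m)// (Mr k').
  by rewrite -(gmulKV mk) e gmulKV.
- move=> k /mapP[k' kM ->]; have mk : rng m = rng k' by rewrite (lr m)// (Mr k').
  by rewrite !rng_gmul// ?src_ginv ?mk ?(Mr k').
- move=> k km kM; apply/eqP; rewrite mulf_eq0; apply/orP; left.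
  apply: contraNT kM => hk; have e : src m = rng k.
    by rewrite km rng_gmul// src_ginv (lr m).
  by apply/mapP; exists (gmul m k); [exact: MP|rewrite gmulVK].
Qed.

Definition fibre_vec (x : X) xi := forall g, src g <> x -> xi g = 0.

Definition l2_le xi (c : R) :=
  forall l : seq G, uniq l -> \sum_(g <- l) nsq (xi g) <= c.

(** The norm of pi_x f is at most K for all x. Stated with squares and finite
    sums, the bound involves neither suprema nor infinite series. *)
Definition op_le f K :=
  forall x xi c, fibre_vec x xi -> l2_le xi c -> l2_le (conv f xi) (K ^+ 2 * c).

Lemma fibre_vec_conv x f xi : fibre_vec x xi -> fibre_vec x (conv f xi).
Proof.
move=> vx g gx; apply: contrapT => /eqP/conv_neq0[k [l [kl ge _ /eqP]]].
by apply; apply: vx => lx; apply: gx; rewrite ge src_gmul.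
Qed.

Lemma l2_le_ge0 xi c : l2_le xi c -> 0 <= c.
Proof. by move=> /(_ [::] isT); rewrite big_nil. Qed.

Lemma l2_le_nsq xi c g : l2_le xi c -> nsq (xi g) <= c.
Proof. by move=> /(_ [:: g] isT); rewrite big_seq1. Qed.

Lemma l2_le0 xi g : l2_le xi 0 -> xi g = 0.
Proof.
move=> /(@l2_le_nsq _ _ g) h; apply/eqP; rewrite -nsq_eq0.
by rewrite eq_le h nsq_ge0.
Qed.

Lemma l2_leD xi eta c d t : 0 < t -> l2_le xi c -> l2_le eta d ->
  l2_le (xi \+ eta) ((1 + t) * c + (1 + t^-1) * d).
Proof.
move=> t0 hx he l ul.
apply: (@le_trans _ _ (\sum_(g <- l) ((1 + t) * nsq (xi g) + (1 + t^-1) * nsq (eta g)))).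
  by apply: ler_sum => g _; exact: nsqD_le.
rewrite big_split -!mulr_sumr lerD// ler_wpM2l ?addr_ge0 ?invr_ge0 ?(ltW t0)//.
- exact: hx.
- exact: he.
Qed.

Lemma l2_leZ z xi c : l2_le xi c -> l2_le (z \*: xi) (nsq z * c).
Proof.
move=> h l ul; under eq_bigr do rewrite [X in nsq X]/GRing.scale/= nsqM.
by rewrite -mulr_sumr ler_wpM2l ?nsq_ge0 ?h.
Qed.

Lemma l2norm_le xi K : 0 <= K -> (l2norm xi <= K%:E)%E <-> l2_le xi (K ^+ 2).
Proof.
move=> K0; rewrite /l2norm.
have -> : K%:E = sqrte (K ^+ 2)%:E by rewrite /= sqrtr_sqr ger0_norm.
rewrite lee_sqrt ?lee_fin ?sqr_ge0//.
have E g : complex.Re (`|xi g| ^+ 2) = nsq (xi g) by rewrite -nsqE.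
split.
  move=> h l ul; rewrite -lee_fin; apply: le_trans h; apply: esum_ge.
  exists [set` l]; first by split=> //; exact: finite_seq.
  rewrite fsumEFin ?lee_fin; last exact: finite_seq.
  by rewrite [leLHS]fsbig_seq//; under eq_fsbigr do rewrite -E.
move=> h; apply: ge_ereal_sup => _ [A [fA _] <-].
rewrite fsumEFin// lee_fin fsbig_finite//.
by under eq_bigr do rewrite E; apply: h; exact: fset_uniq.
Qed.

(** The reduced norm tests unit vectors only: other vectors are rescaled, and
    those with c = 0 vanish. *)
Lemma reduced_norm_le f K : 0 <= K -> (reduced_norm f <= K%:E)%E <-> op_le f K.
Proof.
move=> K0; split=> [h x xi c vx hc|h]; last first.
  apply: ge_ereal_sup => _ [x _ <-]; apply: ge_ereal_sup => _ [xi [[vx _] h1] <-].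
  apply/l2norm_le => //; rewrite -[K ^+ 2]mulr1; apply: (h x) => //.
  by rewrite -[X in l2_le _ X](expr1n _ 2); apply/l2norm_le.
have c0 := l2_le_ge0 hc; have [ce|cn] := eqVneq c 0.
  have -> : conv f xi = fun=> 0.
    apply/funext => g; rewrite /conv fsbig1// => p _.
    by rewrite (@l2_le0 _ p.2) ?mulr0// -ce.
  rewrite ce mulr0 => l ul; rewrite big1// => g _; exact: nsq0.
have cp : 0 < c by rewrite lt_def cn.
pose z : C := ((Num.sqrt c)^-1)%:C.
have nz : nsq z = c^-1 by rewrite nsqR exprVn sqr_sqrtr.
have vz : fibre_vec x (z \*: xi) by move=> g /vx /= ->; rewrite scaler0.
have h1 : (l2norm (z \*: xi)%R <= 1)%E.
  by apply/l2norm_le => //; rewrite expr1n -(mulVf cn) -nz; exact: l2_leZ.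
have h2 : (l2norm (conv f (z \*: xi)) <= K%:E)%E.
  apply: le_trans h; apply: (@le_trans _ _ (pi_norm x f)).
    apply: ereal_sup_ubound; exists (z \*: xi) => //; split=> //; split=> //.
    exact: le_lt_trans h1 (ltry _).
  by apply: ereal_sup_ubound; exists x.
move/(l2norm_le _ K0) : h2; rewrite convZr => /(@l2_leZ z^-1).
have -> : nsq z^-1 = c.
  apply: (@mulfI _ (nsq z)); first by rewrite nz invr_eq0.
  rewrite -nsqM divff; last by rewrite -nsq_eq0 nz invr_eq0.
  by rewrite nz mulVf// /nsq /= expr1n expr0n addr0.
rewrite mulrC; congr (l2_le _ _); apply/funext => g /=.
by rewrite scalerA mulVf ?scale1r// -nsq_eq0 nz invr_eq0.
Qed.

Lemma op_le_trans f K L : 0 <= K -> K <= L -> op_le f K -> op_le f L.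
Proof.
move=> K0 KL h; apply/reduced_norm_le; first exact: le_trans KL.
by move/reduced_norm_le : h => /(_ K0)/le_trans; apply; rewrite lee_fin.
Qed.

(** L / K is the weight for which the two bounds add up to (K + L)^2. *)
Lemma op_leD f h K L : unif_finite f -> unif_finite h -> 0 < K -> 0 < L ->
  op_le f K -> op_le h L -> op_le (f \+ h) (K + L).
Proof.
move=> Ff Fh K0 L0 hf hh x xi c vx hc; rewrite convDl//.
have t0 : 0 < L / K by rewrite divr_gt0.
have -> : (K + L) ^+ 2 * c =
    (1 + L / K) * (K ^+ 2 * c) + (1 + (L / K)^-1) * (L ^+ 2 * c).
  by field; rewrite !gt_eqF.
by apply: l2_leD => //; [exact: (hf x)|exact: (hh x)].
Qed.

Lemma op_leZ z f K L : nsq z <= L ^+ 2 -> op_le f K -> op_le (z \*: f) (L * K).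
Proof.
move=> zL h x xi c vx hc l ul; rewrite convZl.
apply: le_trans (l2_leZ z (h x xi c vx hc) ul) _.
rewrite exprMn -[leRHS]mulrA ler_wpM2r// mulr_ge0 ?sqr_ge0//; exact: l2_le_ge0 hc.
Qed.

Lemma op_le_conv f h K L : unif_finite f -> unif_finite h -> op_le f K -> op_le h L ->
  op_le (conv f h) (K * L).
Proof.
move=> Ff Fh hf hh x xi c vx hc; rewrite convA// exprMn -mulrA.
by apply: (hf x); [exact: fibre_vec_conv|exact: (hh x)].
Qed.

(** Let eta be the part on l of the image of ze under the adjoint, and S its
    squared norm. Then S is the inner product of f eta with ze, so
    2 S <= |f eta|^2 / K^2 + K^2 |ze|^2 <= S + K^2 c. *)
Lemma op_le_invol f K : unif_finite f -> 0 < K -> op_le f K -> op_le (invol f) K.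
Proof.
move=> Ff K0 hf x ze c vx hc l0 ul0.
pose l := [seq g <- l0 | src g == x].
have ul : uniq l by rewrite filter_uniq.
have lx g : g \in l -> src g = x by rewrite mem_filter => /andP[/eqP].
pose eta g : C := if g \in l then conv (invol f) ze g else 0.
have -> : \sum_(g <- l0) nsq (conv (invol f) ze g) = \sum_(g <- l) nsq (eta g).
  rewrite [RHS]big_seq; under [RHS]eq_bigr => g gl do rewrite /eta gl.
  rewrite -big_seq big_filter [RHS]big_mkcond; apply: eq_bigr => g _.
  by case: eqP => // /(fibre_vec_conv (invol f) vx) ->; rewrite nsq0.
set S := \sum_(g <- l) nsq (eta g).
have veta : fibre_vec x eta.
  by move=> g gx; rewrite /eta ifF//; apply/negP => /lx.
have heta : l2_le eta S.
  move=> k uk; rewrite (bigID (mem l))/= [X in _ + X]big1 ?addr0; last first.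
    by move=> g gl; rewrite /eta (negPf gl) nsq0.
  rewrite -big_filter.
  have e : perm_eq [seq g <- k | g \in l] [seq g <- l | g \in k].
    apply: uniq_perm; rewrite ?filter_uniq// => g.
    by rewrite !mem_filter andbC.
  rewrite (perm_big _ e) /= big_filter /S [leRHS](bigID (mem k))/= lerDl.
  by rewrite sumr_ge0// => g _; exact: nsq_ge0.
have [M [uM Mx MP]] : exists M : seq G, [/\ uniq M,
    forall p, p \in M -> src p = x
  & forall g p, g \in l -> src p = x -> f (gmul p (ginv g)) != 0 -> p \in M].
  have [n [s [_ cf _]]] := Ff.
  have [|M [uM MP]] := @finite_union n G G l
      (fun g => [set p | src p = x /\ f (gmul p (ginv g)) != 0]).
    move=> g /lx gx; apply: (at_most_image (f := fun k => gmul k g) (cf (rng g))).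
    move=> p [px fp]; exists (gmul p (ginv g)); last by rewrite gmulVr ?gx.
    by split=> //; rewrite src_gmul ?rng_ginv ?gx.
  by exists M; split=> // [p /MP[g _ []]|g p gl px fp]//; apply/MP; exists g.
have E1 g : g \in l ->
    conv (invol f) ze g = \sum_(p <- M) (f (gmul p (ginv g)))^* * ze p.
  move=> gl; have gx := lx _ gl.
  have I p : src p = x -> invol f (gmul g (ginv p)) = (f (gmul p (ginv g)))^*.
    by move=> px; rewrite /invol ginvM ?ginvK// rng_ginv gx.
  rewrite (@conv_col _ _ _ _ _ _ M)//.
  - by apply: eq_big_seq => p /Mx px; rewrite I.
  - by move=> p /Mx ->.
  - move=> p px pM; rewrite I ?px//; apply/eqP; rewrite mulf_eq0; apply/orP; left.
    by rewrite conjc_eq0; apply: contraNT pM => fp; apply: MP fp => //; rewrite px.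
have E2 p : p \in M -> conv f eta p = \sum_(g <- l) f (gmul p (ginv g)) * eta g.
  move=> /Mx px; apply: conv_col => //; first by move=> g /lx ->.
  by move=> g gx gl; rewrite /eta (negPf gl) mulr0.
have SE : S%:C = \sum_(p <- M) (conv f eta p)^* * ze p.
  rewrite /S rmorph_sum /=.
  transitivity (\sum_(g <- l) \sum_(p <- M)
      (eta g)^* * ((f (gmul p (ginv g)))^* * ze p)).
    apply: eq_big_seq => g gl; rewrite nsqJ_mul -mulr_sumr -E1//.
    by rewrite [in X in _ * X]/eta gl.
  rewrite exchange_big /=; apply: eq_big_seq => p pM.
  rewrite E2// rmorph_sum mulr_suml; apply: eq_bigr => g _.
  by rewrite rmorphM/= mulrA [_^* * _^*]mulrC.
have K2 : 0 < K ^+ 2 by rewrite exprn_gt0.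
have : 2 * S <= K ^+ 2 * c + S.
  have -> : S = complex.Re S%:C by [].
  have He := hf x _ _ veta heta M uM; have Hz := hc M uM.
  rewrite {1}SE (raddf_sum (@complex.Re R : Rcomplex R -> R)) /=.
  apply: (@le_trans _ _ (\sum_(p <- M)
      (K ^+ 2 * nsq (ze p) + (K ^+ 2)^-1 * nsq (conv f eta p)))).
    rewrite mulr_sumr; apply: ler_sum => p _.
    case: (conv f eta p) (ze p) => [a b] [a' b']; rewrite /nsq /=.
    have h (u v : R) : 2 * (u * v) <= K ^+ 2 * v ^+ 2 + (K ^+ 2)^-1 * u ^+ 2.
      have e : K ^+ 2 * v ^+ 2 + (K ^+ 2)^-1 * u ^+ 2 - 2 * (u * v) =
         K ^+ 2 * (v - (K ^+ 2)^-1 * u) ^+ 2 by field; rewrite gt_eqF.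
      by rewrite -subr_ge0 e mulr_ge0 ?sqr_ge0.
    have := h a a'; have := h b b'; nra.
  rewrite big_split -!mulr_sumr /= lerD// ?ler_wpM2l ?sqr_ge0//.
  by rewrite mulrC ler_pdivrMr// mulrC.
by rewrite mulr2n mulrDl mul1r lerD2r.
Qed.

(** The Schur test: Cauchy-Schwarz on a row costs a factor n, and each
    coordinate of xi occurs in at most n rows. *)
Lemma op_le_unif_finite n s f K : unif_finite_by n s f ->
  n%:R * n%:R * s <= K ^+ 2 -> op_le f K.
Proof.
move=> [rf cf sf] sK x xi c vx hc l ul.
have [->|[g0 g0l]] : l = [::] \/ exists g, g \in l.
  by case: (l) => [|g m]; [left|right; exists g; rewrite mem_head].
  by rewrite big_nil mulr_ge0 ?sqr_ge0//; exact: l2_le_ge0 hc.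
have s0 : 0 <= s by exact: le_trans (nsq_ge0 _) (sf g0).
have /choice[r rP] (g : G) : exists r : seq G, [/\ uniq r, (size r <= n)%N &
    forall q, q \in r <-> src q = src g /\ f (gmul g (ginv q)) != 0].
  apply: at_most_exact; apply: (at_most_image
    (f := fun k => gmul (ginv k) g) (rf (rng g))).
  move=> q [qg fq]; exists (gmul g (ginv q)); first by rewrite /= rng_gmul.
  by rewrite ginvM// ginvK -gmulA// ?rng_ginv// gmulVg -qg; apply: gpd_eq;
    rewrite ?(rng_gmul, deg_gmul, src_gmul)// addr0.
pose Q := undup (flatten (map r l)).
have QP g q : g \in l -> q \in r g -> q \in Q.
  by move=> gl qr; rewrite mem_undup; apply/flattenP; exists (r g) => //; apply: map_f.
apply: (@le_trans _ _ (\sum_(g <- l) \sum_(q <- Q | q \in r g)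
    (n%:R * s) * nsq (xi q))).
  rewrite big_seq [leRHS]big_seq; apply: ler_sum => g gl; have [ur sr rgP] := rP g.
  rewrite (@conv_col _ _ _ _ _ _ (r g))//; first last.
  - move=> q qg qr; apply/eqP; rewrite mulf_eq0; apply/orP; left.
    by apply: contraNT qr => fq; apply/rgP.
  - by move=> q /rgP[].
  apply: le_trans (nsq_sum _ _) _.
  have -> : \sum_(q <- Q | q \in r g) n%:R * s * nsq (xi q) =
      \sum_(q <- r g) n%:R * s * nsq (xi q).
    rewrite -big_filter; apply: perm_big; apply: uniq_perm => //.
      by rewrite filter_uniq// undup_uniq.
    by move=> q; rewrite mem_filter; apply/andb_idr; exact: QP.
  rewrite -mulr_sumr -mulrA ler_pM ?ler_nat ?sumr_ge0//.
    by move=> q _; exact: nsq_ge0.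
  rewrite mulr_sumr; apply: ler_sum => q _.
  by rewrite nsqM ler_wpM2r ?nsq_ge0.
under eq_bigr do rewrite big_mkcond.
rewrite exchange_big /=.
apply: (@le_trans _ _ (\sum_(q <- Q) (n%:R * n%:R * s) * nsq (xi q))).
  apply: ler_sum => q _; rewrite -big_mkcond /= -big_filter.
  rewrite big_const_seq count_predT iter_addr_0 -[leLHS]mulr_natl.
  rewrite -!mulrA ler_wpM2r ?mulr_ge0 ?nsq_ge0//.
  rewrite ler_nat; have [w [uw sw wP]] := at_most_exact (at_most_image
    (f := fun k => gmul k q) (cf (rng q)) (Q := [set g | q \in r g])
    ltac:(move=> g; case: (rP g) => _ _ h /h[qg fq];
      exists (gmul g (ginv q)); [by split=> //; rewrite src_gmul|by rewrite gmulVr])).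
  apply: leq_trans sw; apply: uniq_leq_size; first by rewrite filter_uniq.
  by move=> g; rewrite mem_filter => /andP[qr _]; apply/wP.
rewrite -mulr_sumr ler_pM ?mulr_ge0 ?sumr_ge0//.
- by move=> q _; exact: nsq_ge0.
- by apply: hc; exact: undup_uniq.
Qed.

Lemma unif_finite_op_le f : unif_finite f -> exists2 K, 0 < K & op_le f K.
Proof.
move=> [n [s h]]; exists (1 + n%:R * n%:R * `|s|).
  by rewrite ltr_wpDr ?mulr_ge0.
apply: (op_le_unif_finite h); set a := _ * n%:R.
have a0 : 0 <= a by rewrite mulr_ge0.
have : a * s <= a * `|s| by rewrite ler_wpM2l// ler_norm.
have : 0 <= a * `|s| by rewrite mulr_ge0.
set b := a * `|s| => b0 h1; nra.
Qed.

(** The value f g is a coordinate of the image of the point mass at the unit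
    over the source of g. *)
Lemma op_le_nsq f K g : op_le f K -> nsq (f g) <= K ^+ 2.
Proof.
move=> h; pose u := gunit (phi := phi) (src g).
pose xi k : C := if k == u then 1 else 0.
have e : conv f xi g = f g.
  rewrite (@conv_col _ _ _ _ _ _ [:: u])//.
  - rewrite big_seq1 /xi eqxx mulr1; congr f; apply: gpd_eq;
      by rewrite ?(rng_gmul, deg_gmul, src_gmul)// addr0.
  - by move=> k; rewrite inE => /eqP ->.
  - by move=> k _; rewrite inE /xi => /negPf ->; rewrite mulr0.
have vx : fibre_vec (src g) xi.
  by move=> k; rewrite /xi; case: eqP => // ->.
have h1 : l2_le xi 1.
  move=> l ul; rewrite (bigID (pred1 u))/= [X in _ + X]big1 ?addr0; last first.
    by move=> k /negPf ku; rewrite /xi ku nsq0.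
  under eq_bigr => k ku do rewrite /xi ku.
  have -> : nsq (1 : C) = 1 by rewrite /nsq /= expr1n expr0n addr0.
  rewrite big_const_seq iter_addr_0 (count_uniq_mem _ ul).
  by case: (u \in l); rewrite ?mulr1n ?mulr0n.
by have := l2_le_nsq g (h _ _ _ vx h1); rewrite e mulr1.
Qed.

End conv_algebra.

(** * The real Stone-Weierstrass theorem *)

(** If P K failed, the sets whose complement in K satisfies P would form a proper
    filter, and P would fail near a cluster point of it. *)
Lemma compact_ind (T : topologicalType) (K : set T) (P : set T -> Prop) :
  compact K -> P set0 -> (forall U V, P U -> P V -> P (U `|` V)) ->
  (forall U V, U `<=` V -> P V -> P U) ->
  (forall x, K x -> exists2 U, nbhs x U & P U) -> P K.
Proof.
move=> cK P0 PU Psub Ploc; apply: contrapT => nPK.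
pose F : set_system T := [set A | P (K `\` A)].
have FF : ProperFilter F.
  split; first by move=> h; apply: nPK; apply: Psub h => x Kx; split.
  split.
  - by apply: Psub P0 => x [_] /(_ I).
  - move=> A B FA FB; apply: Psub (PU _ _ FA FB) => x [Kx nAB].
    by have [Ax|] := pselect (A x); [right; split=> // Bx; apply: nAB|left].
  - by move=> A B AB; apply: Psub => x [Kx nB]; split=> // /AB.
have FK : F K by apply: Psub P0 => x [].
have [x [Kx clx]] := cK _ FF FK; have [U nU PUx] := Ploc x Kx.
have FU : F (~` U) by apply: Psub PUx => z [_ /contrapT].
by have [z []] := clx _ _ FU nU.
Qed.

Section stone_weierstrass_real.
Context {R : realType} {T : topologicalType} (K : set T).
Implicit Types f g h : T -> R.

(** Polynomials in t that increase to the absolute value of t on [-1, 1]. *)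
Fixpoint abs_approx (n : nat) (t : R) : R :=
  if n is m.+1 then abs_approx m t + (t ^+ 2 - abs_approx m t ^+ 2) / 2 else 0.

(** With s = |t|, one step multiplies the error s - p by
    1 - (s + p) / 2 <= 1 - (s - p) / 2, which keeps it below 2 / (n + 2). *)
Lemma abs_approxP n t : `|t| <= 1 ->
  [/\ 0 <= abs_approx n t, abs_approx n t <= `|t|
    & (`|t| - abs_approx n t) * n.+2%:R <= 2].
Proof.
move=> t1; have t0 := normr_ge0 t.
have tt : t ^+ 2 = `|t| ^+ 2 by rewrite real_normK ?num_real.
elim: n => [|n [h1 h2 h3]] /=; first by split=> //; nra.
rewrite tt; move: h1 h2 h3 t0 t1; set p := abs_approx n t; set s := `|t|.
move=> h1 h2 h3 t0 t1.
have h4 : s - p <= 1 by nra.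
split; [nra|nra|].
have -> : n.+3%:R = n.+2%:R + 1 :> R by rewrite natr1.
set m := n.+2%:R in h3 *.
have m0 : 0 <= m by rewrite ler0n.
have h5 : s - (p + (s ^+ 2 - p ^+ 2) / 2) <= (s - p) * (1 - (s - p) / 2) by nra.
apply: (@le_trans _ _ ((s - p) * (1 - (s - p) / 2) * (m + 1))).
  by rewrite ler_wpM2r// addr_ge0.
have d0 : 0 <= s - p by lra.
move: h3 h4 d0; set d := s - p => h3 h4 d0.
have -> : d * (1 - d / 2) * (m + 1) = 2 - (2 - d * m) * (1 - d / 2) - d ^+ 2 / 2.
  by field.
have : 0 <= (2 - d * m) * (1 - d / 2) by rewrite mulr_ge0//; lra.
have := sqr_ge0 d; lra.
Qed.

Variable A : set (T -> R).
Hypothesis compactK : compact K.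
Hypothesis A_cont : forall f, A f -> continuous f.
Hypothesis A_cst : forall r : R, A (fun=> r).
Hypothesis A_add : forall f g, A f -> A g -> A (fun x => f x + g x).
Hypothesis A_mul : forall f g, A f -> A g -> A (fun x => f x * g x).

Let near_cont f x (e : R) : continuous f -> 0 < e ->
  \forall z \near x, `|f x - f z| < e.
Proof. by move=> cf e0; have /cvgrPdist_lt := cf x; exact. Qed.

Lemma cont_bounded_on f : continuous f ->
  exists2 M : R, 0 < M & forall x, K x -> `|f x| <= M.
Proof.
move=> cf; apply: (@compact_ind _ K
  (fun U => exists2 M : R, 0 < M & forall x, U x -> `|f x| <= M) compactK).
- by exists 1.
- move=> U V [M M0 h] [N N0 k]; exists (M + N); first exact: addr_gt0.
  by move=> x [/h|/k] le; rewrite (le_trans le)// ?lerDl ?lerDr ltW.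
- by move=> U V UV [M M0 h]; exists M => // x /UV/h.
move=> x Kx; exists [set z | `|f x - f z| < 1]; first exact: near_cont.
exists (`|f x| + 1); first by rewrite ltr_wpDl.
move=> z /= fz; have -> : f z = f x - (f x - f z) by ring.
by rewrite (le_trans (ler_normB _ _))// lerD2l ltW.
Qed.

Let unif_closure f := forall e, 0 < e -> exists2 h, A h & forall x, K x ->
  `|f x - h x| <= e.

Let unif_closure_sub f : A f -> unif_closure f.
Proof. by move=> Af e e0; exists f => // x _; rewrite subrr normr0 ltW. Qed.

Let unif_closure_ucl f :
  (forall e, 0 < e -> exists2 h, unif_closure h & forall x, K x -> `|f x - h x| <= e) -> unif_closure f.
Proof.
move=> h e e0; have e2 : 0 < e / 2 by rewrite divr_gt0.
have [g ug fg] := h _ e2; have [k Ak gk] := ug _ e2.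
exists k => // x Kx; have -> : f x - k x = (f x - g x) + (g x - k x) by ring.
by rewrite (le_trans (ler_normD _ _))// [leRHS]splitr lerD ?fg ?gk.
Qed.

Let unif_closure_add f g : unif_closure f -> unif_closure g ->
  unif_closure (fun x => f x + g x).
Proof.
move=> uf ug e e0; have e2 : 0 < e / 2 by rewrite divr_gt0.
have [h Ah fh] := uf _ e2; have [k Ak gk] := ug _ e2.
exists (fun x => h x + k x); first exact: A_add.
move=> x Kx; have -> : f x + g x - (h x + k x) = (f x - h x) + (g x - k x) by ring.
by rewrite (le_trans (ler_normD _ _))// [leRHS]splitr lerD ?fh ?gk.
Qed.

Let unif_closure_scale (r : R) f : unif_closure f -> unif_closure (fun x => r * f x).
Proof.
move=> uf e e0; have r0 : 0 < `|r| + 1 by rewrite ltr_wpDl.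
have [h Ah fh] := uf (e / (`|r| + 1)) (divr_gt0 e0 r0).
exists (fun x => r * h x); first by apply: A_mul => //; exact: A_cst.
move=> x Kx; rewrite -mulrBr normrM.
apply: (@le_trans _ _ ((`|r| + 1) * (e / (`|r| + 1)))).
  by rewrite ler_pM ?fh// lerDl.
by rewrite mulrC divfK// gt_eqF.
Qed.

Let A_abs_approx n f : A f -> A (fun x => abs_approx n (f x)).
Proof.
move=> Af; elim: n => [|n IH] /=; first exact: A_cst.
apply: A_add => //.
have -> : (fun x => (f x ^+ 2 - abs_approx n (f x) ^+ 2) / 2) =
   (fun x => 2^-1 * (f x * f x + (-1) * (abs_approx n (f x) * abs_approx n (f x)))).
  by apply/funext => x; ring.
apply: A_mul; first exact: A_cst.
by apply: A_add; [exact: A_mul|apply: A_mul; [exact: A_cst|exact: A_mul]].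
Qed.

Let unif_closure_abs f : unif_closure f -> unif_closure (fun x => `|f x|).
Proof.
move=> uf; apply: unif_closure_ucl => e e0; have [h Ah fh] := uf e e0.
exists (fun x => `|h x|); last first.
  move=> x Kx; apply: le_trans (fh x Kx); exact: ler_dist_dist.
have [M M0 hM] := cont_bounded_on (A_cont Ah).
have -> : (fun x => `|h x|) = (fun x => M * `|M^-1 * h x|).
  apply/funext => x; rewrite normrM gtr0_norm ?invr_gt0// mulrA divff ?mul1r//.
  by rewrite gt_eqF.
apply: unif_closure_scale; have Ag : A (fun x => M^-1 * h x) by apply: A_mul.
move=> d d0; pose n := Num.bound (2 / d).
exists (fun x => abs_approx n (M^-1 * h x)); first exact: A_abs_approx.
move=> x Kx; have [h1 h2 h3] : [/\ 0 <= abs_approx n (M^-1 * h x),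
   abs_approx n (M^-1 * h x) <= `|M^-1 * h x| &
   (`|M^-1 * h x| - abs_approx n (M^-1 * h x)) * n.+2%:R <= 2].
  apply: abs_approxP; rewrite normrM gtr0_norm ?invr_gt0//.
  by rewrite mulrC ler_pdivrMr// mul1r hM.
rewrite ger0_norm ?subr_ge0//.
have hn : 2 / d < n%:R by apply: archi_boundP; rewrite ltW// divr_gt0.
rewrite -(@ler_pM2r _ n.+2%:R)// (le_trans h3)// mulrC -ler_pdivrMr//.
by rewrite ltW// (lt_trans hn)// ltr_nat.
Qed.

Let B f := unif_closure f /\ continuous f.

Let maxE (a b : R) : Num.max a b = 2^-1 * (a + b + `|a - b|).
Proof. by rewrite maxr_absE; field. Qed.

Let B_abs f : B f -> B (fun x => `|f x|).
Proof.
move=> [uf cf]; split; first exact: unif_closure_abs.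
by move=> x; apply: continuous_comp; [exact: cf|exact: (@norm_continuous R R)].
Qed.

Let B_add f g : B f -> B g -> B (fun x => f x + g x).
Proof.
move=> [uf cf] [ug cg]; split; first exact: unif_closure_add.
by move=> x; apply: (@continuousD _ _ _ f g x) => //; [exact: cf|exact: cg].
Qed.

Let B_scale (r : R) f : B f -> B (fun x => r * f x).
Proof.
move=> [uf cf]; split; first exact: unif_closure_scale.
by move=> x; apply: (@continuousM _ _ (fun=> r) f x) => //; [exact: cvg_cst|exact: cf].
Qed.

Let B_max f g : B f -> B g -> B (fun x => Num.max (f x) (g x)).
Proof.
move=> Bf Bg; have -> : (fun x => Num.max (f x) (g x)) =
    (fun x => 2^-1 * (f x + g x + `|f x + (-1) * g x|)).
  by apply/funext => x; rewrite maxE mulN1r.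
by apply: B_scale; apply: B_add; [exact: B_add|apply: B_abs; apply: B_add => //;
  exact: B_scale].
Qed.

Let B_min f g : B f -> B g -> B (fun x => Num.min (f x) (g x)).
Proof.
move=> Bf Bg; have -> : (fun x => Num.min (f x) (g x)) =
    (fun x => (-1) * Num.max ((-1) * f x) ((-1) * g x)).
  by apply/funext => x; rewrite !mulN1r -oppr_min opprK.
by apply: B_scale; apply: B_max; exact: B_scale.
Qed.

Hypothesis A_sep : forall x y, K x -> K y -> x <> y -> exists2 f, A f & f x <> f y.

Let two_points f x y : K x -> K y -> exists2 h, A h & h x = f x /\ h y = f y.
Proof.
move=> Kx Ky; have [->|xy] := pselect (x = y); first by exists (fun=> f y).
have [g Ag gxy] := A_sep Kx Ky xy.
have d0 : g x - g y != 0 by rewrite subr_eq0; apply/eqP.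
exists (fun z => f y + ((f x - f y) / (g x - g y)) * (g z + (- g y))).
  apply: A_add; first exact: A_cst.
  by apply: A_mul; [exact: A_cst|apply: A_add => //; exact: A_cst].
by split; [field|rewrite subrr mulr0 addr0].
Qed.

(** The uniform closure of A is a lattice because absolute values are limits of
    polynomials. Functions of A meeting f at x and at y are combined twice by
    compactness: minima over finitely many y stay below f + e, and maxima of
    these over finitely many x are also above f - e. *)
Theorem stone_weierstrass_real f (e : R) : continuous f -> 0 < e ->
  exists2 h, A h & forall x, K x -> `|f x - h x| <= e.
Proof.
move=> cf e0; suff : unif_closure f by exact.
move=> {}e {}e0.
have [K0|/set0P[x0 Kx0]] := eqVneq K set0.
  by exists (fun=> 0) => // x; rewrite K0.
suff [g [Bg cg] gP] : exists2 g, B g & forall z, K z ->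
    f z - e / 2 < g z /\ g z < f z + e / 2.
  have e2 : 0 < e / 2 by rewrite divr_gt0.
  have [h Ah gh] := Bg _ e2; exists h => // x Kx; have [h1 h2] := gP x Kx.
  have -> : f x - h x = (f x - g x) + (g x - h x) by ring.
  rewrite (le_trans (ler_normD _ _))// [leRHS]splitr lerD ?gh//.
  by rewrite ler_norml; apply/andP; split; lra.
move: (e / 2) (divr_gt0 e0 (ltr0n R 2)) => {e0}e e0.
have below x : K x -> exists2 g, B g & f x <= g x /\
    forall z, K z -> g z < f z + e.
  move=> Kx; suff [g Bg [gx h]] : exists2 g, B g & f x <= g x /\
      forall z, K z -> K z -> g z < f z + e.
    by exists g => //; split=> // z Kz; exact: h.
  apply: (@compact_ind _ K (fun U => exists2 g, B g & f x <= g x /\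
      forall z, K z -> U z -> g z < f z + e) compactK).
  - by exists (fun=> f x) => //; split=> //; [exact: unif_closure_sub|exact: A_cont].
  - move=> U V [g Bg [gx gU]] [h Bh [hx hV]].
    exists (fun z => Num.min (g z) (h z)); first exact: B_min.
    split; first by rewrite le_min gx hx.
    by move=> z Kz [/gU-/(_ Kz)|/hV-/(_ Kz)] l; rewrite gt_min l ?orbT.
  - by move=> U V UV [g Bg [gx gV]]; exists g => //; split=> // z Kz /UV; exact: gV.
  move=> y Ky; have [g Ag [gx gy]] := two_points f Kx Ky.
  have e2 : 0 < e / 2 by rewrite divr_gt0.
  exists [set z | `|f y - f z| < e / 2 /\ `|g y - g z| < e / 2].
    by apply: filterI; [exact: near_cont|apply: near_cont => //; exact: A_cont].
  exists g; first by split; [exact: unif_closure_sub|exact: A_cont].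
  split; first by rewrite gx.
  by move=> z Kz /= []; rewrite gy !ltr_norml => /andP[? ?] /andP[? ?]; lra.
suff [g Bg h] : exists2 g, B g & (forall z, K z -> g z < f z + e) /\
    forall z, K z -> K z -> f z - e < g z.
  by exists g => // z Kz; split; [exact: h.2|exact: h.1].
apply: (@compact_ind _ K (fun U => exists2 g, B g &
   (forall z, K z -> g z < f z + e) /\
    forall z, K z -> U z -> f z - e < g z) compactK).
- by have [g Bg [_ h]] := below _ Kx0; exists g.
- move=> U V [g Bg [gx gU]] [h Bh [hx hV]].
  exists (fun z => Num.max (g z) (h z)); first exact: B_max.
  split; first by move=> z Kz; rewrite gt_max gx// hx.
  by move=> z Kz [/gU-/(_ Kz)|/hV-/(_ Kz)] l; rewrite lt_max l ?orbT.
- by move=> U V UV [g Bg [gx gV]]; exists g => //; split=> // z Kz /UV; exact: gV.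
move=> y Ky; have [g Bg [gy h]] := below _ Ky.
have e2 : 0 < e / 2 by rewrite divr_gt0.
exists [set z | `|f y - f z| < e / 2 /\ `|g y - g z| < e / 2].
  by apply: filterI; apply: near_cont => //; exact: Bg.2.
exists g => //; split=> // z Kz /= [].
by rewrite !ltr_norml => /andP[? ?] /andP[? ?]; lra.
Qed.

End stone_weierstrass_real.

(** * Complex-valued continuous functions *)

Section complex_continuity.
Context {R : realType} {T : topologicalType}.
Local Notation C := R[i].
Implicit Types f g : T -> C.

Lemma continuous_nsqP f : continuous f <->
  forall x (e : R), 0 < e -> \forall z \near x, nsq (f x - f z) < e ^+ 2.
Proof.
split=> [cf x e e0|h x].
  have /cvgrPdist_lt/(_ e%:C) := cf x; rewrite ltcR => /(_ e0).
  by apply: filterS => z /=; rewrite nsq_lt.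
apply/cvgrPdist_lt => -[e e']; rewrite ltcE /= => /andP[/eqP ee e0].
rewrite ee in e0 *; apply: filterS (h x e e0) => z.
by rewrite -nsq_lt.
Qed.

Lemma continuous_Re f : continuous f -> continuous (fun x => complex.Re (f x)).
Proof.
move=> /continuous_nsqP cf x; apply/cvgrPdist_lt => e e0.
apply: filterS (cf x e e0) => z; case: (f x) (f z) => [a b] [c d].
rewrite /nsq /= => h; rewrite -(@ltr_pXn2r _ 2) ?nnegrE ?(ltW e0)//.
by rewrite real_normK ?num_real// (le_lt_trans _ h)// lerDl sqr_ge0.
Qed.

Lemma continuous_Im f : continuous f -> continuous (fun x => complex.Im (f x)).
Proof.
move=> /continuous_nsqP cf x; apply/cvgrPdist_lt => e e0.
apply: filterS (cf x e e0) => z; case: (f x) (f z) => [a b] [c d].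
rewrite /nsq /= => h; rewrite -(@ltr_pXn2r _ 2) ?nnegrE ?(ltW e0)//.
by rewrite real_normK ?num_real// (le_lt_trans _ h)// lerDr sqr_ge0.
Qed.

Lemma continuous_complex (a b : T -> R) : continuous a -> continuous b ->
  continuous (fun x => a x +i* b x : C).
Proof.
move=> ca cb; apply/continuous_nsqP => x e e0.
have e2 : 0 < e / 2 by rewrite divr_gt0.
have /cvgrPdist_lt/(_ _ e2) ha := ca x; have /cvgrPdist_lt/(_ _ e2) hb := cb x.
apply: filterS2 ha hb => z; rewrite /nsq /=.
rewrite -(@ltr_pXn2r _ 2 _ `|a x - a z|) ?nnegrE ?(ltW e2)// real_normK ?num_real//.
rewrite -(@ltr_pXn2r _ 2 _ `|b x - b z|) ?nnegrE ?(ltW e2)// real_normK ?num_real//.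
move=> h1 h2; have : 0 < (e / 2) ^+ 2 by rewrite exprn_gt0.
have ee : e = e / 2 + e / 2 by rewrite -splitr.
move: (e / 2) h1 h2 ee => d h1 h2 ->.
move: h1 h2; move: (a x - a z) (b x - b z) => u v; nra.
Qed.

Lemma continuous_real (a : T -> R) : continuous a -> continuous (fun x => (a x)%:C : C).
Proof. by move=> ca; apply: continuous_complex => // x; exact: cvg_cst. Qed.

Lemma continuous_conj f : continuous f -> continuous (fun x => (f x)^*).
Proof.
move=> cf; have -> : (fun x => (f x)^*) =
    (fun x => complex.Re (f x) +i* - complex.Im (f x)).
  by apply/funext => x; case: (f x).
apply: continuous_complex; first exact: continuous_Re.
by move=> x; apply: (@cvgN _ R); exact: continuous_Im.
Qed.

Lemma continuous_nsq f : continuous f -> continuous (fun x => nsq (f x)).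
Proof.
move=> cf; have -> : (fun x => nsq (f x)) = (fun x => complex.Re (f x * (f x)^*)).
  by apply/funext => x; rewrite mulrC -nsqJ_mul.
apply: continuous_Re => x; apply: (@continuousM _ _ f (fun x => (f x)^*)).
  exact: cf.
exact: continuous_conj.
Qed.

Lemma compact_bdd (K : set T) f : compact K -> continuous f ->
  exists2 s : R, 0 < s & forall x, K x -> nsq (f x) <= s.
Proof.
move=> cK /continuous_nsq cn; have [s s0 hs] := cont_bounded_on cK cn.
by exists s => // x Kx; exact: le_trans (ler_norm _) (hs x Kx).
Qed.

End complex_continuity.

Section stone_weierstrass.
Context {R : realType} {T : topologicalType} (K : set T).
Local Notation C := R[i].
Variable A : set (T -> C).
Hypothesis compactK : compact K.
Hypothesis A_cont : forall f, A f -> continuous f.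
Hypothesis A1 : A (fun=> 1).
Hypothesis A_add : forall f g, A f -> A g -> A (f \+ g).
Hypothesis A_mul : forall f g, A f -> A g -> A (f \* g).
Hypothesis A_scale : forall (z : C) f, A f -> A (z \*: f).
Hypothesis A_conj : forall f, A f -> A (fun x => (f x)^*).
Hypothesis A_sep : forall x y, K x -> K y -> x <> y -> exists2 f, A f & f x <> f y.

Let real_part f : A f -> A (fun x => (complex.Re (f x))%:C).
Proof.
move=> Af; have -> : (fun x => (complex.Re (f x))%:C) =
    (2^-1 : C) \*: (f \+ (fun x => (f x)^*)).
  by apply/funext => x /=; rewrite ReJ_add mulrC.
by apply: A_scale; apply: A_add => //; exact: A_conj.
Qed.

(** The real-valued members of A still separate points, since the imaginary part
    of g is the real part of - i g; they approximate the real and the imaginary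
    part of f separately. *)
Theorem stone_weierstrass (f : T -> C) (e : R) : continuous f -> 0 < e ->
  exists2 h, A h & forall x, K x -> nsq (f x - h x) <= e ^+ 2.
Proof.
move=> cf e0; have e2 : 0 < e / 2 by rewrite divr_gt0.
pose AR : set (T -> R) := [set r | A (fun x => (r x)%:C)].
have sw r : continuous r -> exists2 h, AR h & forall x, K x -> `|r x - h x| <= e / 2.
  move=> cr; apply: stone_weierstrass_real => //.
  - move=> g /A_cont cg.
    have -> : g = (fun x => complex.Re ((g x)%:C)) by [].
    exact: continuous_Re.
  - move=> s; rewrite /AR /=; have -> : (fun=> s%:C) = s%:C \*: (fun=> 1 : C) :> (T -> C).
      by apply/funext => x /=; rewrite [RHS]mulr1.
    exact: A_scale.
  - move=> g h Ag Ah; rewrite /AR /=.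
    have -> : (fun x => (g x + h x)%:C) = (fun x => (g x)%:C) \+ (fun x => (h x)%:C).
      by apply/funext => x /=; rewrite rmorphD.
    exact: A_add.
  - move=> g h Ag Ah; rewrite /AR /=.
    have -> : (fun x => (g x * h x)%:C) = (fun x => (g x)%:C) \* (fun x => (h x)%:C).
      by apply/funext => x /=; rewrite rmorphM.
    exact: A_mul.
  - move=> x y Kx Ky xy; have [g Ag gxy] := A_sep Kx Ky xy.
    have [E|] := pselect (complex.Re (g x) = complex.Re (g y)); last first.
      by exists (fun z => complex.Re (g z)) => //; exact: real_part.
    exists (fun z => complex.Re ((- 'i%C) * g z)).
      by apply: (@real_part ((- 'i%C) \*: g)); exact: A_scale.
    move=> E2; apply: gxy; move: E E2; case: (g x) (g y) => [a b] [c d] /= ->.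
    by rewrite !oppr0 !mul0r !sub0r !mulN1r !opprK => ->.
have [h Ah hf] := sw _ (continuous_Re cf); have [k Ak kf] := sw _ (continuous_Im cf).
exists ((fun x => (h x)%:C) \+ 'i%C \*: (fun x => (k x)%:C)).
  by apply: A_add => //; exact: A_scale.
move=> x Kx.
have -> : nsq (f x - ((fun x => (h x)%:C) \+ 'i%C \*: (fun x => (k x)%:C)) x) =
    (complex.Re (f x) - h x) ^+ 2 + (complex.Im (f x) - k x) ^+ 2.
  rewrite /= [X in _ - (_ + X)]/GRing.scale/=; case: (f x) => a b; rewrite /nsq /=.
  by rewrite ?mul0r ?mul1r ?mulr0 ?oppr0 ?addr0 ?add0r ?subr0.
move: (hf x Kx) (kf x Kx).
rewrite -(@ler_pXn2r _ 2 _ `|_ - h x|) ?nnegrE ?(ltW e2)// real_normK ?num_real//.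
rewrite -(@ler_pXn2r _ 2 _ `|_ - k x|) ?nnegrE ?(ltW e2)// real_normK ?num_real//.
move=> h1 h2; have : 0 < (e / 2) ^+ 2 by rewrite exprn_gt0.
have ee : e = e / 2 + e / 2 by rewrite -splitr.
move: (e / 2) h1 h2 ee => d h1 h2 ->.
move: h1 h2; move: (_ - h x) (_ - k x) => u v; nra.
Qed.

End stone_weierstrass.

(** * Clopen pieces of the groupoid *)

Lemma at_most_inj n (T U : eqType) (h : U -> T) (P : set T) (Q : set U) :
  at_most n P -> (forall g, Q g -> P (h g)) ->
  (forall g g', Q g -> Q g' -> h g = h g' -> g = g') -> at_most n Q.
Proof.
move=> [l sl Pl] QP hi.
have /choice[c cP] x : exists o : option U,
    forall g, Q g -> h g = x -> o = Some g.
  have [[g [Qg gx]]|no] := pselect (exists g, Q g /\ h g = x).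
    by exists (Some g) => g' Qg' g'x; rewrite (hi g g')// gx.
  by exists None => g Qg gx; exfalso; apply: no; exists g.
exists (pmap c l).
  by rewrite size_pmap (leq_trans (count_size _ _)).
move=> g Qg; rewrite mem_pmap; apply/mapP; exists (h g); first exact/Pl/QP.
by rewrite (cP _ g).
Qed.

Section iterates.
Context {Y : topologicalType} {theta : Y -> Y}.

Definition fibres_at_most (M : nat) := forall y, at_most M [set z | theta z = y].

(** Each i accounts for at most one point of a fibre, the one at which a i does
    not vanish. *)
Lemma fibres_cover (T : nmodType) (I : eqType) (L : seq I) (a : I -> Y -> T) :
  (forall y, exists2 i, i \in L & a i y != 0) ->
  (forall i, i \in L -> forall y z, a i y != 0 -> a i z != 0 ->
     theta y = theta z -> y = z) ->
  fibres_at_most (size L).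
Proof.
move=> cov inj y; rewrite -[size L]muln1; apply: (at_most_bind (P := fun i => i \in L)
  (Q := fun i => [set z | a i z != 0 /\ theta z = y /\ i \in L])).
- by exists L.
- move=> i iL; have [[z [az [zy _]]]|no] := pselect
    (exists z, a i z != 0 /\ theta z = y /\ i \in L).
    exists [:: z] => // z' [az' [z'y _]]; rewrite inE; apply/eqP.
    by apply: (inj i iL) => //; rewrite z'y.
  by exists [::] => // z h; exfalso; apply: no; exists z.
- by move=> z /= zy; have [i iL ai] := cov z; exists i.
Qed.

Lemma fibres_iter M n y : fibres_at_most M ->
  at_most (M ^ n) [set z | iter n theta z = y].
Proof.
move=> hM; elim: n y => [|n IH] y; first by exists [:: y] => // x <-; rewrite inE.
rewrite expnSr; apply: (at_most_bind (IH y) (Q := fun w => [set z | theta z = w])).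
  by move=> w _; exact: hM.
by move=> z /= e; exists (theta z) => //=; rewrite -iterSr.
Qed.

Lemma continuous_iter n : continuous theta -> continuous (iter n theta).
Proof.
move=> ct; elim: n => [|n IH] //= x; first exact: cvg_id.
by apply: continuous_comp; [exact: IH|exact: ct].
Qed.

Definition loc_inj (f : Y -> Y) :=
  forall y, exists U : set Y, [/\ open U, U y & set_inj U f].

Lemma loc_inj_iter n : continuous theta -> loc_inj theta -> loc_inj (iter n theta).
Proof.
move=> ct li; elim: n => [|n IH] y.
  exists setT; split=> //; first exact: openT.
have [U [oU Uy iU]] := IH y; have [V [oV Vy iV]] := li (iter n theta y).
exists (U `&` iter n theta @^-1` V); split=> //.
- by apply: openI => //; apply: open_comp oV => x _; exact: continuous_iter.
- move=> x x' /set_mem[Ux Vx] /set_mem[Ux' Vx'] /= e.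
  by apply: iU; rewrite ?inE//; apply: iV; rewrite ?inE.
Qed.

Lemma locally_injective_loc_inj : locally_injective theta <-> loc_inj theta.
Proof.
split=> [[B [oB nB] iB] y|h].
  have [U [BU Uy] _] := nB y setT filterT; exists U; split=> //; first exact: oB.
  exact: iB.
exists [set U | open U /\ set_inj U theta] => [|U []//]; split; first by move=> U [].
move=> y U /=; rewrite nbhsE => -[V [oV Vy] VU]; have [W [oW Wy iW]] := h y.
exists (V `&` W); last by move=> z [/VU].
split=> //; split; first exact: openI.
by move=> x x' /set_mem[_ Wx] /set_mem[_ Wx'] e; apply: iW; rewrite ?inE.
Qed.

End iterates.

Section groupoid_pieces.
Context {R : realType} {Y : topologicalType} {theta : Y -> Y}.
Local Notation C := R[i].
Local Notation G := (groupoid theta).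

(** The piece of degree a - b and depth b. It is indexed by both exponents
    because it is the support of the a-th power of the shift times the b-th power
    of its adjoint. *)
Definition lag (a b : nat) : set G :=
  [set g | deg g = a%:Z - b%:Z /\ iter a theta (rng g) = iter b theta (src g)].

Lemma lagE a b : lag a b = gpd_piece (a%:Z - b%:Z) b.
Proof.
apply/seteqP; split=> g [dg] /=.
  move=> e; split=> // i bi.
  have -> : `|(a%:Z - b%:Z + i%:Z)%R|%N = (a + (i - b))%N by lia.
  by rewrite -[in RHS](subnK bi) addnC iterD e -iterD.
move=> /(_ b (leqnn _)) e; split=> //; rewrite -e; congr (iter _ _ _); lia.
Qed.

Lemma lag_cover g : exists a b, lag a b g.
Proof. by have [a [b [h1 h2]]] := groupoid_rel g; exists a, b. Qed.

Lemma gpd_openE (U : set G) : open U = gpd_open U.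
Proof. by []. Qed.

Lemma continuous_rng : continuous (rng : G -> Y).
Proof.
apply/continuousP => V oV; rewrite gpd_openE => k n kn.
exists (fst @^-1` V) => //; apply: open_comp => // p _; exact: cvg_fst.
Qed.

Lemma continuous_src : continuous (src : G -> Y).
Proof.
apply/continuousP => V oV; rewrite gpd_openE => k n kn.
exists (snd @^-1` V) => //; apply: open_comp => // p _; exact: cvg_snd.
Qed.

Lemma open_neq (T : topologicalType) (f h : T -> Y) : hausdorff_space Y ->
  continuous f -> continuous h -> open [set t | f t <> h t].
Proof.
rewrite open_hausdorff => hY cf ch; rewrite openE => t /= /eqP /hY[[A B] /=].
rewrite !inE => -[At Bt] [oA oB AB].
have nA : nbhs t (f @^-1` A) by apply: cf; exact: open_nbhs_nbhs.
have nB : nbhs t (h @^-1` B) by apply: ch; exact: open_nbhs_nbhs.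
apply: filterS2 nA nB => s /= As Bs e; suff : (A `&` B) (f s) by rewrite AB.
by split=> //; rewrite e.
Qed.

Section clopen.
Hypothesis compactY : compact [set: Y].
Hypothesis hausdorffY : hausdorff_space Y.
Hypothesis continuous_theta : continuous theta.
Hypothesis loc_inj_theta : loc_inj theta.

Let agree a b : set (Y * Y) := [set p | iter a theta p.1 = iter b theta p.2].

Let closed_agree a b : closed (agree a b).
Proof.
rewrite -[agree a b]setCK; apply: open_closedC; apply: open_neq => //.
- by move=> p; apply: continuous_comp; [exact: cvg_fst|exact: continuous_iter].
- by move=> p; apply: continuous_comp; [exact: cvg_snd|exact: continuous_iter].
Qed.

Lemma lag_closed a b : closed (lag a b).
Proof.
rewrite -[lag a b]setCK; apply: open_closedC; rewrite gpd_openE => k n kn.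
have [->|kab] := eqVneq k (a%:Z - b%:Z).
  exists (~` agree a b); first exact: closed_openC.
  by move=> g [dg _]; split=> h e; apply: h; [split|case: e].
exists setT; first exact: openT.
by move=> g [dg _]; split=> // _ [e _]; move: kab; rewrite -dg e eqxx.
Qed.

(** Among the arrows of a larger depth n, those of the piece are distinguished by
    the equality of two points that have the same image under the iterate of
    order n - b; as that iterate is locally injective, nearby points with equal
    images are equal. *)
Lemma lag_open a b : open (lag a b).
Proof.
rewrite gpd_openE => k n kn.
have [kab|kab] := eqVneq k (a%:Z - b%:Z); last first.
  exists set0; first exact: open0.
  by move=> g [dg _]; split=> // -[e _]; move: kab; rewrite -dg e eqxx.
have [nb|bn] := leqP n b.
  exists setT; first exact: openT.
  move=> g [dg h]; split=> // _; rewrite lagE -kab; split=> // i bi.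
  by apply: h; exact: leq_trans bi.
pose m := (n - b)%N.
pose W := \bigcup_(U in [set U : set Y | open U /\ set_inj U (iter m theta)])
   ((iter a theta \o fst) @^-1` U `&` (iter b theta \o snd) @^-1` U).
exists W.
  apply: bigcup_open => U [oU _]; apply: openI; apply: open_comp => // p _.
  - by apply: continuous_comp; [exact: cvg_fst|exact: continuous_iter].
  - by apply: continuous_comp; [exact: cvg_snd|exact: continuous_iter].
move=> g [dg h]; split.
  move=> [_ e].
  have [U [oU Ug iU]] := loc_inj_iter m continuous_theta loc_inj_theta
    (iter a theta (rng g)).
  by exists U => //; split=> //=; rewrite -e.
move=> [U [oU iU] [/= Ua Ub]]; split; first by rewrite dg.
apply: iU; rewrite ?inE// -!iterD.
have := h n (leqnn _); have -> : `|(k + n%:Z)%R|%N = (m + a)%N by rewrite /m; lia.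
by have -> : (m + b = n)%N by rewrite /m; lia.
Qed.

(** The piece carries the relative topology of a closed subset of Y * Y. *)
Lemma lag_compact a b : compact (lag a b).
Proof.
move=> F FF FL.
have := @subclosed_compact _ (agree a b) (setT `*` setT) (@closed_agree a b)
  (compact_setX compactY compactY) (fun _ _ => conj I I).
have PF : ProperFilter ((fun g : G => (rng g, src g)) @ F).
  exact: fmap_proper_filter.
move=> /(_ _ PF) [|[x y] [/= exy clu]].
  by apply: (@filterS _ F _ (lag a b)) FL => g [].
have gxy : gpd_rel theta (x, a%:Z - b%:Z, y) by exists a, b.
exists (exist _ _ gxy); split; first by split.
move=> A U FA; rewrite nbhsE => -[V [oV Vg] VU].
have ab0 : 0 <= b%:Z + (a%:Z - b%:Z) by lia.
have [W oW WV] := oV (a%:Z - b%:Z) b ab0.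
have Lg : lag a b (exist _ _ gxy) by split.
have Wxy : W (x, y) by apply/(WV (exist _ _ gxy)) => //; rewrite -lagE.
have FA' : ((fun g : G => (rng g, src g)) @ F)
    [set p | exists2 g, A g /\ lag a b g & p = (rng g, src g)].
  by apply: (@filterS2 _ F _ A (lag a b)) FA FL => g Ag Lg'; exists g.
have [p [[g [Ag Lg'] ->] Wp]] := clu _ _ FA' (open_nbhs_nbhs (conj oW Wxy)).
by exists g; split=> //; apply: VU; apply/WV => //; rewrite -lagE.
Qed.

End clopen.

Definition restr (U : set G) (f : G -> C) : G -> C :=
  fun g => if `[< U g >] then f g else 0.

Lemma restrE (U : set G) (f : G -> C) g : U g -> restr U f g = f g.
Proof. by move=> Ug; rewrite /restr asboolT. Qed.

Lemma restrN (U : set G) (f : G -> C) g : ~ U g -> restr U f g = 0.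
Proof. by move=> Ug; rewrite /restr asboolF. Qed.

Lemma restr_neq0 (U : set G) (f : G -> C) g : restr U f g != 0 -> U g.
Proof. by rewrite /restr; case: asboolP; rewrite ?eqxx. Qed.

Lemma restrC (U : set G) f : f = restr U f \+ restr (~` U) f.
Proof.
apply/funext => g /=; have [Ug|nUg] := pselect (U g).
  by rewrite restrE// restrN ?addr0// => /(_ Ug).
by rewrite restrN// restrE// add0r.
Qed.

Lemma continuous_restr U (f : G -> C) : open U -> closed U -> continuous f ->
  continuous (restr U f).
Proof.
move=> oU cU /continuous_nsqP cf; apply/continuous_nsqP => g e e0.
have [Ug|nUg] := pselect (U g).
  have nU : nbhs g U by exact: open_nbhs_nbhs.
  by move: nU (cf g e e0); apply: filterS2 => h Uh; rewrite !restrE.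
have nU : nbhs g (~` U).
  by apply: open_nbhs_nbhs; split=> //; exact: closed_openC.
move: nU; apply: filterS => h Uh.
by rewrite !restrN// subrr nsq0 exprn_gt0.
Qed.

(** The product d S^a T^b e, where S is the shift and T its adjoint. *)
Definition elem (d : Y -> C) (a b : nat) (e : Y -> C) : G -> C :=
  restr (lag a b) (fun g => d (rng g) * e (src g)).

Inductive span_elem (D : set (Y -> C)) : set (G -> C) :=
| span_elem1 d a b e of D d & D e : span_elem D (elem d a b e)
| span_elemD f h of span_elem D f & span_elem D h : span_elem D (f \+ h).

(** An arrow of the piece is determined by its range and its source, and when the
    range is given the source lies in a fibre of the b-th iterate. *)
Lemma unif_finite_by_lag M a b (s : R) (f : G -> C) : fibres_at_most (theta := theta) M ->
  (forall g, f g != 0 -> lag a b g) -> (forall g, nsq (f g) <= s) ->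
  unif_finite_by (M ^ a + M ^ b) s f.
Proof.
move=> hM fL fs; split=> //.
- move=> y; apply: (at_mostW (leq_addl _ _)).
  apply: (at_most_inj (h := @src _ _) (fibres_iter b (iter a theta y) hM)).
  + by move=> g [/= <- /fL[]].
  + by move=> g g' [gy /fL[dg _]] [g'y /fL[dg' _]] e; apply: gpd_eq => //;
      [rewrite gy|rewrite dg].
- move=> y; apply: (at_mostW (leq_addr _ _)).
  apply: (at_most_inj (h := @rng _ _) (fibres_iter a (iter b theta y) hM)).
  + by move=> g [/= <- /fL[]].
  + by move=> g g' [gy /fL[dg _]] [g'y /fL[dg' _]] e; apply: gpd_eq => //;
      [rewrite dg|rewrite gy].
Qed.

End groupoid_pieces.

(** * Approximation of compactly supported functions *)

Section approximation.
Context {R : realType} {Y : topologicalType} {theta : Y -> Y}.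
Local Notation C := R[i].
Local Notation G := (groupoid theta).
Implicit Types (f h : G -> C) (P : set (G -> C)) (d e : Y -> C).

(** The closure of P in the operator norm, among the functions with finite
    convolution sums. *)
Definition approx P f :=
  unif_finite f /\ forall e : R, 0 < e -> exists2 h, P h & op_le (f \- h) e.

Definition bdd_fun (T : Type) (d : T -> C) := exists s : R, forall y, nsq (d y) <= s.

Lemma unif_finite_sub f h : unif_finite f -> unif_finite h -> unif_finite (f \- h).
Proof.
move=> Ff Fh; have -> : f \- h = f \+ (-1) \*: h.
  by apply/funext => g /=; rewrite scaleN1r.
by apply: unif_finite_add => //; exact: unif_finite_scale.
Qed.

Lemma unif_finite0 : unif_finite (fun _ : G => 0 : C).
Proof.
by exists 0%N, 0; split=> [y|y|g]; do ?[by exists [::] => // g [_]; rewrite eqxx];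
  rewrite nsq0.
Qed.

Lemma elem_neq0 d a b e (g : G) : elem d a b e g != 0 -> lag a b g.
Proof. exact: restr_neq0. Qed.

Lemma bounded_mul (T : Type) (d e : T -> C) : bdd_fun d -> bdd_fun e ->
  exists2 s : R, 0 <= s & forall y z, nsq (d y * e z) <= s.
Proof.
move=> [s hs] [t ht]; have [[y0]|no] := pselect (exists y : T, True); last first.
  by exists 0 => // y; exfalso; apply: no; exists y.
have s0 : 0 <= s by exact: le_trans (nsq_ge0 _) (hs y0).
have t0 : 0 <= t by exact: le_trans (nsq_ge0 _) (ht y0).
by exists (s * t) => [|y z]; rewrite ?mulr_ge0// nsqM ler_pM ?nsq_ge0.
Qed.

Variable M : nat.
Hypothesis fibM : fibres_at_most (theta := theta) M.

Lemma unif_finite_by_elem d a b e : bdd_fun d -> bdd_fun e ->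
  exists n s, unif_finite_by n s (elem d a b e : G -> C).
Proof.
move=> bd be; have [s s0 hs] := bounded_mul bd be.
exists (M ^ a + M ^ b)%N, s; apply: unif_finite_by_lag => //; first exact: elem_neq0.
by move=> g; rewrite /elem /restr; case: ifP => _; rewrite ?nsq0.
Qed.

Lemma unif_finite_span D f : (forall d, D d -> bdd_fun d) -> span_elem D f ->
  unif_finite f.
Proof.
move=> bD; elim=> [d a b e Dd De|h k _ Fh _ Fk]; last exact: unif_finite_add.
by apply: unif_finite_by_elem; apply: bD.
Qed.

Hypothesis compactY : compact [set: Y].
Hypothesis hausdorffY : hausdorff_space Y.
Hypothesis continuous_theta : continuous theta.
Hypothesis loc_inj_theta : loc_inj theta.

Let lagO a b : open (lag a b : set G).
Proof. exact: lag_open. Qed.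
Let lagF a b : closed (lag a b : set G).
Proof. exact: lag_closed. Qed.
Let lagK a b : compact (lag a b : set G).
Proof. exact: lag_compact. Qed.

Lemma continuous_tensor d e : continuous d -> continuous e ->
  continuous (fun g : G => d (rng g) * e (src g)).
Proof.
move=> cd ce g; apply: (@continuousM _ _ (d \o rng) (e \o src)).
- by apply: continuous_comp; [exact: continuous_rng|exact: cd].
- by apply: continuous_comp; [exact: continuous_src|exact: ce].
Qed.

Lemma alg_star_elem d a b e : continuous d -> continuous e ->
  alg_star (elem d a b e : G -> C).
Proof.
move=> cd ce; apply: alg_star_cc.
  by apply: continuous_restr => //; exact: continuous_tensor.
apply: subclosed_compact (@lagK a b) _; first exact: closed_closure.
rewrite [X in _ `<=` X]((closure_id (lag a b)).1 (@lagF a b)).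
apply: closure_subset => g /=.
exact: elem_neq0.
Qed.

Variable D : set (Y -> C).
Hypothesis D_cont : forall d, D d -> continuous d.
Hypothesis D1 : D (fun=> 1).
Hypothesis D_mul : forall d e, D d -> D e -> D (d \* e).
Hypothesis D_scale : forall (z : C) d, D d -> D (z \*: d).
Hypothesis D_conj : forall d, D d -> D (fun y => (d y)^*).
Hypothesis D_sep : forall x y, x <> y -> exists2 d, D d & d x <> d y.

Inductive tensors : set (G -> C) :=
| tensors1 d e of D d & D e : tensors (fun g => d (rng g) * e (src g))
| tensorsD f h of tensors f & tensors h : tensors (f \+ h).

Let span_restr a b f : tensors f -> span_elem D (restr (lag a b) f).
Proof.
elim=> [d e Dd De|h k _ sh _ sk]; first exact: span_elem1.
have -> : restr (lag a b) (h \+ k) = restr (lag a b) h \+ restr (lag a b) k.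
  by apply/funext => g; rewrite /restr /=; case: ifP; rewrite ?addr0.
exact: span_elemD.
Qed.

Let tens_scale (z : C) f : tensors f -> tensors (z \*: f).
Proof.
elim=> [d e Dd De|h k _ sh _ sk].
  have -> : z \*: (fun g : G => d (rng g) * e (src g)) =
      (fun g : G => (z \*: d) (rng g) * e (src g)).
    by apply/funext => g /=; rewrite /GRing.scale/= mulrA.
  exact: (tensors1 (D_scale z Dd) De).
have -> : z \*: (h \+ k) = z \*: h \+ z \*: k.
  by apply/funext => g /=; rewrite scalerDr.
exact: tensorsD.
Qed.

Let tens_conj f : tensors f -> tensors (fun g => (f g)^*).
Proof.
elim=> [d e Dd De|h k _ sh _ sk].
  have -> : (fun g : G => (d (rng g) * e (src g))^*) =
      (fun g : G => (fun y => (d y)^*) (rng g) * (fun y => (e y)^*) (src g)).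
    by apply/funext => g /=; rewrite rmorphM.
  exact: (tensors1 (D_conj Dd) (D_conj De)).
have -> : (fun g => ((h \+ k) g)^*) = (fun g => (h g)^*) \+ (fun g => (k g)^*).
  by apply/funext => g /=; rewrite rmorphD.
exact: tensorsD.
Qed.

Let tens_mul f h : tensors f -> tensors h -> tensors (f \* h).
Proof.
elim=> [d e Dd De|f1 f2 _ s1 _ s2] th; last first.
  have -> : (f1 \+ f2) \* h = f1 \* h \+ f2 \* h.
    by apply/funext => g /=; rewrite mulrDl.
  by apply: tensorsD; [exact: s1|exact: s2].
elim: th => [d' e' Dd' De'|f1 f2 _ s1 _ s2].
  have -> : (fun g : G => d (rng g) * e (src g)) \*
      (fun g : G => d' (rng g) * e' (src g)) =
      (fun g : G => (d \* d') (rng g) * (e \* e') (src g)).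
    by apply/funext => g /=; rewrite mulrACA.
  exact: (tensors1 (D_mul Dd Dd') (D_mul De De')).
have -> (k : G -> C) : k \* (f1 \+ f2) = k \* f1 \+ k \* f2.
  by apply/funext => g /=; rewrite mulrDr.
exact: tensorsD.
Qed.

Let tens_cont f : tensors f -> continuous f.
Proof.
elim=> [d e Dd De|h k _ sh _ sk]; first by apply: continuous_tensor; exact: D_cont.
by move=> g; apply: continuousD; [exact: sh|exact: sk].
Qed.

Let approx_lag a b f : continuous f -> (forall g, f g != 0 -> lag a b g) ->
  approx (span_elem D) f.
Proof.
move=> cf fL; split.
  have [s s0 hs] := compact_bdd (@lagK a b) cf.
  exists (M ^ a + M ^ b)%N, s; apply: unif_finite_by_lag => // g.
  have [/fL Lg|/negPn/eqP ->] := boolP (f g != 0); last by rewrite nsq0 ltW.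
  exact: hs.
move=> e e0; pose n := (M ^ a + M ^ b)%N.
(* n.+1 rather than n, which may be 0. *)
pose dl := e / n.+1%:R; have d0 : 0 < dl by rewrite divr_gt0.
have [h th hf] : exists2 h, tensors h & forall g, lag a b g -> nsq (f g - h g) <= dl ^+ 2.
  apply: (@stone_weierstrass _ _ (lag a b) tensors) => //.
  - have -> : (fun=> 1) = (fun g : G => (fun=> 1 : C) (rng g) * (fun=> 1 : C) (src g)).
      by apply/funext => g /=; rewrite mulr1.
    exact: (tensors1 D1 D1).
  - exact: tensorsD.
  - move=> g g' [dg _] [dg' _] gg'.
    have [er|/D_sep[d Dd ne]] := pselect (rng g = rng g'); last first.
      exists (fun g : G => d (rng g) * (fun=> 1 : C) (src g)).
        exact: (tensors1 Dd D1).
      by rewrite !mulr1.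
    have [es|/D_sep[d Dd ne]] := pselect (src g = src g'); last first.
      exists (fun g : G => (fun=> 1 : C) (rng g) * d (src g)).
        exact: (tensors1 D1 Dd).
      by rewrite !mul1r.
    by exfalso; apply: gg'; apply: gpd_eq => //; rewrite dg dg'.
exists (restr (lag a b) h); first exact: span_restr.
apply: (@op_le_unif_finite _ _ _ n (dl ^+ 2)).
  apply: unif_finite_by_lag => // g.
    apply: contraTP => nL /=; rewrite restrN// subr0; apply/negPn.
    by apply: contraT => /fL.
  have [Lg|nL] := pselect (lag a b g); first by rewrite /= restrE// hf.
  have [/fL //|/negPn/eqP f0] := boolP (f g != 0).
  by rewrite /= restrN// f0 subrr nsq0 sqr_ge0.
have -> : e = n.+1%:R * dl by rewrite mulrC divfK.
rewrite [leRHS]exprMn ler_wpM2r ?sqr_ge0// -expr2 ler_pXn2r ?nnegrE ?ler0n//.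
by rewrite ler_nat.
Qed.

Let approx_list (L : seq (nat * nat)) f : continuous f ->
  (forall g, f g != 0 -> exists2 ab, ab \in L & lag ab.1 ab.2 g) -> approx (span_elem D) f.
Proof.
elim: L f => [|[a b] L IH] f cf fL.
  have -> : f = fun=> 0.
    apply/funext => g; apply/eqP; apply: contraT => /fL[ab].
    by rewrite in_nil.
  split; first exact: unif_finite0.
  move=> e e0; exists (elem (fun=> 0) 0 0 (fun=> 0)).
    have D0 : D (fun=> 0).
      have -> : (fun=> 0) = (0 : C) \*: (fun=> 1 : C) :> (Y -> C).
        by apply/funext => y /=; rewrite scale0r.
      exact: D_scale.
    exact: span_elem1.
  have -> : (fun _ : G => 0 : C) \- elem (fun=> 0) 0 0 (fun=> 0) = fun=> 0.
    by apply/funext => g; rewrite /elem /restr /=; case: ifP; rewrite ?mulr0 subr0.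
  apply: (@op_le_unif_finite _ _ _ 0 0); last by rewrite mulr0 sqr_ge0.
  by split=> [y|y|g]; do ?[by exists [::] => // g [_]; rewrite eqxx]; rewrite nsq0.
have cL1 : continuous (restr (lag a b) f) by exact: continuous_restr.
have cL2 : continuous (restr (~` lag a b) f).
  apply: continuous_restr => //; first exact: closed_openC.
  by apply: open_closedC.
have [F1 A1] := approx_lag cL1 (fun g => @restr_neq0 _ _ _ _ _ g).
have [F2 A2] : approx (span_elem D) (restr (~` lag a b) f).
  apply: IH => // g g0; have nL := restr_neq0 g0.
  move: g0; rewrite restrE// => /fL[ab]; rewrite inE => /predU1P[-> //|abL Lg].
  by exists ab.
rewrite (restrC (lag a b) f); split; first exact: unif_finite_add.
move=> e e0; have e2 : 0 < e / 2 by rewrite divr_gt0.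
have [h1 s1 o1] := A1 _ e2; have [h2 s2 o2] := A2 _ e2.
exists (h1 \+ h2); first exact: span_elemD.
rewrite [e]splitr.
have -> : (restr (lag a b) f \+ restr (~` lag a b) f) \- (h1 \+ h2) =
   (restr (lag a b) f \- h1) \+ (restr (~` lag a b) f \- h2).
  by apply/funext => g /=; rewrite opprD addrACA.
have bD d : D d -> bdd_fun d.
  move=> /D_cont cd; have [s s0 hs] := compact_bdd compactY cd.
  by exists s => y; exact: hs.
by apply: op_leD => //; apply: unif_finite_sub => //; exact: unif_finite_span bD _.
Qed.

(** Finitely many pieces cover the support, and being clopen they can be made
    disjoint without losing continuity. On one piece Stone-Weierstrass gives
    uniform approximation, which is approximation in norm because the entries per
    row and column are bounded there. *)
Lemma cc_approximable f : continuous f -> compactly_supported f -> approx (span_elem D) f.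
Proof.
move=> cf kf.
have [L hL] : exists L : seq (nat * nat), forall g, closure [set g | f g != 0] g ->
    exists2 ab, ab \in L & lag ab.1 ab.2 g.
  apply: (@compact_ind _ _ (fun U : set G => exists L : seq (nat * nat),
     forall g, U g -> exists2 ab, ab \in L & lag ab.1 ab.2 g) kf).
  - by exists [::].
  - move=> U V [L1 h1] [L2 h2]; exists (L1 ++ L2) => g [/h1|/h2] [ab abL Lg];
      by exists ab => //; rewrite mem_cat abL ?orbT.
  - by move=> U V UV [L1 h1]; exists L1 => g /UV/h1.
  move=> g _; have [a [b Lg]] := lag_cover g; exists (lag a b).
    exact: open_nbhs_nbhs.
  by exists [:: (a, b)] => g' Lg'; exists (a, b) => //; rewrite mem_head.
by apply: (approx_list (L := L)) => // g /(@subset_closure _ [set g | f g != 0])/hL.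
Qed.

End approximation.

(** * Products of elementary functions and the transfer operator *)

Section elem_products.
Context {R : realType} {Y : topologicalType} {theta : Y -> Y}.
Local Notation C := R[i].
Local Notation G := (groupoid theta).
Implicit Types (f h : G -> C) (d e : Y -> C).
Local Notation elem := (@elem R Y theta).

Lemma gpd_rel_step z : gpd_rel theta (z, 1, theta z).
Proof. by exists 1%N, 0%N. Qed.

Definition gstep z : G := exist _ _ (gpd_rel_step z).

Lemma rng_gstep z : rng (gstep z) = z. Proof. by []. Qed.
Lemma src_gstep z : src (gstep z) = theta z. Proof. by []. Qed.
Lemma deg_gstep z : deg (gstep z) = 1. Proof. by []. Qed.

Definition shift : G -> C := elem (fun=> 1) 1 0 (fun=> 1).
Definition coshift : G -> C := elem (fun=> 1) 0 1 (fun=> 1).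

(** Multiplying a diagonal element d by the shift S on the right and by its
    adjoint on the left gives this function again as a diagonal element. *)
Definition transfer d : Y -> C := fun y => \sum_(z \in [set z | theta z = y]) d z.

Lemma transferE d y (l : seq Y) : uniq l -> (forall z, z \in l <-> theta z = y) ->
  transfer d y = \sum_(z <- l) d z.
Proof.
move=> ul lP; rewrite [RHS]fsbig_seq//; apply: eq_fsbigl.
by apply/seteqP; split=> z /= /lP.
Qed.

Lemma elemE d a b e g : lag a b g -> elem d a b e g = d (rng g) * e (src g).
Proof. exact: restrE. Qed.

Lemma elemN d a b e g : ~ lag a b g -> elem d a b e g = 0.
Proof. exact: restrN. Qed.

Lemma lag00 (g : G) : lag 0 0 g <-> rng g = src g /\ deg g = 0.
Proof. by split=> [[]|[]]. Qed.

Lemma lag10 (g : G) : lag 1 0 g <-> g = gstep (rng g).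
Proof. by split=> [[/= e1 e2]|->//]; apply: gpd_eq. Qed.

Lemma on_unitsE d : on_units d = elem (fun=> 1) 0 0 d.
Proof.
apply/funext => g; rewrite /on_units; have [Lg|nL] := pselect (lag 0 0 g).
  by have [-> ->] := (lag00 g).1 Lg; rewrite elemE// !eqxx mul1r.
rewrite elemN//; case: ifP => // /andP[/eqP e1 /eqP e2].
by case: nL; apply/lag00.
Qed.

Lemma on_unitsEl d : on_units d = elem d 0 0 (fun=> 1).
Proof.
rewrite on_unitsE; apply/funext => g; have [Lg|nL] := pselect (lag 0 0 g).
  by rewrite !elemE// mul1r mulr1; have [-> _] := (lag00 g).1 Lg.
by rewrite !elemN.
Qed.

Lemma on_units_unit d y : on_units d (gunit (phi := theta) y) = d y.
Proof. by rewrite /on_units !eqxx. Qed.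

Lemma conv_unitsr f d g : conv f (on_units d) g = f g * d (src g).
Proof.
rewrite (@conv_col _ _ _ _ _ _ [:: gunit (src g)])//.
- rewrite big_seq1 on_units_unit; congr (f _ * _).
  by apply: gpd_eq; rewrite ?(rng_gmul, deg_gmul, src_gmul)// addr0.
- by move=> k; rewrite inE => /eqP ->.
- move=> k kg; rewrite inE => ku; rewrite /on_units; case: ifP; rewrite ?mulr0//.
  move=> /andP[/eqP e1 /eqP e2]; case/eqP: ku.
  by rewrite -kg; exact: gunitP.
Qed.

Lemma conv_unitsl f d g : conv (on_units d) f g = d (rng g) * f g.
Proof.
rewrite (@conv_row _ _ _ _ _ _ [:: gunit (rng g)])//.
- rewrite big_seq1 on_units_unit; congr (_ * f _).
  by apply: gpd_eq; rewrite ?(rng_gmul, deg_gmul, src_gmul)// ?add0r// oppr0 add0r.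
- by move=> k; rewrite inE => /eqP ->.
- move=> k kg; rewrite inE => ku; rewrite /on_units; case: ifP; rewrite ?mul0r//.
  move=> /andP[/eqP e1 /eqP e2]; case/eqP: ku.
  by rewrite -kg e1; exact: gunitP.
Qed.

Lemma conv_elem_units d a b e e' :
  conv (elem d a b e) (on_units e') = elem d a b (e \* e').
Proof.
apply/funext => g; rewrite conv_unitsr; have [Lg|nL] := pselect (lag a b g).
  by rewrite !elemE// mulrA.
by rewrite !elemN// mul0r.
Qed.

Lemma conv_units_elem d a b e d' :
  conv (on_units d') (elem d a b e) = elem (d' \* d) a b e.
Proof.
apply/funext => g; rewrite conv_unitsl; have [Lg|nL] := pselect (lag a b g).
  by rewrite !elemE// mulrA.
by rewrite !elemN// mulr0.
Qed.

Lemma conv_coshift f g : conv f coshift g = f (gmul g (gstep (src g))).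
Proof.
rewrite (@conv_col _ _ _ _ _ _ [:: ginv (gstep (src g))])//.
- by rewrite big_seq1 ginvK /coshift elemE ?mulr1.
- by move=> k; rewrite inE => /eqP ->.
- move=> k kg; rewrite inE => ku; rewrite /coshift elemN ?mulr0// => -[dk /= ek].
  case/eqP: ku; apply: gpd_eq => //; first by rewrite rng_ginv src_gstep -kg.
Qed.

Lemma conv_elem_coshift d a b e :
  conv (elem d a b e) coshift = elem d a b.+1 (e \o theta).
Proof.
apply/funext => g; rewrite conv_coshift.
have sg : src g = rng (gstep (src g)) by [].
have L : lag a b (gmul g (gstep (src g))) <-> lag a b.+1 g.
  rewrite /lag /= rng_gmul// src_gmul// deg_gmul// -iterS iterSr src_gstep deg_gstep.
  by split=> -[h1 ->]; split=> //; lia.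
have [Lg|nL] := pselect (lag a b.+1 g).
  by rewrite !elemE// ?rng_gmul ?src_gmul//; exact/L.
by rewrite !elemN// => /L.
Qed.

Lemma conv_shift f g (l : seq Y) : uniq l -> (forall z, z \in l <-> theta z = src g) ->
  conv f shift g = \sum_(z <- l) f (gmul g (ginv (gstep z))).
Proof.
move=> ul lP; rewrite (@conv_col _ _ _ _ _ _ (map gstep l)).
- rewrite big_map; apply: eq_bigr => z _.
  by rewrite /shift elemE ?mulr1//; exact/lag10.
- by rewrite map_inj_uniq// => z z' /(congr1 rng).
- by move=> k /mapP[z /lP zg ->].
- move=> k kg kl; rewrite /shift elemN ?mulr0// => /lag10 ek.
  case/negP: kl; apply/mapP; exists (rng k) => //; apply/lP.
  by rewrite -kg {2}ek src_gstep.
Qed.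

Variable M : nat.
Hypothesis fibM : fibres_at_most (theta := theta) M.

(** The last adjoint T of the product meets S in T e S, the transfer of e. *)
Lemma conv_elem_shiftS d a b e :
  conv (elem d a b.+1 e) shift = elem d a b (transfer e).
Proof.
apply/funext => g; have [l [ul _ lP]] := at_most_exact (fibM (src g)).
rewrite (conv_shift _ ul lP).
have L z : z \in l -> lag a b.+1 (gmul g (ginv (gstep z))) <-> lag a b g.
  move=> /lP /= zg; have sg : src g = rng (ginv (gstep z)) by [].
  rewrite /lag /= rng_gmul// src_gmul// deg_gmul// -iterS iterSr src_ginv rng_gstep zg.
  rewrite deg_ginv deg_gstep.
  by split=> -[h1 ->]; split=> //; lia.
have [Lg|nL] := pselect (lag a b g).
  rewrite elemE// (transferE _ ul lP) mulr_sumr; apply: eq_big_seq => z zl.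
  have sg : src g = rng (ginv (gstep z)) by have /lP := zl.
  by rewrite elemE ?rng_gmul ?src_gmul//; exact/L.
rewrite elemN// big_seq big1// => z zl; rewrite elemN// => /(L _ zl)//.
Qed.

(** Without an adjoint to its left, e is moved through the shifts and arrives
    composed with an iterate of the map. *)
Lemma conv_elem_shift0 d a e :
  conv (elem d a 0 e) shift = elem (d \* (e \o iter a theta)) a.+1 0 (fun=> 1).
Proof.
apply/funext => g; have [l [ul _ lP]] := at_most_exact (fibM (src g)).
rewrite (conv_shift _ ul lP); pose w := iter a theta (rng g).
have E z : z \in l -> elem d a 0 e (gmul g (ginv (gstep z))) =
    if (deg g == a.+1%:Z) && (z == w) then d (rng g) * e w else 0.
  move=> /lP zg; have sg : src g = rng (ginv (gstep z)) by [].
  have [/andP[/eqP dg /eqP zw]|n] := boolP (_ && _).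
    rewrite zw in sg *; have L : lag a 0 (gmul g (ginv (gstep w))).
      split; last by rewrite rng_gmul// src_gmul.
      by rewrite deg_gmul// deg_ginv deg_gstep dg; lia.
    by rewrite elemE// rng_gmul// src_gmul.
  rewrite elemN// => -[]; rewrite ?deg_gmul ?rng_gmul ?src_gmul// => dg ew.
  case/negP: n; apply/andP; split; last by rewrite /w ew.
  by apply/eqP; move: dg; rewrite deg_ginv deg_gstep; lia.
rewrite (eq_big_seq _ E); have [Lg|nL] := pselect (lag a.+1 0 g).
  rewrite elemE// mulr1; case: (Lg) => dg eg; rewrite dg subr0 eqxx /=.
  have wl : w \in l by apply/lP; exact: eg.
  rewrite (bigD1_seq w)//= eqxx big1 ?addr0// => z /negPf ->//.
rewrite elemN// big_seq big1// => z zl; case: ifP => // /andP[/eqP dg /eqP zw].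
exfalso; apply: nL; split; first by rewrite dg; lia.
by have /lP <- := zl; rewrite zw.
Qed.

Lemma invol_elem d a b e :
  invol (elem d a b e) = elem (fun y => (e y)^*) b a (fun y => (d y)^*).
Proof.
have L g : lag a b (ginv g) <-> lag b a g.
  by rewrite /lag /= rng_ginv src_ginv deg_ginv; split=> -[h1 ->]; split=> //; lia.
apply/funext => g; rewrite /invol; have [Lg|nL] := pselect (lag b a g).
  by rewrite !elemE ?rmorphM 1?mulrC//; exact/L.
by rewrite !elemN => [||/L] //; exact: conjc0.
Qed.

Lemma invol_shift : invol shift = coshift.
Proof. by rewrite invol_elem; congr elem; apply/funext => y; exact: conjc1. Qed.

Lemma unif_finite_elem d a b e : bdd_fun d -> bdd_fun e -> unif_finite (elem d a b e).
Proof. by move=> bd be; have [n [s h]] := unif_finite_by_elem fibM a b bd be; exists n, s. Qed.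

Lemma bounded_cst (z : C) : bdd_fun (fun=> z : C) (T := Y).
Proof. by exists (nsq z). Qed.

Section algebra.
Variable D : set (Y -> C).
Hypothesis D_bounded : forall d, D d -> bdd_fun d.
Hypothesis D1 : D (fun=> 1).
Hypothesis D_mul : forall d e, D d -> D e -> D (d \* e).
Hypothesis D_scale : forall (z : C) d, D d -> D (z \*: d).
Hypothesis D_conj : forall d, D d -> D (fun y => (d y)^*).
Hypothesis D_comp : forall d, D d -> D (d \o theta).
Hypothesis D_transfer : forall d, D d -> D (transfer d).

Lemma span_elem_invol f : span_elem D f -> span_elem D (invol f).
Proof.
elim=> [d a b e Dd De|h k _ sh _ sk].
  by rewrite invol_elem; apply: span_elem1; exact: D_conj.
have -> : invol (h \+ k) = invol h \+ invol k.
  by apply/funext => g; rewrite /invol /= rmorphD.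
exact: span_elemD.
Qed.

Lemma span_elem_scale (z : C) f : span_elem D f -> span_elem D (z \*: f).
Proof.
elim=> [d a b e Dd De|h k _ sh _ sk].
  have -> : z \*: elem d a b e = elem (z \*: d) a b e.
    apply/funext => g; have [Lg|nL] := pselect (lag a b g); rewrite [LHS]/GRing.scale/=.
      by rewrite !elemE// mulrA.
    by rewrite !elemN// mulr0.
  by apply: span_elem1 => //; exact: D_scale.
have -> : z \*: (h \+ k) = z \*: h \+ z \*: k.
  by apply/funext => g /=; rewrite scalerDr.
exact: span_elemD.
Qed.

Let span_fin f : span_elem D f -> unif_finite f.
Proof. exact: unif_finite_span. Qed.

Let rmul f := unif_finite f /\ forall p, span_elem D p -> span_elem D (conv p f).

Let rmul_conv f h : rmul f -> rmul h -> rmul (conv f h).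
Proof.
move=> [Ff hf] [Fh hh]; split; first exact: unif_finite_conv.
by move=> p sp; rewrite -convA//; [apply/hh/hf|exact: span_fin].
Qed.

Let rmul_gen f : unif_finite f ->
  (forall d a b e, D d -> D e -> span_elem D (conv (elem d a b e) f)) -> rmul f.
Proof.
move=> Ff h; split=> // p; elim=> [d a b e Dd De|p1 p2 h1 s1 h2 s2].
  exact: h.
by rewrite convDl; [exact: span_elemD|exact: span_fin|exact: span_fin].
Qed.

Let rmul_units d : D d -> rmul (on_units d).
Proof.
move=> Dd; apply: rmul_gen.
  by rewrite on_unitsE; apply: unif_finite_elem; [exact: bounded_cst|exact: D_bounded].
move=> d' a b e Dd' De; rewrite conv_elem_units; apply: span_elem1 => //.
exact: D_mul.
Qed.

Let rmul_coshift : rmul coshift.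
Proof.
apply: rmul_gen; first by apply: unif_finite_elem; exact: bounded_cst.
move=> d a b e Dd De; rewrite conv_elem_coshift; apply: span_elem1 => //.
exact: D_comp.
Qed.

Let D_iter n d : D d -> D (d \o iter n theta).
Proof.
move=> Dd; elim: n => [|n IH] //.
have -> : d \o iter n.+1 theta = (d \o iter n theta) \o theta.
  by apply/funext => y /=; rewrite -iterS iterSr.
exact: D_comp.
Qed.

Let rmul_shift : rmul shift.
Proof.
apply: rmul_gen; first by apply: unif_finite_elem; exact: bounded_cst.
move=> d a [|b] e Dd De.
  by rewrite conv_elem_shift0; apply: span_elem1 => //; apply: D_mul => //; exact: D_iter.
by rewrite conv_elem_shiftS; apply: span_elem1 => //; exact: D_transfer.
Qed.

Let rmul_elem d a b e : D d -> D e -> rmul (elem d a b e).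
Proof.
move=> Dd De; have -> : elem d a b e = conv (elem d a b (fun=> 1)) (on_units e).
  by rewrite conv_elem_units; congr elem; apply/funext => y /=; rewrite mul1r.
apply: rmul_conv; last exact: rmul_units.
elim: b => [|b IH]; last first.
  by rewrite -[fun=> 1]/((fun=> 1) \o theta) -conv_elem_coshift; exact: rmul_conv.
elim: a => [|a IH]; first by rewrite -on_unitsEl; exact: rmul_units.
have -> : elem d a.+1 0 (fun=> 1) = conv (elem d a 0 (fun=> 1)) shift.
  by rewrite conv_elem_shift0; congr elem; apply/funext => y /=; rewrite mulr1.
exact: rmul_conv.
Qed.

(** An elementary function is a product of diagonal elements, shifts and adjoints
    of shifts, so by associativity only right multiplication by these three kinds
    of functions has to be checked. *)
Lemma span_elem_conv f h : span_elem D f -> span_elem D h -> span_elem D (conv f h).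
Proof.
move=> sf sh; suff [_] : rmul h by apply.
elim: sh => [d a b e Dd De|p q _ [Fp hp] _ [Fq hq]]; first exact: rmul_elem.
split; first exact: unif_finite_add.
move=> k sk; rewrite convDr; last exact: span_fin.
by apply: span_elemD; [exact: hp|exact: hq].
Qed.

End algebra.

End elem_products.

(** * Approximation in norm and partitions of unity *)

Section approximation_in_norm.
Context {R : realType} {X : topologicalType} {phi : X -> X}.
Local Notation C := R[i].
Local Notation G := (groupoid phi).
Implicit Types (f h k : G -> C) (P : set (G -> C)).

Lemma approx_sub P Q f : P `<=` Q -> approx P f -> approx Q f.
Proof.
move=> PQ [Ff hf]; split=> // e /hf[h Ph o]; exists h => //; exact: PQ.
Qed.

Lemma op_le_eq0 (K : R) : op_le (fun _ : G => 0 : C) K.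
Proof.
apply: (@op_le_unif_finite _ _ _ 0 0); last by rewrite mulr0 sqr_ge0.
by split=> [y|y|g]; do ?[by exists [::] => // g [_]; rewrite eqxx]; rewrite nsq0.
Qed.

Lemma op_le_sub0 f (K : R) : op_le (f \- f) K.
Proof.
have -> : f \- f = fun=> 0 by apply/funext => g /=; rewrite subrr.
exact: op_le_eq0.
Qed.

Lemma approx_self P f : unif_finite f -> P f -> approx P f.
Proof. by move=> Ff Pf; split=> // e e0; exists f => //; exact: op_le_sub0. Qed.

Lemma op_le_tri f h k (K L : R) : unif_finite f -> unif_finite h ->
  unif_finite k -> 0 < K -> 0 < L ->
  op_le (f \- h) K -> op_le (h \- k) L -> op_le (f \- k) (K + L).
Proof.
move=> Ff Fh Fk K0 L0 o1 o2; have -> : f \- k = (f \- h) \+ (h \- k).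
  by apply/funext => g /=; rewrite addrA subrK.
by apply: op_leD => //; exact: unif_finite_sub.
Qed.

Lemma op_le_subC f h (K : R) : op_le (f \- h) K -> op_le (h \- f) K.
Proof.
have -> : h \- f = (-1 : C) \*: (f \- h).
  by apply/funext => g /=; rewrite scaleN1r opprB.
move=> /(@op_leZ _ _ _ (-1) _ _ 1); rewrite mul1r; apply.
by rewrite nsqN /nsq /= expr1n expr0n addr0.
Qed.

Lemma bdd_nsq (z : C) : exists2 L : R, 0 < L & nsq z <= L ^+ 2.
Proof.
exists (1 + nsq z); first by rewrite ltr_wpDr ?nsq_ge0.
have := nsq_ge0 z; set a := nsq z; nra.
Qed.

Section closure.
Variable P : set (G -> C).
Hypothesis P_unif_finite : forall f, P f -> unif_finite f.
Hypothesis P_add : forall f h, P f -> P h -> P (f \+ h).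
Hypothesis P_scale : forall (z : C) f, P f -> P (z \*: f).
Hypothesis P_conv : forall f h, P f -> P h -> P (conv f h).
Hypothesis P_invol : forall f, P f -> P (invol f).

Lemma approxD f h : approx P f -> approx P h -> approx P (f \+ h).
Proof.
move=> [Ff hf] [Fh hh]; split; first exact: unif_finite_add.
move=> e e0; have e2 : 0 < e / 2 by rewrite divr_gt0.
have [f' Pf of'] := hf _ e2; have [h' Ph oh'] := hh _ e2.
exists (f' \+ h'); first exact: P_add.
have -> : (f \+ h) \- (f' \+ h') = (f \- f') \+ (h \- h').
  by apply/funext => g /=; rewrite opprD addrACA.
by rewrite [e]splitr; apply: op_leD => //; apply: unif_finite_sub => //; exact: P_unif_finite.
Qed.

Lemma approxZ (z : C) f : approx P f -> approx P (z \*: f).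
Proof.
move=> [Ff hf]; split; first exact: unif_finite_scale.
move=> e e0; have [L L0 zL] := bdd_nsq z.
have [f' Pf of'] := hf _ (divr_gt0 e0 L0).
exists (z \*: f'); first exact: P_scale.
have -> : z \*: f \- z \*: f' = z \*: (f \- f').
  by apply/funext => g /=; rewrite scalerBr.
have -> : e = L * (e / L) by rewrite [RHS]mulrC divfK// gt_eqF.
exact: op_leZ.
Qed.

Lemma conv_sub f h f' h' : unif_finite f -> unif_finite h -> unif_finite f' ->
  unif_finite h' ->
  conv f h \- conv f' h' = conv f (h \- h') \+ conv (f \- f') h'.
Proof.
move=> Ff Fh Ff' Fh'.
have E (a b : G -> C) : a \- b = a \+ (-1 : C) \*: b.
  by apply/funext => g /=; rewrite scaleN1r.
rewrite !E convDr// convDl//; last exact: unif_finite_scale.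
rewrite convZr convZl; apply/funext => g /=.
by rewrite !scaleN1r addrA subrK.
Qed.

Lemma approxM f h : approx P f -> approx P h -> approx P (conv f h).
Proof.
move=> [Ff hf] [Fh hh]; split; first exact: unif_finite_conv.
move=> e e0; have e2 : 0 < e / 2 by rewrite divr_gt0.
(* The accuracy of f' depends on the norm of h', which is therefore chosen first. *)
have [K K0 oK] := unif_finite_op_le Ff.
have [h' Ph oh] := hh _ (divr_gt0 e2 K0); have Fh' := P_unif_finite Ph.
have [L L0 oL] := unif_finite_op_le Fh'.
have [f' Pf of'] := hf _ (divr_gt0 e2 L0); have Ff' := P_unif_finite Pf.
exists (conv f' h'); first exact: P_conv.
rewrite conv_sub// [e]splitr; apply: op_leD => //.
- by apply: unif_finite_conv => //; exact: unif_finite_sub.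
- by apply: unif_finite_conv => //; exact: unif_finite_sub.
- have -> : e / 2 = K * (e / 2 / K) by rewrite [RHS]mulrC divfK// gt_eqF.
  by apply: op_le_conv => //; exact: unif_finite_sub.
- have -> : e / 2 = e / 2 / L * L by rewrite divfK// gt_eqF.
  by apply: op_le_conv => //; exact: unif_finite_sub.
Qed.

Lemma approxI f : approx P f -> approx P (invol f).
Proof.
move=> [Ff hf]; split; first exact: unif_finite_invol.
move=> e e0; have [f' Pf of'] := hf _ e0.
exists (invol f'); first exact: P_invol.
have -> : invol f \- invol f' = invol (f \- f').
  by apply/funext => g; rewrite /invol /= rmorphB.
by apply: op_le_invol => //; apply: unif_finite_sub => //; exact: P_unif_finite.
Qed.

Lemma alg_star_approx :
  (forall f, continuous f -> compactly_supported f -> approx P f) ->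
  forall f, alg_star f -> approx P f.
Proof.
move=> cc f; elim=> {f}.
- exact: cc.
- by move=> f h _ ? _ ?; exact: approxD.
- by move=> z f _ ?; exact: approxZ.
- by move=> f h _ ? _ ?; exact: approxM.
- by move=> f _ ?; exact: approxI.
Qed.

End closure.

End approximation_in_norm.

Section partition.
Context {R : realType} {X : metricType R} {phi : X -> X}.

Lemma continuous_mdist (x : X) : continuous (mdist x : X -> R).
Proof.
move=> y; apply/cvgrPdist_lt => e e0.
apply: filterS (nbhsx_ballx y e e0) => z; rewrite ballEmdist /= => yz.
rewrite ltr_norml; apply/andP; split.
- by have := metric_triangle x y z; lra.
- by have := metric_triangle x z y; rewrite (metric_sym z y); lra.
Qed.

(** Twice the positive part of p.2 - mdist p.1 y, so that its support is a
    ball. *)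
Let bump (p : X * R) (y : X) : R := (p.2 - mdist p.1 y) + `|p.2 - mdist p.1 y|.

Let bump_ge0 p y : 0 <= bump p y.
Proof. by rewrite /bump -lerBlDl sub0r ler_normr lexx orbT. Qed.

Let bump_gt0 p y : bump p y != 0 -> ball p.1 p.2 y.
Proof.
rewrite ballEmdist /= => b0; rewrite ltNge; apply/negP => le.
by move: b0; rewrite /bump ler0_norm ?subr_le0// subrr eqxx.
Qed.

Let continuous_bump p : continuous (bump p).
Proof.
have c : continuous (fun y => p.2 - mdist p.1 y).
  by move=> y; apply: (@continuousB R R _ (fun=> p.2) (mdist p.1) y); [exact: cvg_cst|exact: continuous_mdist].
move=> y; apply: (@continuousD R R _ (fun y => p.2 - mdist p.1 y)
  (fun y => `|p.2 - mdist p.1 y|) y); first exact: c.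
by apply: continuous_comp; [exact: c|exact: (@norm_continuous R R)].
Qed.

(** The squares sum to 1 because the functions are used on both sides of a
    product, in sums of terms u p d u p. *)
Lemma loc_inj_partition : compact [set: X] -> loc_inj phi ->
  exists (L : seq (X * R)) (u : X * R -> X -> R),
  [/\ forall p, continuous (u p),
      forall p, p \in L -> forall x y, u p x != 0 -> u p y != 0 ->
        phi x = phi y -> x = y
    & forall x, \sum_(p <- L) u p x ^+ 2 = 1].
Proof.
move=> cX li.
have [L LI LX] : exists2 L : seq (X * R),
    forall p, p \in L -> set_inj (ball p.1 p.2) phi
  & forall x, [set: X] x -> exists2 p, p \in L & 0 < bump p x.
  apply: (@compact_ind _ _ (fun U : set X => exists2 L : seq (X * R),
    forall p, p \in L -> set_inj (ball p.1 p.2) phi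
  & forall x, U x -> exists2 p, p \in L & 0 < bump p x) cX).
  - by exists [::].
  - move=> U V [L1 I1 h1] [L2 I2 h2]; exists (L1 ++ L2).
      by move=> p; rewrite mem_cat => /orP[/I1|/I2].
    by move=> x [/h1|/h2] [p pL bp]; exists p => //; rewrite mem_cat pL ?orbT.
  - by move=> U V UV [L1 I1 h1]; exists L1 => // x /UV/h1.
  move=> x _; have [U [oU Ux iU]] := li x.
  have /nbhs_ballP[r /= r0 rU] : nbhs x U by exact: open_nbhs_nbhs.
  exists (ball x r); first exact: nbhsx_ballx.
  exists [:: (x, r)].
    move=> p; rewrite inE => /eqP -> y z /set_mem/rU Uy /set_mem/rU Uz.
    by apply: iU; rewrite inE.
  move=> y xy; exists (x, r); first by rewrite mem_head.
  rewrite lt_def bump_ge0 andbT /bump /=; move: xy; rewrite ballEmdist /= => xy.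
  by rewrite gtr0_norm ?subr_gt0// -mulr2n mulrn_eq0/= subr_eq0 gt_eqF.
pose s y := \sum_(p <- L) bump p y.
have s0 y : 0 < s y.
  have [p pL bp] := LX y I; rewrite /s (big_rem p)//= ltr_pwDl//.
  by apply: sumr_ge0 => q _; exact: bump_ge0.
have cs : continuous s.
  rewrite /s; elim: (L) => [|p l IH].
    have -> : (fun y => \sum_(p <- [::]) bump p y) = fun=> 0.
      by apply/funext => y; rewrite big_nil.
    by move=> y; exact: cvg_cst.
  have -> : (fun y => \sum_(q <- p :: l) bump q y) =
      (fun y => bump p y + \sum_(q <- l) bump q y).
    by apply/funext => y; rewrite big_cons.
  by move=> y; apply: (@continuousD R R _ (bump p) _ y); [exact: continuous_bump|exact: IH].
exists L, (fun p y => Num.sqrt (bump p y * (s y)^-1)); split.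
- move=> p y; apply: continuous_comp; last exact: sqrt_continuous.
  apply: (@continuousM R _ (bump p) (fun y => (s y)^-1)).
    exact: continuous_bump.
  by apply: (@cvgV R); [rewrite gt_eqF|exact: cs].
- move=> p pL x y; rewrite !sqrtr_eq0 -!ltNge => bx by_.
  have h z : 0 < bump p z * (s z)^-1 -> z \in (ball p.1 p.2 : set X).
    rewrite pmulr_lgt0 ?invr_gt0// => bz; rewrite inE; apply: bump_gt0.
    by rewrite gt_eqF.
  exact: (LI p pL x y (h _ bx) (h _ by_)).
- move=> x; under eq_bigr do rewrite sqr_sqrtr ?divr_ge0 ?bump_ge0 ?(ltW (s0 _))//.
  by rewrite -mulr_suml -/(s x) divff// gt_eqF.
Qed.

End partition.

(** * The diagonal algebra *)

Section diagonal_algebra.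
Context {R : realType} {X : metricType R} {phi : X -> X}.
Local Notation C := R[i].
Local Notation G := (groupoid phi).
Implicit Types (d e : X -> C).

Hypothesis compactX : compact [set: X].
Hypothesis continuous_phi : continuous phi.
Hypothesis loc_inj_phi : loc_inj phi.

Variables (I : eqType) (L : seq I) (u : I -> X -> R).
Hypothesis u_cont : forall i, continuous (u i).
Hypothesis u_inj : forall i, i \in L -> forall x y, u i x != 0 -> u i y != 0 ->
  phi x = phi y -> x = y.
Hypothesis u_sum : forall x, \sum_(i <- L) u i x ^+ 2 = 1.

Lemma partition_neq0 x : exists2 i, i \in L & u i x != 0.
Proof.
apply: contrapT => no; have := u_sum x; rewrite big_seq big1 => [/esym/eqP|i iL].
  by rewrite oner_eq0.
apply/eqP; rewrite sqrf_eq0; apply: contrapT => /negP ui.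
by apply: no; exists i.
Qed.

Lemma fibres_partition : fibres_at_most (theta := phi) (size L).
Proof.
exact: (fibres_cover partition_neq0 u_inj).
Qed.

Let fibM := fibres_partition.
Let hausX : hausdorff_space X.
Proof. exact: metric_hausdorff. Qed.

Lemma cc_approx_continuous (f : G -> C) : continuous f -> compactly_supported f ->
  approx (span_elem [set d | continuous d]) f.
Proof.
pose D := [set d : X -> C | continuous d].
have D1 : D (fun=> 1) by move=> x; exact: cvg_cst.
have DM d e : D d -> D e -> D (d \* e).
  by move=> cd ce x; apply: (@continuousM _ _ d e); [exact: cd|exact: ce].
have DZ (z : C) d : D d -> D (z \*: d).
  move=> cd x; apply: (@continuousM _ _ (fun=> z) d); first exact: cvg_cst.
  exact: cd.
have DJ d : D d -> D (fun x => (d x)^*) by move=> cd; exact: continuous_conj.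
have Dsep x y : x <> y -> exists2 d, D d & d x <> d y.
  move=> xy; exists (fun z => (mdist x z)%:C : C).
    by apply: continuous_real; exact: continuous_mdist.
  by rewrite mdistxx => -[] /esym /mdist_positivity.
exact: (@cc_approximable _ _ _ _ fibM compactX hausX continuous_phi loc_inj_phi
  D (fun d h => h) D1 DM DZ DJ Dsep).
Qed.

Lemma alg_star_unif_finite (f : G -> C) : alg_star f -> unif_finite f.
Proof.
elim=> {f}.
- by move=> f cf kf; case: (cc_approx_continuous cf kf).
- by move=> f h _ ? _ ?; exact: unif_finite_add.
- by move=> z f _ ?; exact: unif_finite_scale.
- by move=> f h _ ? _ ?; exact: unif_finite_conv.
- by move=> f _ ?; exact: unif_finite_invol.
Qed.

(** The diagonal elements of alg_star before closure. *)
Definition kept d := alg_star (on_units d : G -> C).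

Lemma unif_finite_bdd f : unif_finite f ->
  exists2 K : R, 0 < K & forall g : G, nsq (f g : C) <= K ^+ 2.
Proof. by move=> /unif_finite_op_le[K K0 oK]; exists K => // g; exact: op_le_nsq. Qed.

Lemma kept_bdd d : kept d -> exists2 K : R, 0 < K & forall x, nsq (d x) <= K ^+ 2.
Proof.
move=> /alg_star_unif_finite/unif_finite_bdd[K K0 hK]; exists K => // x.
by have := hK (gunit x); rewrite on_units_unit.
Qed.

Lemma op_le_units d (e : R) : (forall x, nsq (d x) <= e ^+ 2) ->
  op_le (on_units d : G -> C) e.
Proof.
move=> de; apply: (@op_le_unif_finite _ _ _ 1 (e ^+ 2)); last by rewrite !mul1r.
have n0 g : on_units d g != 0 -> g = gunit (src g) /\ g = gunit (rng g).
  rewrite /on_units; case: ifP; rewrite ?eqxx// => /andP[/eqP e1 /eqP e2] _.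
  by split; apply: gpd_eq.
split.
- move=> y; exists [:: gunit y] => // g [gy /n0[_]]; rewrite gy => ->.
  by rewrite mem_head.
- move=> y; exists [:: gunit y] => // g [gy /n0[]]; rewrite gy => -> _.
  by rewrite mem_head.
- by move=> g; rewrite /on_units; case: ifP => _; rewrite ?nsq0 ?sqr_ge0.
Qed.

Lemma on_unitsB d e : on_units d \- on_units e = on_units (d \- e) :> (G -> C).
Proof. by apply/funext => g; rewrite /on_units /=; case: ifP; rewrite ?subrr. Qed.

(** For functions on the units the reduced norm is the supremum norm: it bounds
    every value by op_le_nsq, and conversely there is one entry per row and
    column, so that the Schur test is sharp. *)
Lemma diagP d : diag phi d <->
  forall e : R, 0 < e -> exists2 d0, kept d0 & forall x, nsq (d x - d0 x) <= e ^+ 2.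
Proof.
split=> h e e0.
  have [f [af sf] le] := h e e0; exists (fun x => f (gunit x)).
    rewrite /kept; suff -> : on_units (fun x => f (gunit x)) = f by [].
    apply/funext => g; rewrite /on_units; case: ifPn => [/andP[/eqP e1 /eqP e2]|n].
      by congr f; apply: gpd_eq.
    apply/esym/eqP; apply: contraR n => /sf[-> ->].
    by rewrite !eqxx.
  have /reduced_norm_le o := ltW le; move=> x.
  have := op_le_nsq (gunit x) (o (ltW e0)); rewrite /= on_units_unit.
  by [].
have e2 : 0 < e / 2 by rewrite divr_gt0.
have [d0 kd0 dd] := h _ e2; exists (on_units d0).
  split=> // g; rewrite /on_units; case: ifP; rewrite ?eqxx//.
  by move=> /andP[/eqP ? /eqP ?].
apply: (@le_lt_trans _ _ (e / 2)%:E); last first.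
  by rewrite lte_fin ltr_pdivrMr// ltr_pMr// ltr1n.
apply/reduced_norm_le; first exact: ltW.
rewrite [X in op_le X _](_ : _ = on_units (d \- d0)); last exact: on_unitsB.
exact: op_le_units.
Qed.

Lemma kept_diag d : kept d -> diag phi d.
Proof.
move=> kd; apply/diagP => e e0; exists d => // x.
by rewrite subrr nsq0 sqr_ge0.
Qed.

Lemma nsq_tri (a b c : C) (r s : R) : 0 <= r -> 0 <= s ->
  nsq (a - b) <= r ^+ 2 -> nsq (b - c) <= s ^+ 2 -> nsq (a - c) <= (r + s) ^+ 2.
Proof.
move=> r0 s0 h1 h2; have -> : a - c = (a - b) + (b - c) by rewrite addrA subrK.
exact: nsqD_bound.
Qed.

Lemma diag_closed d :
  (forall e : R, 0 < e -> exists2 d0, diag phi d0 & forall x, nsq (d x - d0 x) <= e ^+ 2) ->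
  diag phi d.
Proof.
move=> h; apply/diagP => e e0; have e2 : 0 < e / 2 by rewrite divr_gt0.
have [d1 /diagP D1 h1] := h _ e2; have [d2 K2 h2] := D1 _ e2.
exists d2 => // x; rewrite [e]splitr.
by apply: (nsq_tri _ _ (h1 x) (h2 x)); exact: ltW.
Qed.

Lemma diag_bdd d : diag phi d ->
  exists2 K : R, 0 < K & forall x, nsq (d x) <= K ^+ 2.
Proof.
move=> /diagP /(_ 1 ltr01)[d0 /kept_bdd[K K0 hK] h]; exists (1 + K).
  by rewrite addr_gt0.
move=> x; have -> : d x = (d x - d0 x) + d0 x by rewrite subrK.
by apply: nsqD_bound => //; exact: ltW.
Qed.

Lemma diag_map (F : (X -> C) -> (X -> C)) (K : R) : 0 < K ->
  (forall d, kept d -> kept (F d)) ->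
  (forall d d0 (e : R), 0 < e -> (forall x, nsq (d x - d0 x) <= e ^+ 2) ->
     forall x, nsq (F d x - F d0 x) <= (K * e) ^+ 2) ->
  forall d, diag phi d -> diag phi (F d).
Proof.
move=> K0 kF cF d /diagP Dd; apply/diagP => e e0.
have [d0 k0 h] := Dd _ (divr_gt0 e0 K0); exists (F d0); first exact: kF.
have -> : e = K * (e / K) by rewrite [RHS]mulrC divfK// gt_eqF.
by apply: cF => //; exact: divr_gt0.
Qed.

Lemma on_unitsD d e : on_units (d \+ e) = on_units d \+ on_units e :> (G -> C).
Proof. by apply/funext => g; rewrite /on_units /=; case: ifP; rewrite ?addr0. Qed.

Lemma on_unitsZ (z : C) d : on_units (z \*: d) = z \*: on_units d :> (G -> C).
Proof. by apply/funext => g; rewrite /on_units /=; case: ifP; rewrite ?scaler0. Qed.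

Lemma conv_units d e : conv (on_units d) (on_units e) = on_units (d \* e) :> (G -> C).
Proof.
apply/funext => g; rewrite conv_unitsl /on_units; case: ifP; rewrite ?mulr0//.
Qed.

Lemma invol_units d : invol (on_units d) = on_units (fun x => (d x)^*) :> (G -> C).
Proof.
by rewrite on_unitsE invol_elem on_unitsEl; congr elem; apply/funext => x; exact: conjc1.
Qed.

Lemma kept_cont d : continuous d -> kept d.
Proof.
move=> cd; rewrite /kept on_unitsE.
have c1 : continuous (fun _ : X => 1 : C) by move=> x; exact: cvg_cst.
exact: (@alg_star_elem R X phi compactX hausX continuous_phi loc_inj_phi
  (fun=> 1) 0 0 d c1 cd).
Qed.

Lemma diag_cont d : continuous d -> diag phi d.
Proof. by move=> /kept_cont/kept_diag. Qed.

Lemma diag_cst (z : C) : diag phi (fun=> z).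
Proof. by apply: diag_cont => x; exact: cvg_cst. Qed.

Lemma diagD d e : diag phi d -> diag phi e -> diag phi (d \+ e).
Proof.
move=> /diagP Dd /diagP De; apply/diagP => r r0.
have r2 : 0 < r / 2 by rewrite divr_gt0.
have [d0 kd hd] := Dd _ r2; have [e0 ke he] := De _ r2.
exists (d0 \+ e0); first by rewrite /kept on_unitsD; exact: alg_starD.
move=> x; rewrite /= opprD addrACA [r]splitr.
by apply: nsqD_bound => //; exact: ltW.
Qed.

Lemma diagZ (z : C) d : diag phi d -> diag phi (z \*: d).
Proof.
have [K K0 zK] := bdd_nsq z; apply: (@diag_map (fun d => z \*: d) _ K0).
  by move=> {}d kd; rewrite /kept on_unitsZ; exact: alg_starZ.
move=> {}d d0 e e0 h x; rewrite /= -scalerBr nsqM exprMn.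
by rewrite ler_pM ?nsq_ge0.
Qed.

Lemma diagM d e : diag phi d -> diag phi e -> diag phi (d \* e).
Proof.
move=> Dd De; have [K K0 hK] := diag_bdd Dd; apply/diagP => r r0.
have r2 : 0 < r / 2 by rewrite divr_gt0.
have [e1 ke he] := (diagP e).1 De _ (divr_gt0 r2 K0).
have [H H0 hH] := kept_bdd ke.
have [d1 kd hd] := (diagP d).1 Dd _ (divr_gt0 r2 H0).
exists (d1 \* e1); first by rewrite /kept -conv_units; exact: alg_star_conv.
move=> x; have -> : (d \* e) x - (d1 \* e1) x =
   d x * (e x - e1 x) + (d x - d1 x) * e1 x by rewrite /=; ring.
rewrite [r]splitr; apply: nsqD_bound; rewrite ?(ltW r2)//.
- have -> : r / 2 = K * (r / 2 / K) by rewrite [RHS]mulrC divfK// gt_eqF.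
  by rewrite nsqM exprMn ler_pM ?nsq_ge0.
- have -> : r / 2 = (r / 2 / H) * H by rewrite divfK// gt_eqF.
  by rewrite nsqM exprMn ler_pM ?nsq_ge0.
Qed.

Lemma diagJ d : diag phi d -> diag phi (fun x => (d x)^*).
Proof.
apply: (@diag_map (fun d x => (d x)^*) _ ltr01).
  by move=> {}d kd; rewrite /kept -invol_units; exact: alg_star_invol.
by move=> {}d d0 e e0 h x; rewrite mul1r -rmorphB nsqJ.
Qed.

Lemma alg_star_shift : alg_star (shift : G -> C).
Proof.
have c1 : continuous (fun _ : X => 1 : C) by move=> x; exact: cvg_cst.
exact: (@alg_star_elem R X phi compactX hausX continuous_phi loc_inj_phi
  (fun=> 1) 1 0 (fun=> 1) c1 c1).
Qed.

Lemma alg_star_coshift : alg_star (coshift : G -> C).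
Proof. by rewrite -invol_shift; apply: alg_star_invol; exact: alg_star_shift. Qed.

Lemma kept_transfer d : kept d -> kept (transfer (theta := phi) d).
Proof.
move=> kd; rewrite /kept; have -> : on_units (transfer (theta := phi) d) =
    conv (conv coshift (on_units d)) shift :> (G -> C).
  rewrite /coshift conv_elem_units (conv_elem_shiftS fibM) on_unitsE.
  by congr elem; congr transfer; apply/funext => x /=; rewrite mul1r.
apply: alg_star_conv alg_star_shift; exact: alg_star_conv alg_star_coshift kd.
Qed.

Lemma diag_transfer d : diag phi d -> diag phi (transfer (theta := phi) d).
Proof.
have K0 : (0 : R) < (size L).+1%:R by rewrite ltr0n.
apply: (@diag_map (@transfer R X phi) _ K0) => [{}d|{}d d0 e e0 h x]; first exact: kept_transfer.
have [l [ul sl lP]] := at_most_exact (fibM x).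
rewrite !(transferE _ ul lP) -sumrB; apply: (le_trans (nsq_sum _ _)).
apply: (@le_trans _ _ ((size l)%:R * \sum_(z <- l) e ^+ 2)).
  by rewrite ler_wpM2l//; apply: ler_sum => z _; exact: h.
rewrite big_const_seq count_predT iter_addr_0 -(mulr_natl (e ^+ 2)) mulrA exprMn.
rewrite ler_wpM2r ?sqr_ge0// -expr2 ler_pXn2r ?nnegrE ?ler0n// ler_nat.
by rewrite (leq_trans sl).
Qed.

(** For the shift S and its adjoint T, the function S d T is d o phi spread over
    the arrows of degree 0 whose ends have the same image under phi. Cutting it
    down by u i on both sides leaves only units, as phi is injective where u i
    does not vanish, and summing over i gives back d o phi, as the squares of the
    u i sum to 1. *)
Lemma kept_comp d : kept d -> kept (d \o phi).
Proof.
move=> kd; pose w i : X -> C := fun x => (u i x)%:C.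
have kw i : kept (w i) by apply: kept_cont; apply: continuous_real; exact: u_cont.
pose S : G -> C := fun g => \sum_(i <- L)
  conv (conv (on_units (w i)) (conv (conv shift (on_units d)) coshift)) (on_units (w i)) g.
have aS : alg_star S.
  rewrite /S; elim: (L) => [|i l IH].
    have -> : (fun g : G => \sum_(i <- [::]) conv (conv (on_units (w i))
       (conv (conv shift (on_units d)) coshift)) (on_units (w i)) g) =
       (0 : C) \*: on_units d.
      by apply/funext => g; rewrite big_nil /= scale0r.
    exact: alg_starZ.
  under [X in alg_star X]funext => g do rewrite big_cons.
  apply: alg_starD IH; apply: alg_star_conv (kw i); apply: alg_star_conv (kw i) _.
  by apply: alg_star_conv alg_star_coshift; exact: alg_star_conv alg_star_shift kd.
suff E : on_units (d \o phi) = S by rewrite /kept E.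
apply/funext => g; rewrite /S.
have E1 i : conv (conv (on_units (w i)) (conv (conv shift (on_units d)) coshift))
    (on_units (w i)) g =
   w i (rng g) * elem (fun=> 1) 1 1 ((fun=> 1) \* d \o phi) g * w i (src g).
  by rewrite conv_unitsr conv_unitsl /shift conv_elem_units conv_elem_coshift.
under eq_bigr do rewrite E1.
have [Lg|nL] := pselect (lag 1 1 g); last first.
  rewrite big1 => [|i _]; last by rewrite elemN// mulr0 mul0r.
  rewrite /on_units; case: ifP => // /andP[/eqP e1 /eqP e2].
  by exfalso; apply: nL; split; rewrite ?e2 ?e1.
under eq_bigr do rewrite elemE// /= !mul1r.
have dg : deg g = 0 by case: Lg => -> _.
have pg : phi (rng g) = phi (src g) by case: Lg.
rewrite /on_units dg eqxx andbT; case: eqP => [e|ne].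
  rewrite e; transitivity ((\sum_(i <- L) u i (src g) ^+ 2)%:C * d (phi (src g))).
    by rewrite u_sum mul1r.
  rewrite rmorph_sum mulr_suml; apply: eq_bigr => i _.
  by rewrite rmorphXn /= /w expr2 mulrAC.
rewrite big_seq big1// => i iL.
have [u0|un] := eqVneq (u i (rng g)) 0; first by rewrite /w u0 !mul0r.
have [u0|un'] := eqVneq (u i (src g)) 0; first by rewrite /w u0 mulr0.
by case: ne; exact: (u_inj iL).
Qed.

Lemma diag_comp d : diag phi d -> diag phi (d \o phi).
Proof.
apply: (@diag_map (fun d => d \o phi) _ ltr01) => [{}d|{}d d0 e e0 h x]; first exact: kept_comp.
by rewrite mul1r /=; exact: h.
Qed.

(** An explicit rate for the convergence of (1 - t)^n to 0. *)
Lemma bernoulli_inv (t : R) n : 0 <= t -> t <= 1 -> (1 - t) ^+ n * (1 + n%:R * t) <= 1.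
Proof.
move=> t0 t1; elim: n => [|n IH]; first by rewrite expr0 mul0r addr0 mulr1.
apply: le_trans IH; rewrite exprSr -mulrA ler_wpM2l ?exprn_ge0 ?subr_ge0//.
rewrite -natr1; have n0 : (0 : R) <= n%:R by rewrite ler0n.
move: n0; set m := n%:R; nra.
Qed.

(** The inverse is the uniform limit of the Neumann series of 1 - g / M, written
    as the recursion s + (1 - g s) / M, for which 1 - g s = (1 - g / M)^n. *)
Lemma diag_inv (g : X -> R) (dl : R) : diag phi (fun x => (g x)%:C) -> 0 < dl ->
  (forall x, dl <= g x) -> diag phi (fun x => ((g x)^-1)%:C).
Proof.
move=> Dg d0 dg; have [K K0 hK] := diag_bdd Dg.
pose M := K + dl; have M0 : 0 < M by rewrite addr_gt0.
have gM x : g x <= M.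
  have := hK x; rewrite nsqR -[X in X <= _]real_normK ?num_real//.
  rewrite ler_pXn2r ?nnegrE ?(ltW K0)// => h.
  by rewrite (le_trans (ler_norm _))// (le_trans h)// lerDl ltW.
pose s := fix s (n : nat) (x : X) : R :=
  if n is m.+1 then s m x + (1 - g x * s m x) / M else 0.
have sE n x : 1 - g x * s n x = (1 - g x / M) ^+ n.
  elim: n => [|n IH] /=; first by rewrite mulr0 subr0 expr0.
  rewrite exprS -IH; field; exact: lt0r_neq0.
have Ds n : diag phi (fun x => (s n x)%:C).
  elim: n => [|n IH]; first exact: (diag_cst (0 : R)%:C).
  have -> : (fun x => (s n.+1 x)%:C) = (fun x => (s n x)%:C) \+
     ((M^-1)%:C \*: ((fun=> 1) \+ (-1 : C) \*: ((fun x => (g x)%:C) \* (fun x => (s n x)%:C)))).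
    apply/funext => x; rewrite /= scaleN1r.
    by rewrite rmorphD rmorphM rmorphB rmorphM /= mulrC.
  exact: (diagD IH (diagZ _ (diagD (diag_cst 1) (diagZ _ (diagM Dg IH))))).
pose t := dl / M; have t0 : 0 < t by rewrite divr_gt0.
apply: diag_closed => e e0.
pose n := Num.bound ((dl * e)^-1 / t).
have hn : (dl * e)^-1 / t < n%:R.
  by apply: archi_boundP; rewrite ltW// divr_gt0// invr_gt0 mulr_gt0.
exists (fun x => (s n x)%:C); first exact: Ds.
move=> x; rewrite -rmorphB nsqR.
have gx := dg x; have gx0 : 0 < g x by exact: lt_le_trans gx.
have E : (g x)^-1 - s n x = (1 - g x / M) ^+ n / g x.
  by rewrite -sE; field; rewrite gt_eqF.
have q0 : 0 <= 1 - g x / M by rewrite subr_ge0 ler_pdivrMr// mul1r.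
have qt : 1 - g x / M <= 1 - t by rewrite lerD2l lerN2 ler_wpM2r// invr_ge0 ltW.
have t1 : t <= 1 by have := le_trans q0 qt; rewrite subr_ge0.
rewrite E ler_pXn2r ?nnegrE ?divr_ge0 ?exprn_ge0// ?(ltW gx0) ?(ltW e0)//.
rewrite ler_pdivrMr//.
apply: (@le_trans _ _ (dl * e)); last by rewrite mulrC ler_wpM2l// ltW.
apply: (@le_trans _ _ ((1 - t) ^+ n)).
  by rewrite lerXn2r// nnegrE// subr_ge0.
have de0 : 0 < dl * e by rewrite mulr_gt0.
have h1 : 1 <= dl * e * (1 + n%:R * t).
  rewrite -ler_pdivrMl// mulr1; move: hn; rewrite ltr_pdivrMr// => /ltW h.
  by rewrite (le_trans h)// lerDr.
have nt : 0 < 1 + n%:R * t.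
  by rewrite ltr_wpDr// mulr_ge0// ltW.
rewrite -(ler_pM2r nt); apply: le_trans h1.
exact: bernoulli_inv (ltW t0) t1.
Qed.

End diagonal_algebra.

(** * Characters and compactness of the spectrum *)

Lemma sep_hausdorff (T U : topologicalType) : hausdorff_space U ->
  (forall x y : T, x <> y -> exists2 f : T -> U, continuous f & f x <> f y) ->
  hausdorff_space T.
Proof.
move=> hU sep p q pq; apply: contrapT => /sep[f cf fpq].
apply: fpq; apply: hU => A B nA nB.
have nA' : nbhs p (f @^-1` A) by exact: cf.
have nB' : nbhs q (f @^-1` B) by exact: cf.
by have [x [? ?]] := pq _ _ nA' nB'; exists (f x).
Qed.

Section complex_plane.
Context {R : realType}.
Local Notation C := R[i].

Lemma hausdorff_complex : hausdorff_space C.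
Proof. exact: norm_hausdorff. Qed.

Lemma compact_square (K : R) :
  compact [set z : C | `|complex.Re z| <= K /\ `|complex.Im z| <= K].
Proof.
pose f (p : R * R) : C := p.1 +i* p.2.
have cf : continuous f.
  by apply: continuous_complex => p; [exact: cvg_fst|exact: cvg_snd].
have -> : [set z : C | `|complex.Re z| <= K /\ `|complex.Im z| <= K] =
    f @` (`[- K, K]%classic `*` `[- K, K]%classic).
  apply/seteqP; split=> [[a b] /= [ha hb]|_ [[a b] /= [ha hb] <-]].
    by exists (a, b) => //=; split; rewrite /= in_itv /= -ler_norml.
  by move: ha hb; rewrite !in_itv /= -!ler_norml.
apply: continuous_compact; first exact: continuous_subspaceT.
by apply: compact_setX; exact: segment_compact.
Qed.

End complex_plane.

(* From here on diag is used through its closure properties only. *)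
#[local] Opaque diag.

Section characters.
Context {R : realType} {X : metricType R} {phi : X -> X}.
Local Notation C := R[i].
Implicit Types (d e : X -> C) (c : spectrum R phi).

Hypothesis compactX : compact [set: X].
Hypothesis continuous_phi : continuous phi.
Hypothesis loc_inj_phi : loc_inj phi.

Variables (I : eqType) (L : seq I) (u : I -> X -> R).
Hypothesis u_cont : forall i, continuous (u i).
Hypothesis u_inj : forall i, i \in L -> forall x y, u i x != 0 -> u i y != 0 ->
  phi x = phi y -> x = y.
Hypothesis u_sum : forall x, \sum_(i <- L) u i x ^+ 2 = 1.

Local Notation D := (diag phi).
Let Dcst := @diag_cst _ _ _ compactX continuous_phi loc_inj_phi.
Let Dcont := @diag_cont _ _ _ compactX continuous_phi loc_inj_phi.
Let DD := @diagD _ _ phi.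
Let DZ := @diagZ _ _ phi.
Let DM := @diagM _ _ _ compactX continuous_phi loc_inj_phi _ _ _ u_inj u_sum.
Let DJ := @diagJ _ _ phi.
Let Dbdd := @diag_bdd _ _ _ compactX continuous_phi loc_inj_phi _ _ _ u_inj u_sum.
Let Dinv := @diag_inv _ _ _ compactX continuous_phi loc_inj_phi _ _ _ u_inj u_sum.

Lemma chD c d e : D d -> D e -> sval c (d \+ e) = sval c d + sval c e.
Proof. by case: c => c hc /=; exact: charD. Qed.
Lemma chZ c (z : C) d : D d -> sval c (z \*: d) = z * sval c d.
Proof. by case: c => c hc /=; exact: charZ. Qed.
Lemma chM c d e : D d -> D e -> sval c (d \* e) = sval c d * sval c e.
Proof. by case: c => c hc /=; exact: charM. Qed.
Lemma chJ c d : D d -> sval c (fun x => (d x)^*) = (sval c d)^*.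
Proof. by case: c => c hc /=; exact: char_conj. Qed.
Lemma chcst c (z : C) : sval c (fun=> z) = z.
Proof.
have -> : (fun=> z) = z \*: (fun=> 1 : C) :> (X -> C).
  by apply/funext => x; rewrite /= [RHS]mulr1.
rewrite (chZ c z (Dcst 1)); case: c => c hc /=; by rewrite (char1 hc) mulr1.
Qed.
Lemma chout c d : ~ D d -> sval c d = 0.
Proof. by case: c => c hc /=; exact: char_out. Qed.

Lemma ch_eq c c' : (forall d, D d -> sval c d = sval c' d) -> c = c'.
Proof.
move=> h; have : sval c = sval c'.
  by apply/funext => d; have [Dd|nD] := pselect (D d); [exact: h|rewrite !chout].
by case: c c' {h} => [c p] [c' p'] /= e; subst c'; congr exist; exact: Prop_irrelevance.
Qed.

Lemma chB c d e : D d -> D e -> sval c (d \- e) = sval c d - sval c e.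
Proof.
move=> Dd De; have -> : d \- e = d \+ (-1 : C) \*: e.
  by apply/funext => x /=; rewrite scaleN1r.
by rewrite (chD c Dd (DZ (-1) De)) (chZ c (-1) De) mulN1r.
Qed.

Lemma DB d e : D d -> D e -> D (d \- e).
Proof.
move=> Dd De; have -> : d \- e = d \+ (-1 : C) \*: e.
  by apply/funext => x /=; rewrite scaleN1r.
exact: (DD Dd (DZ (-1) De)).
Qed.

(** If c took a value r < 0 at g, then g - r would be bounded below by - r > 0,
    hence invertible in D, although c vanishes on it. *)
Lemma ch_pos c (g : X -> R) : D (fun x => (g x)%:C) -> (forall x, 0 <= g x) ->
  exists2 r : R, 0 <= r & sval c (fun x => (g x)%:C) = r%:C.
Proof.
move=> Dg g0.
have : sval c (fun x => (g x)%:C) = (complex.Re (sval c (fun x => (g x)%:C)))%:C.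
  have := chJ c Dg; have -> : (fun x => ((g x)%:C)^*) = (fun x => (g x)%:C).
    by apply/funext => x; exact: conjc_real.
  case: (sval c _) => a b [] /eqP; rewrite -addr_eq0 -mulr2n.
  by rewrite mulrn_eq0 /= => /eqP ->.
move: (complex.Re _) => r E; exists r => //; rewrite leNgt; apply/negP => r0.
pose h x := g x - r.
have hE : (fun x => (h x)%:C) = (fun x => (g x)%:C) \- (fun=> r%:C).
  by apply/funext => x; rewrite /h rmorphB.
have Dh : D (fun x => (h x)%:C) by rewrite hE; exact: (DB Dg (Dcst r%:C)).
have h0 x : - r <= h x by rewrite /h lerDr.
have mr : 0 < - r by rewrite oppr_gt0.
have Dk := Dinv Dh mr h0.
have hn x : h x != 0 by rewrite gt_eqF// (lt_le_trans mr).
have : sval c ((fun x => (h x)%:C) \* (fun x => ((h x)^-1)%:C)) = 1.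
  have -> : (fun x => (h x)%:C) \* (fun x => ((h x)^-1)%:C) = (fun=> 1).
    by apply/funext => x; rewrite /= -rmorphM divff.
  exact: chcst.
rewrite (chM c Dh Dk) hE (chB c Dg (Dcst r%:C)) E chcst subrr mul0r => /esym/eqP.
by rewrite oner_eq0.
Qed.

Lemma diag_nsq d : D d -> D (fun x => (nsq (d x))%:C).
Proof.
move=> Dd; have -> : (fun x => (nsq (d x))%:C) = (fun x => (d x)^*) \* d.
  by apply/funext => x; rewrite nsqJ_mul.
exact: (DM (DJ Dd) Dd).
Qed.

Lemma ch_nsq c d : D d -> sval c (fun x => (nsq (d x))%:C) = (nsq (sval c d))%:C.
Proof.
move=> Dd; have -> : (fun x => (nsq (d x))%:C) = (fun x => (d x)^*) \* d.
  by apply/funext => x; rewrite nsqJ_mul.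
by rewrite (chM c (DJ Dd) Dd) (chJ c Dd) nsqJ_mul.
Qed.

Lemma ch_bound c d (K : R) : D d -> (forall x, nsq (d x) <= K) -> nsq (sval c d) <= K.
Proof.
move=> Dd dK; pose g x := K - nsq (d x).
have gE : (fun x => (g x)%:C) = (fun=> K%:C) \- (fun x => (nsq (d x))%:C).
  by apply/funext => x; rewrite /g rmorphB.
have Dn := diag_nsq Dd.
have Dg : D (fun x => (g x)%:C) by rewrite gE; exact: (DB (Dcst K%:C) Dn).
have [r r0] := ch_pos c Dg (fun x => ltac:(by rewrite /g subr_ge0)).
rewrite gE (chB c (Dcst K%:C) Dn) chcst (ch_nsq c Dd) -rmorphB => /complexI rE.
by rewrite -subr_ge0 rE.
Qed.

Definition eval_char_fun (x : X) : (X -> C) -> C := fun d => if `[<D d>] then d x else 0.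

Lemma eval_char_funE x d : D d -> eval_char_fun x d = d x.
Proof. by move=> Dd; rewrite /eval_char_fun asboolT. Qed.

Lemma eval_char_subproof x : is_character phi (eval_char_fun x).
Proof.
split.
- by move=> d nD; rewrite /eval_char_fun asboolF.
- exact: (eval_char_funE x (Dcst 1)).
- by move=> d e Dd De; rewrite (eval_char_funE x (DD Dd De)) (eval_char_funE x Dd) (eval_char_funE x De).
- by move=> z d Dd; rewrite (eval_char_funE x (DZ z Dd)) (eval_char_funE x Dd).
- by move=> d e Dd De; rewrite (eval_char_funE x (DM Dd De)) (eval_char_funE x Dd) (eval_char_funE x De).
- by move=> d Dd; rewrite (eval_char_funE x (DJ Dd)) (eval_char_funE x Dd).
Qed.

Definition eval_char x : spectrum R phi := exist _ _ (eval_char_subproof x).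

Lemma eval_charE x d : D d -> sval (eval_char x) d = d x.
Proof. exact: eval_char_funE. Qed.

Lemma eval_char_inj : injective eval_char.
Proof.
move=> x y e; pose d z : C := (mdist x z)%:C.
have Dd : D d by apply: Dcont; apply: continuous_real; exact: continuous_mdist.
have := eval_charE x Dd; rewrite e eval_charE// /d mdistxx => -[] h.
exact: mdist_positivity.
Qed.

Lemma continuous_sval :
  continuous (sval : spectrum R phi -> {ptws (X -> C) -> C}).
Proof. exact: initial_continuous. Qed.

Lemma continuous_gelfand d : continuous (gelfand d : spectrum R phi -> C).
Proof.
move=> c; apply: (@continuous_comp _ _ _ (sval : spectrum R phi -> {ptws (X -> C) -> C})
  (fun f => f d)); first exact: continuous_sval.
exact: (@proj_continuous _ (fun _ : X -> C => C) d).
Qed.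

Lemma gelfand_sep c c' : c <> c' -> exists2 d, D d & gelfand d c <> gelfand d c'.
Proof.
move=> cc; apply: contrapT => no; apply: cc; apply: ch_eq => d Dd.
by apply: contrapT => ne; apply: no; exists d.
Qed.

Lemma hausdorff_spectrum : hausdorff_space (spectrum R phi).
Proof.
apply: (sep_hausdorff (@hausdorff_complex R)) => c c' /gelfand_sep[d Dd ne].
by exists (gelfand d) => //; exact: continuous_gelfand.
Qed.

(** Characters are bounded by the supremum norm, so the spectrum is contained in
    a product of compact sets. A cluster point in the product is again a
    character, because each of the defining identities is a closed condition. *)
Lemma compact_spectrum : compact [set: spectrum R phi].
Proof.
have /choice[K KP] d : exists K : R, D d -> 0 <= K /\ forall x, nsq (d x) <= K ^+ 2.
  have [Dd|nD] := pselect (D d); last by exists 0.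
  by have [K K0 h] := Dbdd Dd; exists K => _; split=> //; exact: ltW.
pose box d : set C := if `[<D d>] then
  [set z : C | `|complex.Re z| <= K d /\ `|complex.Im z| <= K d] else [set 0].
have cbox : compact ([set f | forall d, box d (f d)] : set {ptws (X -> C) -> C}).
  apply: (@tychonoff _ (fun _ : X -> C => C)) => d; rewrite /box; case: asboolP => _.
    exact: compact_square.
  exact: compact_set1.
have inbox c d : box d (sval c d).
  rewrite /box; case: asboolP => [Dd|nD]; last exact: chout.
  have [K0 h] := KP d Dd; have := ch_bound c Dd h; rewrite /nsq /= => hn.
  split; rewrite -(@ler_pXn2r _ 2)// ?nnegrE// real_normK ?num_real//;
    by apply: le_trans hn; rewrite ?lerDl ?lerDr sqr_ge0.
move=> F FF _.
pose S : set_system {ptws (X -> C) -> C} :=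
  (sval : spectrum R phi -> {ptws (X -> C) -> C}) @ F.
have FS : ProperFilter S by exact: fmap_proper_filter.
have Sbox : S [set f | forall d, box d (f d)].
  by apply: (@filterE _ F) => c d /=; exact: inbox.
have [f [fbox clf]] := cbox _ FS Sbox.
have agree (a b : {ptws (X -> C) -> C} -> C) : continuous a -> continuous b ->
    (forall c, a (sval c) = b (sval c)) -> a f = b f.
  move=> ca cb ab; apply: contrapT => ne.
  have oU : open [set g | a g <> b g].
    exact: (open_neq (@hausdorff_complex R) ca cb).
  have ST : S [set g | exists c, g = sval c].
    by apply: (@filterE _ F) => c /=; exists c.
  have [g [[c ->] /=]] := clf _ _ ST (open_nbhs_nbhs (conj oU ne)).
  by apply; exact: ab.
have pr d : continuous (fun g : {ptws (X -> C) -> C} => g d).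
  exact: (@proj_continuous _ (fun _ : X -> C => C) d).
have prc (z : C) : continuous (fun _ : {ptws (X -> C) -> C} => z).
  by move=> g; exact: (@cst_continuous _ _ z g).
have cf : is_character phi f.
  split.
  - by move=> d nD; apply: (agree (fun g => g d) (fun=> 0)) => // c; exact: chout.
  - by apply: (agree (fun g => g (cst 1)) (fun=> 1)) => // c; exact: chcst.
  - move=> d e Dd De; apply: (agree (fun g => g (d \+ e)) (fun g => g d + g e)) => //.
      by move=> g; apply: (@continuousD _ _ _ (fun g : {ptws (X -> C) -> C} => g d)
        (fun g : {ptws (X -> C) -> C} => g e)); exact: pr.
    by move=> c; exact: chD.
  - move=> z d Dd; apply: (agree (fun g => g (z \*: d)) (fun g => z * g d)) => //.
      by move=> g; apply: (@continuousM _ _ (fun _ : {ptws (X -> C) -> C} => z)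
        (fun g : {ptws (X -> C) -> C} => g d)); [exact: prc|exact: pr].
    by move=> c; exact: chZ.
  - move=> d e Dd De; apply: (agree (fun g => g (d \* e)) (fun g => g d * g e)) => //.
      by move=> g; apply: (@continuousM _ _ (fun g : {ptws (X -> C) -> C} => g d)
        (fun g : {ptws (X -> C) -> C} => g e)); exact: pr.
    by move=> c; exact: chM.
  - move=> d Dd; apply: (agree (fun g => g (fun x => (d x)^*)) (fun g => (g d)^*)) => //.
      exact: continuous_conj.
    by move=> c; exact: chJ.
exists (exist _ f cf); split=> //.
move=> A U FA [B [[V oV <-] /= Vf BU]].
have SA : S [set g | exists2 c, A c & g = sval c].
  by apply: (@filterS _ F _ A) FA => c Ac /=; exists c.
have [g [[c Ac ->] Vc]] := clf _ _ SA (open_nbhs_nbhs (conj oV Vf)).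
by exists c; split=> //; exact: BU.
Qed.

End characters.

(** * The dual system and its fibres *)

Lemma fibre_cardE (R : realType) (Y : topologicalType) (theta : Y -> Y) M (y : Y) :
  fibres_at_most (theta := theta) M ->
  transfer (theta := theta) (fun=> 1 : R[i]) (theta y) =
    (fibre_card (phi := theta) y)%:R.
Proof.
move=> fibM; have [l [ul _ lP]] := at_most_exact (fibM (theta y)).
rewrite (transferE _ ul lP) big_const_seq count_predT iter_addr_0.
congr (_%:R); rewrite /fibre_card.
have -> : theta @^-1` [set theta y] = [set` l].
  by apply/seteqP; split=> z /= /lP.
have -> : [set` l] = [set` [fset z | z in l]%fset].
  by apply/seteqP; split=> z /=; rewrite !inE.
by rewrite set_fsetK card_fseq undup_id.
Qed.

Lemma ptws_cvg (T : eqType) (V : topologicalType) (F : set_system {ptws T -> V})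
    (f : {ptws T -> V}) : Filter F ->
  (forall t, (fun g : {ptws T -> V} => g t) @ F --> f t) -> F --> f.
Proof.
move=> FF cF; apply/cvg_sup => t U [?/= [[W oW <-]] /= Wf /filterS]; apply.
by apply: (cF t); exact: open_nbhs_nbhs.
Qed.

Section dual_system.
Context {R : realType} {X : metricType R} {phi : X -> X}.
Local Notation C := R[i].
Local Notation Sp := (spectrum R phi).
Implicit Types (d e g : X -> C) (c : Sp).

Hypothesis compactX : compact [set: X].
Hypothesis continuous_phi : continuous phi.
Hypothesis loc_inj_phi : loc_inj phi.

Variables (I : eqType) (L : seq I) (u : I -> X -> R).
Hypothesis u_cont : forall i, continuous (u i).
Hypothesis u_inj : forall i, i \in L -> forall x y, u i x != 0 -> u i y != 0 ->
  phi x = phi y -> x = y.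
Hypothesis u_sum : forall x, \sum_(i <- L) u i x ^+ 2 = 1.

Variable psi : Sp -> Sp.
Hypothesis psiE : forall c d, diag phi d -> sval (psi c) d = sval c (d \o phi).

Local Notation D := (diag phi).
Local Notation tr := (transfer (theta := phi)).
Let Dcst := @diag_cst _ _ _ compactX continuous_phi loc_inj_phi.
Let Dcont := @diag_cont _ _ _ compactX continuous_phi loc_inj_phi.
Let DD := @diagD _ _ phi.
Let DZ := @diagZ _ _ phi.
Let DM := @diagM _ _ _ compactX continuous_phi loc_inj_phi _ _ _ u_inj u_sum.
Let DJ := @diagJ _ _ phi.
Let Dtr := @diag_transfer _ _ _ compactX continuous_phi loc_inj_phi _ _ _ u_inj u_sum.
Let Dcomp := @diag_comp _ _ _ compactX continuous_phi loc_inj_phi _ _ _ u_cont u_inj u_sum.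
Let chMM := @chM _ _ phi.
Let chcst' := @chcst _ _ _ compactX continuous_phi loc_inj_phi.
Let eval_char' := eval_char compactX continuous_phi loc_inj_phi u_inj u_sum.
Let eval_charE' : forall x d, D d -> sval (eval_char' x) d = d x.
Proof. by move=> x d Dd; exact: eval_charE. Qed.
Let fibM : fibres_at_most (theta := phi) (size L).
Proof. exact: fibres_partition u_inj u_sum. Qed.

Lemma continuous_dual : continuous psi.
Proof.
apply: (@continuous_comp_initial _ _ _
  (sval : Sp -> {ptws (X -> C) -> C}) psi) => c.
pose h0 : Sp -> {ptws (X -> C) -> C} := fun c => sval (psi c).
have FF : Filter (h0 @ nbhs c) by exact: (@fmap_filter _ _ h0 (nbhs c) (nbhs_filter c)).
apply: (@ptws_cvg (X -> C) C _ _ FF) => d.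
suff H : continuous (fun c => sval (psi c) d) by exact: (H c).
have [Dd|nD] := pselect (D d).
  have -> : (fun c => sval (psi c) d) = gelfand (d \o phi).
    by apply/funext => c'; rewrite psiE.
  exact: continuous_gelfand.
have -> : (fun c => sval (psi c) d) = (fun=> 0).
  by apply/funext => c'; rewrite chout.
exact: cst_continuous.
Qed.

Let v i : X -> C := fun x => (u i x)%:C.
Let Dv i : D (v i).
Proof. by apply: Dcont; apply: continuous_real; exact: u_cont. Qed.

(** A fibre of phi has at most one point at which u i does not vanish. *)
Lemma transfer_bump i y : i \in L ->
  (exists z0, [/\ phi z0 = y, u i z0 != 0 & forall h, tr (v i \* h) y = v i z0 * h z0])
  \/ forall h, tr (v i \* h) y = 0.
Proof.
move=> iL; have [l [ul _ lP]] := at_most_exact (fibM y).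
have [[z0 [z0y uz0]]|no] := pselect (exists z0, phi z0 = y /\ u i z0 != 0).
  left; exists z0; split=> // h; rewrite (transferE _ ul lP).
  have zl : z0 \in l by apply/lP.
  rewrite (bigD1_seq z0)//= big_seq_cond big1 ?addr0// => z /andP[/lP zy zz].
  rewrite /v; have [->|uz] := eqVneq (u i z) 0; first by rewrite mul0r.
  by case/eqP: zz; apply: (u_inj iL) => //; rewrite z0y.
right=> h; rewrite (transferE _ ul lP) big_seq big1// => z /lP zy.
rewrite /v /=; have [->|uz] := eqVneq (u i z) 0; first by rewrite mul0r.
by exfalso; apply: no; exists z.
Qed.

(** Where u i x does not vanish, x is the only point of its fibre that
    contributes to the transfer. *)
Lemma bump_transfer i g : i \in L ->
  v i \* (tr (v i \* g) \o phi) = (v i \* v i) \* g.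
Proof.
move=> iL; apply/funext => x /=; have [u0|un] := eqVneq (u i x) 0.
  by rewrite /v u0 !mul0r.
case: (transfer_bump (phi x) iL) => [[z0 [z0x uz0 h]]|h].
  by rewrite h (u_inj iL uz0 un z0x) mulrA.
have := h (fun=> 1); have [l [ul _ lP]] := at_most_exact (fibM (phi x)).
rewrite (transferE _ ul lP); have xl : x \in l by apply/lP.
rewrite (bigD1_seq x)//= big_seq_cond big1 ?addr0 => [|z /andP[/lP zy zz]].
  by rewrite mulr1 => /complexI/eqP; rewrite (negPf un).
rewrite /v; have [->|uz] := eqVneq (u i z) 0; first by rewrite mul0r.
by case/eqP: zz; exact: (u_inj iL).
Qed.

(** Together with ch_bump1 this recovers c from psi c on the set of characters
    that do not vanish at v i, so psi is injective there. *)
Lemma ch_bump i c g : i \in L -> D g -> sval c (v i) != 0 ->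
  sval (psi c) (tr (v i \* g)) = sval c (v i) * sval c g.
Proof.
move=> iL Dg cv; have Dvg := DM (Dv i) Dg; have Dt := Dtr Dvg.
apply: (mulfI cv); rewrite (psiE c Dt) -(chMM c (Dv i) (Dcomp Dt)) bump_transfer//.
by rewrite (chMM c (DM (Dv i) (Dv i)) Dg) (chMM c (Dv i) (Dv i)) mulrA.
Qed.

Lemma ch_bump1 i c : i \in L -> sval c (v i) != 0 ->
  sval (psi c) (tr (v i)) = sval c (v i).
Proof.
move=> iL cv; have := ch_bump iL (Dcst 1) cv; rewrite chcst' mulr1 => <-.
by congr (sval _ (tr _)); apply/funext => x /=; rewrite mulr1.
Qed.

Lemma dual_sep i c c' : i \in L -> sval c (v i) != 0 -> sval c' (v i) != 0 ->
  psi c = psi c' -> c = c'.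
Proof.
move=> iL cv cv' e; apply: ch_eq => g Dg.
have := ch_bump iL Dg cv; rewrite e (ch_bump iL Dg cv').
have -> : sval c (v i) = sval c' (v i).
  by rewrite -(ch_bump1 iL cv) e (ch_bump1 iL cv').
by move/(mulfI cv').
Qed.

Lemma diag_sum (l : seq I) (F : I -> X -> C) : (forall i, D (F i)) ->
  D (fun x => \sum_(i <- l) F i x) /\
  forall c, sval c (fun x => \sum_(i <- l) F i x) = \sum_(i <- l) sval c (F i).
Proof.
move=> DF; elim: l => [|i l [IH1 IH2]].
  have -> : (fun x : X => \sum_(i <- [::]) F i x) = fun=> 0.
    by apply/funext => x; rewrite big_nil.
  by split=> [|c]; [exact: (Dcst 0)|rewrite big_nil; exact: chcst'].
have -> : (fun x : X => \sum_(j <- i :: l) F j x) =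
    F i \+ (fun x => \sum_(j <- l) F j x).
  by apply/funext => x; rewrite big_cons.
split=> [|c]; first exact: (DD (DF i) IH1).
by rewrite (chD c (DF i) IH1) IH2 big_cons.
Qed.

Lemma ch_partition c : \sum_(i <- L) sval c (v i) ^+ 2 = 1.
Proof.
have [_ h] := diag_sum L (fun i => DM (Dv i) (Dv i)).
transitivity (sval c (fun=> 1)); last exact: chcst'.
have -> : (fun=> 1) = (fun x : X => \sum_(i <- L) (v i \* v i) x).
  apply/funext => x; rewrite -[1]/((1 : R)%:C) -(u_sum x) rmorph_sum.
  by apply: eq_bigr => i _; rewrite rmorphXn /= expr2.
rewrite h; apply: eq_bigr => i _.
by rewrite (chMM c (Dv i) (Dv i)) expr2.
Qed.

Lemma ch_partition_neq0 c : exists2 i, i \in L & sval c (v i) != 0.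
Proof.
apply: contrapT => no; have := ch_partition c.
rewrite big_seq big1 => [/esym/eqP|i iL]; first by rewrite oner_eq0.
apply/eqP; rewrite sqrf_eq0; apply: contrapT => /negP ui.
by apply: no; exists i.
Qed.

Lemma fibres_dual : fibres_at_most (theta := psi) (size L).
Proof.
apply: (fibres_cover (a := fun i c => sval c (v i)) ch_partition_neq0).
by move=> i iL c c' ci ci' e; exact: (dual_sep iL ci ci' e).
Qed.

Lemma loc_inj_dual : loc_inj psi.
Proof.
move=> c; have [i iL ci] := ch_partition_neq0 c.
exists [set c' | gelfand (v i) c' <> 0]; split.
- apply: (@open_neq C Sp (gelfand (v i)) (fun=> 0) (@hausdorff_complex R)).
    exact: continuous_gelfand.
  exact: cst_continuous.
- exact/eqP.
- move=> c1 c2 /set_mem/eqP h1 /set_mem/eqP h2; exact: (dual_sep iL h1 h2).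
Qed.

Section fibre_character.
Variables (i : I) (c : Sp).
Hypothesis iL : i \in L.
(** By ch_bump, if c has a preimage that does not vanish at v i, then lam is t
    times that preimage. *)
Let lam g : C := sval c (tr (v i \* g)).
Let t := lam (fun=> 1).

Let Dlam g : D g -> D (tr (v i \* g)).
Proof. by move=> Dg; exact: (Dtr (DM (Dv i) Dg)). Qed.

Let lamM g h : D g -> D h -> lam g * lam h = lam (v i \* (g \* h)).
Proof.
move=> Dg Dh; rewrite /lam -(chMM c (Dlam Dg) (Dlam Dh)); congr (sval c _).
apply/funext => y /=; case: (transfer_bump y iL) => [[z0 [_ _ E]]|E].
  by rewrite !E /= mulrACA -mulrA.
by rewrite !E mulr0.
Qed.

Let lam_bump g : D g -> lam (v i \* g) = lam g * t.
Proof.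
move=> Dg; rewrite (lamM Dg (Dcst 1)); congr lam; apply/funext => x /=.
by rewrite mulr1.
Qed.

Let lamMt g h : D g -> D h -> lam g * lam h = lam (g \* h) * t.
Proof. by move=> Dg Dh; rewrite (lamM Dg Dh) (lam_bump (DM Dg Dh)). Qed.

Let lamD g h : D g -> D h -> lam (g \+ h) = lam g + lam h.
Proof.
move=> Dg Dh; rewrite /lam -(chD c (Dlam Dg) (Dlam Dh)); congr (sval c _).
apply/funext => y /=; case: (transfer_bump y iL) => [[z0 [_ _ E]]|E].
  by rewrite !E /= mulrDr.
by rewrite !E addr0.
Qed.

Let lamZ (z : C) g : D g -> lam (z \*: g) = z * lam g.
Proof.
move=> Dg; rewrite /lam -(chZ c z (Dlam Dg)); congr (sval c _).
apply/funext => y /=; case: (transfer_bump y iL) => [[z0 [_ _ E]]|E].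
  by rewrite !E /= [X in _ * X]/GRing.scale [RHS]/GRing.scale /= mulrCA.
by rewrite !E scaler0.
Qed.

Let lamJ g : D g -> lam (fun x => (g x)^*) = (lam g)^*.
Proof.
move=> Dg; rewrite /lam -(chJ c (Dlam Dg)); congr (sval c _).
apply/funext => y /=; case: (transfer_bump y iL) => [[z0 [_ _ E]]|E].
  by rewrite !E rmorphM /=; congr (_ * _); exact/esym/conjc_real.
by rewrite !E; exact/esym/conjc0.
Qed.

Let tJ : t^* = t.
Proof.
rewrite /t -(lamJ (Dcst 1)); congr lam; apply/funext => x; exact: conjc1.
Qed.

(** Conversely lam / t is a character, since lam is multiplicative up to the
    factor t: only one point of each fibre of phi contributes to the transfer. *)
Lemma fibre_character : t != 0 -> exists c', psi c' = c /\ sval c' (v i) != 0.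
Proof.
move=> t0; pose f d : C := if `[<D d>] then lam d / t else 0.
have fE d : D d -> f d = lam d / t by move=> Dd; rewrite /f asboolT.
have cf : is_character phi f.
  split.
  - by move=> d nD; rewrite /f asboolF.
  - by rewrite (fE _ (Dcst 1)) divff.
  - by move=> d e Dd De; rewrite (fE _ (DD Dd De)) (fE _ Dd) (fE _ De) lamD// mulrDl.
  - by move=> z d Dd; rewrite (fE _ (DZ z Dd)) (fE _ Dd) lamZ// mulrA.
  - move=> d e Dd De; rewrite (fE _ (DM Dd De)) (fE _ Dd) (fE _ De).
    apply: (mulIf (mulf_neq0 t0 t0)).
    transitivity (lam (d \* e) * t); first by field.
    by rewrite -lamMt//; field.
  - move=> d Dd; rewrite (fE _ (DJ Dd)) (fE _ Dd) lamJ// rmorphM fmorphV /=.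
    by rewrite tJ.
exists (exist _ f cf); split.
  apply: ch_eq => g Dg; rewrite (psiE _ Dg) /= (fE _ (Dcomp Dg)).
  have -> : lam (g \o phi) = sval c g * t.
    rewrite /t /lam -(chMM c Dg (Dlam (Dcst 1))); congr (sval c _).
    apply/funext => y /=; case: (transfer_bump y iL) => [[z0 [z0y _ E]]|E].
      by rewrite !E /= z0y mulr1 mulrC.
    by rewrite !E mulr0.
  by rewrite mulfK.
rewrite /= (fE _ (Dv i)).
have -> : lam (v i) = t * t.
  rewrite -[RHS](lam_bump (Dcst 1)); congr lam; apply/funext => x /=.
  by rewrite mulr1.
by rewrite mulfK.
Qed.

(** At most one preimage of c does not vanish at v i, by dual_sep; if there is
    none, then t = 0 by fibre_character and both sides are 0. *)
Lemma fibre_sum_bump (l : seq Sp) g : D g -> uniq l ->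
  (forall c', c' \in l <-> psi c' = c) ->
  lam (v i \* g) = \sum_(c' <- l) sval c' (v i) ^+ 2 * sval c' g.
Proof.
move=> Dg ul lP; have [[c' [cl cv]]|no] := pselect (exists c', c' \in l /\ sval c' (v i) != 0).
  have cc : psi c' = c by apply/lP.
  have Dvg := DM (Dv i) Dg.
  rewrite (bigD1_seq c')//= big_seq_cond big1 ?addr0.
    by rewrite /lam -cc (ch_bump iL Dvg cv) (chMM c' (Dv i) Dg) mulrA expr2.
  move=> c2 /andP[/lP c2l ne].
  have [->|cv2] := eqVneq (sval c2 (v i)) 0; first by rewrite expr0n mul0r.
  by case/eqP: ne; apply: (dual_sep iL) => //; rewrite cc.
rewrite big_seq big1 => [|c' c'l]; last first.
  have [->|cv2] := eqVneq (sval c' (v i)) 0; first by rewrite expr0n mul0r.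
  by exfalso; apply: no; exists c'.
rewrite lam_bump//; have [->|t0] := eqVneq t 0; first by rewrite mulr0.
have [c' [/lP c'l cv]] := fibre_character t0.
by exfalso; apply: no; exists c'.
Qed.

End fibre_character.

(** The identities fibre_sum_bump add up over the partition, as the squares of
    the v i sum to 1 in D and therefore at every character. *)
Lemma transfer_gelfand g : D g ->
  transfer (theta := psi) (gelfand g) = gelfand (tr g).
Proof.
move=> Dg; apply/funext => c.
have [l [ul _ lP]] := at_most_exact (fibres_dual c).
rewrite (transferE _ ul lP) /gelfand.
have [_ h] := diag_sum L (fun i => Dtr (DM (Dv i) (DM (Dv i) Dg))).
have -> : tr g = (fun x => \sum_(i <- L) tr (v i \* (v i \* g)) x).
  apply/funext => y; have [m [um _ mP]] := at_most_exact (fibM y).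
  under eq_bigr do rewrite (transferE _ um mP).
  rewrite (transferE _ um mP) exchange_big /=; apply: eq_bigr => z _.
  rewrite -[LHS]mul1r -[1]/((1 : R)%:C) -(u_sum z) rmorph_sum mulr_suml.
  by apply: eq_bigr => i _; rewrite rmorphXn /= expr2 mulrA.
rewrite h.
transitivity (\sum_(i <- L) \sum_(c' <- l) sval c' (v i) ^+ 2 * sval c' g).
  rewrite exchange_big /=; apply: eq_bigr => c' _.
  by rewrite -mulr_suml ch_partition mul1r.
rewrite big_seq [RHS]big_seq; apply: eq_bigr => i iL.
by rewrite -(fibre_sum_bump iL Dg ul lP).
Qed.

Lemma dual_eval x : psi (eval_char' x) = eval_char' (phi x).
Proof.
by apply: ch_eq => d Dd; rewrite (psiE _ Dd) (eval_charE' x (Dcomp Dd)) (eval_charE' _ Dd).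
Qed.

Let eval_char_inj' : injective eval_char'.
Proof. exact: eval_char_inj. Qed.

(** The evaluations at the points over x are distinct preimages of the evaluation
    at x, and transfer_gelfand at the function 1 leaves no room for others. *)
Lemma dual_fibre_eval c x : psi c = eval_char' x ->
  exists2 z, phi z = x & c = eval_char' z.
Proof.
move=> cx; have [l [ul _ lP]] := at_most_exact (fibres_dual (eval_char' x)).
have [m [um _ mP]] := at_most_exact (fibM x).
have sz : size l = size m.
  have := congr1 (fun f => f (eval_char' x)) (transfer_gelfand (Dcst 1)).
  rewrite (transferE _ ul lP) /gelfand (eval_charE' x (Dtr (Dcst 1))) (transferE _ um mP).
  under eq_bigr do rewrite chcst'.
  rewrite !big_const_seq !count_predT !iter_addr_0 => /eqP.
  by rewrite eqr_nat => /eqP.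
have sub : {subset map eval_char' m <= l}.
  by move=> _ /mapP[z /mP zx ->]; apply/lP; rewrite /= dual_eval -zx.
have um' : uniq (map eval_char' m) by rewrite map_inj_uniq.
have [_ e] := uniq_min_size um' sub ltac:(by rewrite size_map sz).
have : c \in l by apply/lP.
by rewrite -e => /mapP[z /mP zx ->]; exists z.
Qed.

Lemma iter_dual_eval n x : iter n psi (eval_char' x) = eval_char' (iter n phi x).
Proof. by elim: n => [|n IH] //=; rewrite IH dual_eval. Qed.

Lemma iter_dual_fibre_eval n c x : iter n psi c = eval_char' x ->
  exists2 z, iter n phi z = x & c = eval_char' z.
Proof.
elim: n c => [|n IH] c; first by exists x.
rewrite iterSr => /IH[z zx /dual_fibre_eval[w wz ->]]; exists w => //.
by rewrite iterSr wz.
Qed.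

Lemma fibre_card_dual c :
  (fibre_card (phi := psi) c)%:R = sval c (fun x => (fibre_card (phi := phi) x)%:R).
Proof.
rewrite -(fibre_cardE R c fibres_dual).
have -> : (fun x => (fibre_card (phi := phi) x)%:R) = tr (fun=> 1 : C) \o phi.
  by apply/funext => x; rewrite /= (fibre_cardE R x fibM).
rewrite -(psiE _ (Dtr (Dcst 1))).
have /(congr1 (fun f => f (psi c))) := transfer_gelfand (Dcst 1).
rewrite {2}/gelfand => <-; congr (transfer _ _); apply/funext => c'.
by rewrite /gelfand chcst'.
Qed.

End dual_system.

(** * Comparison of the two groupoids *)

Section fibre_norms.
Context {R : realType} {Y : topologicalType} {theta : Y -> Y}.
Local Notation C := R[i].
Local Notation G := (groupoid theta).
Implicit Types (f h p : G -> C).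

(** This expresses the norm of a vector by a value at a unit, to which characters
    can be applied. *)
Lemma conv_invol_unit p y (l : seq G) : uniq l ->
  (forall k, k \in l -> src k = y) -> (forall k, src k = y -> p k != 0 -> k \in l) ->
  conv (invol p) p (gunit y) = (\sum_(k <- l) nsq (p k))%:C.
Proof.
move=> ul ly lP.
have E k : src k = y -> gmul (gunit y) (ginv k) = ginv k.
  move=> ky; have e : src (gunit (phi := theta) y) = rng (ginv k) by rewrite rng_ginv.
  by apply: gpd_eq; rewrite ?(rng_gmul, deg_gmul, src_gmul)// ?add0r// rng_ginv.
rewrite (@conv_col _ _ _ _ _ _ l)//.
  rewrite rmorph_sum /=; apply: eq_big_seq => k /ly ky.
  by rewrite E// /invol ginvK nsqJ_mul.
move=> k ky kl; have /eqP -> : p k == 0 by apply: contraNT kl; exact: lP.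
by rewrite mulr0.
Qed.

Lemma eq_conv_fibre f xi eta y g : src g = y ->
  (forall k, src k = y -> xi k = eta k) -> conv f xi g = conv f eta g.
Proof.
move=> gy e; rewrite /conv; apply: eq_fsbigr => -[k l] /set_mem [/= _ _ _ sg].
by rewrite e// -sg.
Qed.

Lemma sum_sub_list (l m : seq G) (F : G -> R) : uniq l -> uniq m ->
  (forall g, 0 <= F g) -> {subset l <= m} -> \sum_(g <- l) F g <= \sum_(g <- m) F g.
Proof.
move=> ul um F0 lm; rewrite [leRHS](bigID (mem l))/=.
have -> : \sum_(g <- m | g \in l) F g = \sum_(g <- l) F g.
  rewrite -big_filter; apply: perm_big; apply: uniq_perm => //.
    by rewrite filter_uniq.
  by move=> g; rewrite mem_filter; apply/andb_idr; exact: lm.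
by rewrite lerDl sumr_ge0.
Qed.

(** The values of conv f xi on l involve finitely many coordinates of xi, which
    reduces norm estimates to finitely supported vectors. *)
Lemma conv_truncate f xi y (l : seq G) : unif_finite f -> uniq l ->
  (forall g, g \in l -> src g = y) ->
  exists M : seq G, [/\ uniq M, forall q, q \in M -> src q = y
    & forall eta, (forall q, q \in M -> eta q = xi q) ->
      forall g, g \in l -> conv f eta g = conv f xi g].
Proof.
move=> Ff ul ly.
have [M [uM My MP]] : exists M : seq G, [/\ uniq M,
    forall q, q \in M -> src q = y
  & forall g q, g \in l -> src q = y -> f (gmul g (ginv q)) != 0 -> q \in M].
  have [n [s [rf _ _]]] := Ff.
  have [|M [uM MP]] := @finite_union n G G l
      (fun g => [set q | src q = y /\ f (gmul g (ginv q)) != 0]).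
    move=> g /ly gy; apply: (at_most_image (f := fun k => gmul (ginv k) g) (rf (rng g))).
    move=> q [qy fq]; have e : src g = rng (ginv q) by rewrite rng_ginv qy gy.
    exists (gmul g (ginv q)); first by rewrite /= rng_gmul.
    by rewrite ginvM// ginvK gmulVr// qy gy.
  by exists M; split=> // [p /MP[g _ []]|g p gl px fp]//; apply/MP; exists g.
exists M; split=> // eta e g gl; have gy := ly _ gl.
have out (z : G -> C) k : src k = src g -> k \notin M -> f (gmul g (ginv k)) * z k = 0.
  move=> kg kM; apply/eqP; rewrite mulf_eq0; apply/orP; left.
  by apply: contraNT kM => fk; apply: MP fk => //; rewrite kg.
rewrite (@conv_col _ _ _ _ _ _ M)//; [|by move=> k /My ->|exact: out].
rewrite (@conv_col _ _ _ _ _ _ M)//; [|by move=> k /My ->|exact: out].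
by apply: eq_big_seq => k /e ->.
Qed.

End fibre_norms.

Section comparison.
Context {R : realType} {X : metricType R} {phi : X -> X}.
Local Notation C := R[i].
Local Notation Sp := (spectrum R phi).

Hypothesis compactX : compact [set: X].
Hypothesis continuous_phi : continuous phi.
Hypothesis loc_inj_phi : loc_inj phi.

Variables (I : eqType) (L : seq I) (u : I -> X -> R).
Hypothesis u_cont : forall i, continuous (u i).
Hypothesis u_inj : forall i, i \in L -> forall x y, u i x != 0 -> u i y != 0 ->
  phi x = phi y -> x = y.
Hypothesis u_sum : forall x, \sum_(i <- L) u i x ^+ 2 = 1.

Variable psi : Sp -> Sp.
Hypothesis psiE : forall (c : Sp) d, diag phi d -> sval (psi c) d = sval c (d \o phi).

Implicit Types (d e : X -> C) (c : Sp) (f h p : groupoid psi -> C).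
Local Notation D := (diag phi).
Let Dcst := @diag_cst _ _ _ compactX continuous_phi loc_inj_phi.
Let Dcont := @diag_cont _ _ _ compactX continuous_phi loc_inj_phi.
Let DD := @diagD _ _ phi.
Let DZ := @diagZ _ _ phi.
Let DM := @diagM _ _ _ compactX continuous_phi loc_inj_phi _ _ _ u_inj u_sum.
Let DJ := @diagJ _ _ phi.
Let Dtr := @diag_transfer _ _ _ compactX continuous_phi loc_inj_phi _ _ _ u_inj u_sum.
Let Dcomp := @diag_comp _ _ _ compactX continuous_phi loc_inj_phi _ _ _ u_cont u_inj u_sum.
Let Dbdd := @diag_bdd _ _ _ compactX continuous_phi loc_inj_phi _ _ _ u_inj u_sum.
Let DBB : forall d e, D d -> D e -> D (d \- e) := @DB _ _ phi.
Let chcst' := @chcst _ _ _ compactX continuous_phi loc_inj_phi.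
Let eval_char' := eval_char compactX continuous_phi loc_inj_phi u_inj u_sum.
Let eval_charE' : forall x d, D d -> sval (eval_char' x) d = d x.
Proof. by move=> x d Dd; exact: eval_charE. Qed.
Let eval_char_inj' : injective eval_char'.
Proof. exact: eval_char_inj. Qed.
Let iter_ev : forall n x, iter n psi (eval_char' x) = eval_char' (iter n phi x).
Proof. exact: (iter_dual_eval compactX continuous_phi loc_inj_phi u_cont u_inj u_sum psiE). Qed.
Let fibM : fibres_at_most (theta := phi) (size L).
Proof. exact: fibres_partition u_inj u_sum. Qed.
Let fibP : fibres_at_most (theta := psi) (size L).
Proof. exact: (fibres_dual compactX continuous_phi loc_inj_phi u_cont u_inj u_sum psiE). Qed.
Let cpsi : continuous psi.
Proof. exact: continuous_dual psiE. Qed.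
Let lipsi : loc_inj psi.
Proof. exact: (loc_inj_dual compactX continuous_phi loc_inj_phi u_cont u_inj u_sum psiE). Qed.
Let compactSp : compact [set: Sp].
Proof. exact: (compact_spectrum compactX continuous_phi loc_inj_phi u_inj u_sum). Qed.
Let hausSp : hausdorff_space Sp := @hausdorff_spectrum _ _ _.

Definition gelfand_image : set (Sp -> C) := [set a | exists2 d, D d & a = gelfand d].
Local Notation GD := gelfand_image.

Let GD_gelfand d : D d -> GD (gelfand d). Proof. by exists d. Qed.

Lemma gelfandM d e : D d -> D e -> gelfand d \* gelfand e = gelfand (d \* e) :> (Sp -> C).
Proof. by move=> Dd De; apply/funext => c; rewrite /gelfand (chM c Dd De). Qed.
Lemma gelfandZ (z : C) d : D d -> z \*: gelfand d = gelfand (z \*: d) :> (Sp -> C).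
Proof. by move=> Dd; apply/funext => c; rewrite /gelfand (chZ c z Dd). Qed.
Lemma gelfandJ d : D d ->
  (fun c => (gelfand d c)^*) = gelfand (fun x => (d x)^*) :> (Sp -> C).
Proof. by move=> Dd; apply/funext => c; rewrite /gelfand (chJ c Dd). Qed.
Lemma gelfand1 : (fun=> 1) = gelfand (fun=> 1 : C) :> (Sp -> C).
Proof. by apply/funext => c; rewrite /gelfand chcst'. Qed.

Let GD_cont a : GD a -> continuous a.
Proof. by move=> [d Dd ->]; exact: continuous_gelfand. Qed.
Let GD1 : GD (fun=> 1).
Proof. by rewrite gelfand1; exact: (GD_gelfand (Dcst 1)). Qed.
Let GD_mul a b : GD a -> GD b -> GD (a \* b).
Proof.
by move=> [d Dd ->] [e De ->]; rewrite gelfandM//; exact: (GD_gelfand (DM Dd De)).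
Qed.
Let GD_scale (z : C) a : GD a -> GD (z \*: a).
Proof. by move=> [d Dd ->]; rewrite gelfandZ//; exact: (GD_gelfand (DZ z Dd)). Qed.
Let GD_conj a : GD a -> GD (fun c => (a c)^*).
Proof. by move=> [d Dd ->]; rewrite gelfandJ//; exact: (GD_gelfand (DJ Dd)). Qed.
Let GD_sep c c' : c <> c' -> exists2 a, GD a & a c <> a c'.
Proof.
move=> /gelfand_sep[d Dd ne]; exists (gelfand d) => //; exact: (GD_gelfand Dd).
Qed.
Let GD_bdd a : GD a -> bdd_fun a.
Proof.
move=> [d Dd ->]; have [K K0 hK] := Dbdd Dd; exists (K ^+ 2) => c.
exact: (ch_bound compactX continuous_phi loc_inj_phi u_inj u_sum c Dd hK).
Qed.
Let GD_comp a : GD a -> GD (a \o psi).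
Proof.
move=> [d Dd ->]; have -> : gelfand d \o psi = gelfand (d \o phi).
  by apply/funext => c; rewrite /gelfand /= psiE.
exact: (GD_gelfand (Dcomp Dd)).
Qed.
Let GD_transfer a : GD a -> GD (transfer (theta := psi) a).
Proof.
move=> [d Dd ->].
rewrite (transfer_gelfand compactX continuous_phi loc_inj_phi u_cont u_inj u_sum psiE Dd).
exact: (GD_gelfand (Dtr Dd)).
Qed.

(** Gelfand transforms are taken as coefficients, rather than all continuous
    functions on the spectrum, so that the restriction of an element to the units
    is given by an element of D. *)
Definition core : set (groupoid psi -> C) := span_elem GD.
Local Notation P := core.

Lemma core_unif_finite h : P h -> unif_finite h.
Proof. exact: (unif_finite_span fibP GD_bdd). Qed.
Lemma core_add f h : P f -> P h -> P (f \+ h).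
Proof. exact: span_elemD. Qed.
Lemma core_scale (z : C) h : P h -> P (z \*: h).
Proof. exact: (span_elem_scale GD_scale). Qed.
Lemma core_invol h : P h -> P (invol h).
Proof. exact: (span_elem_invol GD_conj). Qed.
Lemma core_conv f h : P f -> P h -> P (conv f h).
Proof. exact: (span_elem_conv fibP GD_bdd GD1 GD_mul GD_comp GD_transfer). Qed.
Lemma core_alg_star h : P h -> alg_star h.
Proof.
elim=> [a m n b Da Db|f k _ af _ ak]; last exact: alg_starD.
exact: (alg_star_elem compactSp hausSp cpsi lipsi m n (GD_cont Da) (GD_cont Db)).
Qed.

Lemma alg_star_approx_core f : alg_star f -> approx P f.
Proof.
apply: (alg_star_approx core_unif_finite core_add core_scale core_conv core_invol).
exact: (cc_approximable fibP compactSp hausSp cpsi lipsi GD_cont GD1 GD_mul GD_scale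
  GD_conj GD_sep).
Qed.

(** Only elementary functions with equal exponents are nonzero at units. *)
Lemma core_unit h : P h -> exists2 d, D d & forall c, h (gunit c) = sval c d.
Proof.
elim=> [a m n b [d Dd ->] [e De ->]|f k _ [d Dd hd] _ [e De he]]; last first.
  exists (d \+ e); first exact: (DD Dd De).
  by move=> c; rewrite /= hd he (chD c Dd De).
have [mn|mn] := eqVneq m n.
  exists (d \* e); first exact: (DM Dd De).
  move=> c; rewrite elemE; last by rewrite mn; split=> //=; rewrite /deg /= subrr.
  by rewrite (chM c Dd De).
exists (fun=> 0) => [|c]; first exact: (Dcst 0).
rewrite chcst' elemN// => -[]; rewrite /deg /= => e0 _.
by case/eqP: mn; move: e0; lia.
Qed.

Lemma gpd_embed_subproof (g : groupoid phi) :
  gpd_rel psi (eval_char' (rng g), deg g, eval_char' (src g)).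
Proof.
have [a [b [/= e1 e2]]] := groupoid_rel g; exists a, b; split=> //=.
by rewrite !iter_ev e2.
Qed.

Definition gpd_embed (g : groupoid phi) :
  groupoid psi := exist _ _ (gpd_embed_subproof g).
Definition pull f : groupoid phi -> C := f \o gpd_embed.

Lemma rng_gpd_embed g : rng (gpd_embed g) = eval_char' (rng g). Proof. by []. Qed.
Lemma src_gpd_embed g : src (gpd_embed g) = eval_char' (src g). Proof. by []. Qed.
Lemma deg_gpd_embed g : deg (gpd_embed g) = deg g. Proof. by []. Qed.

Lemma gpd_embed_inj : injective gpd_embed.
Proof.
move=> g g' e; apply: gpd_eq.
- by apply: eval_char_inj'; exact: (congr1 (@rng _ _) e).
- exact: (congr1 (@deg _ _) e).
- by apply: eval_char_inj'; exact: (congr1 (@src _ _) e).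
Qed.

Lemma gpd_embed_partial_inverse : exists j : groupoid psi -> option (groupoid phi),
  (forall k g, j k = Some g <-> k = gpd_embed g) /\ ocancel j gpd_embed.
Proof.
have /choice[j jP] (k : groupoid psi) : exists o : option (groupoid phi),
    forall g, o = Some g <-> k = gpd_embed g.
  have [[g kg]|no] := pselect (exists g, k = gpd_embed g); last first.
    by exists None => g; split=> // kg; exfalso; apply: no; exists g.
  by exists (Some g) => g'; split=> [[<-]//|]; rewrite kg => /gpd_embed_inj ->.
by exists j; split=> // k; case e : (j k) => [g|] //=; apply/esym/jP.
Qed.

Lemma gpd_embed_lag a b g : lag a b (gpd_embed g) <-> lag a b g.
Proof.
rewrite /lag /= rng_gpd_embed src_gpd_embed deg_gpd_embed !iter_ev.
split=> -[dg e]; split=> //; first exact: eval_char_inj'.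
by rewrite e.
Qed.

(** The range c of k satisfies psi^a c = psi^b (eval x) for some a and b, so it is
    an evaluation by iter_dual_fibre_eval. *)
Lemma gpd_embed_surj k x : src k = eval_char' x -> exists2 g, k = gpd_embed g & src g = x.
Proof.
move=> kx; have [a [b [/= e1 e2]]] := groupoid_rel k.
rewrite kx iter_ev in e2.
have [z zx rk] := iter_dual_fibre_eval u_cont psiE e2.
have gz : gpd_rel phi (z, deg k, x) by exists a, b.
exists (exist _ _ gz) => //.
by apply: gpd_eq => //; rewrite rk.
Qed.

Lemma gpd_embed_gmul g g' : src g = rng g' ->
  gpd_embed (gmul g g') = gmul (gpd_embed g) (gpd_embed g').
Proof.
move=> e; have e' : src (gpd_embed g) = rng (gpd_embed g') by rewrite src_gpd_embed rng_gpd_embed e.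
apply: gpd_eq; rewrite ?(rng_gmul, deg_gmul, src_gmul)//.
- by rewrite !rng_gpd_embed rng_gmul.
- by rewrite !deg_gpd_embed deg_gmul.
- by rewrite !src_gpd_embed src_gmul.
Qed.

(** The factors of an arrow of the image lie in the image by gpd_embed_surj, so
    that both convolutions are sums over the same pairs. *)
Lemma conv_pull f xi : conv (pull f) (pull xi) = pull (conv f xi).
Proof.
apply/funext => g; rewrite /pull /= /Defs.conv.
rewrite (@reindex_fsbig _ _ _ _ _ (fun kl => (gpd_embed kl.1, gpd_embed kl.2))
  [set kl | gmul_to kl.1 kl.2 g])//.
split.
- move=> [k l] /= /gmul_toE[e ->]; apply/gmul_toE; rewrite gpd_embed_gmul//; split=> //.
  by rewrite src_gpd_embed rng_gpd_embed e.
- move=> [k l] [k' l'] _ _ e; congr pair; apply: gpd_embed_inj.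
  + exact: (congr1 fst e).
  + exact: (congr1 snd e).
- move=> [k l] /= /gmul_toE[e ge].
  have [l' ll sl] : exists2 l', l = gpd_embed l' & src l' = src g.
    by apply: gpd_embed_surj; rewrite -(src_gmul e) -ge.
  have [k' kk sk] : exists2 k', k = gpd_embed k' & src k' = rng l'.
    by apply: gpd_embed_surj; rewrite e ll.
  exists (k', l'); last by rewrite /= kk ll.
  apply/gmul_toE; split=> //; apply: gpd_embed_inj.
  by rewrite gpd_embed_gmul// ge kk ll.
Qed.

Lemma invol_pull h : invol (pull h) = pull (invol h).
Proof.
apply/funext => g; rewrite /pull /invol /=; congr ((h _)^*).
by apply: gpd_eq.
Qed.

Lemma pull_elem d a b e : D d -> D e ->
  pull (elem (gelfand d) a b (gelfand e)) = elem d a b e.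
Proof.
move=> Dd De; apply/funext => g; rewrite /pull /=.
have [Lg|nL] := pselect (lag a b g).
  by rewrite !elemE//; [rewrite /gelfand (eval_charE' _ Dd) (eval_charE' _ De)|exact/gpd_embed_lag].
by rewrite !elemN// => /gpd_embed_lag.
Qed.

Lemma pull_core h : P h -> span_elem D (pull h).
Proof.
elim=> [a m n b [d Dd ->] [e De ->]|f k _ sf _ sk].
  by rewrite (pull_elem m n Dd De); exact: span_elem1.
exact: (span_elemD sf sk).
Qed.

Lemma core_pull (k : groupoid phi -> C) : span_elem D k -> exists2 h, P h & k = pull h.
Proof.
elim=> [d a b e Dd De|f h _ [f' Pf ->] _ [h' Ph ->]].
  exists (elem (gelfand d) a b (gelfand e)); last by rewrite pull_elem.
  exact: (span_elem1 a b (GD_gelfand Dd) (GD_gelfand De)).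
by exists (f' \+ h') => //; exact: core_add.
Qed.

Lemma diag_bdd_fun d : D d -> bdd_fun d.
Proof. by move=> /Dbdd[K _ h]; exists (K ^+ 2). Qed.

Lemma unif_finite_pull h : P h -> unif_finite (pull h).
Proof. by move=> /pull_core; exact: (unif_finite_span fibM diag_bdd_fun). Qed.

(** In d S^a T^b e the middle factor is continuous with compact support, and d and
    e are limits of functions in alg_star. *)
Lemma approx_pull_core h : P h -> approx alg_star (pull h).
Proof.
move=> /pull_core; have aUF (f : groupoid phi -> C) : alg_star f -> unif_finite f.
  exact: (alg_star_unif_finite compactX continuous_phi loc_inj_phi u_inj u_sum).
have aD : forall f k : groupoid phi -> C, alg_star f -> alg_star k -> alg_star (f \+ k).
  exact: alg_starD.
have aM : forall f k : groupoid phi -> C, alg_star f -> alg_star k -> alg_star (conv f k).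
  exact: alg_star_conv.
have aU d : D d -> approx alg_star (on_units d : groupoid phi -> C).
  move=> Dd; split.
    rewrite on_unitsE; apply: (unif_finite_elem fibM 0 0); first exact: bounded_cst.
    exact: diag_bdd_fun.
  move=> e e0; have [d0 k0 h0] := (diagP d).1 Dd e e0.
  by exists (on_units d0) => //; rewrite on_unitsB; exact: op_le_units.
elim=> [d a b e Dd De|f k _ sf _ sk]; last exact: (approxD aUF aD sf sk).
have -> : elem d a b e =
    conv (conv (on_units d) (elem (fun=> 1) a b (fun=> 1))) (on_units e) :> (groupoid phi -> C).
  rewrite conv_units_elem conv_elem_units; congr elem; apply/funext => x /=.
    by rewrite mulr1.
  by rewrite mul1r.
have aE : alg_star (elem (fun=> 1) a b (fun=> 1) : groupoid phi -> C).
  have c1 : continuous (fun _ : X => 1 : C) by exact: cst_continuous.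
  exact: (@alg_star_elem R X phi compactX (@metric_hausdorff R X) continuous_phi
    loc_inj_phi (fun=> 1) a b (fun=> 1) c1 c1).
apply: (approxM aUF aM); last exact: aU.
by apply: (approxM aUF aM); [exact: aU|apply: approx_self => //; exact: aUF].
Qed.

(** Continuous functions on X belong to D, so the approximants of
    cc_approx_continuous come from core. *)
Lemma approx_alg_star_pull (f : groupoid phi -> C) : alg_star f -> approx (pull @` P) f.
Proof.
apply: alg_star_approx.
- by move=> _ [h Ph <-]; exact: unif_finite_pull.
- by move=> _ _ [h Ph <-] [k Pk <-]; exists (h \+ k) => //; exact: core_add.
- by move=> z _ [h Ph <-]; exists (z \*: h) => //; exact: core_scale.
- move=> _ _ [h Ph <-] [k Pk <-]; exists (conv h k); first exact: core_conv.
  by rewrite conv_pull.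
- by move=> _ [h Ph <-]; exists (invol h); [exact: core_invol|rewrite invol_pull].
move=> {}f cf kf.
have := cc_approx_continuous compactX continuous_phi loc_inj_phi u_inj u_sum cf kf.
apply: approx_sub => k sk; have [|h Ph ->] := @core_pull k; last by exists h.
elim: sk => [d a b e cd ce|f1 f2 _ s1 _ s2]; last exact: span_elemD.
exact: (span_elem1 a b (Dcont cd) (Dcont ce)).
Qed.

Lemma separate c0 (s : seq Sp) : exists d, [/\ D d, sval c0 d = 1
  & forall c, c \in s -> c <> c0 -> sval c d = 0].
Proof.
elim: s => [|c s [d [Dd d0 ds]]]; first by exists (fun=> 1); split=> //; exact: Dcst.
have [->|ne] := pselect (c = c0).
  by exists d; split=> // c'; rewrite inE => /predU1P[->//|]; exact: ds.
have [e De se] := gelfand_sep ne; rewrite /gelfand in se.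
have n0 : sval c0 e - sval c e != 0 by rewrite subr_eq0; apply/eqP => /esym.
pose w := (sval c0 e - sval c e)^-1 \*: (e \- (fun=> sval c e)).
have De' := DBB De (Dcst (sval c e)).
have Dw : D w by exact: (DZ _ De').
have wE c' : sval c' w = (sval c0 e - sval c e)^-1 * (sval c' e - sval c e).
  by rewrite /w (chZ c' _ De') (chB c' De (Dcst (sval c e))) chcst'.
exists (d \* w); split; first exact: (DM Dd Dw).
  by rewrite (chM c0 Dd Dw) d0 wE mulVf// mulr1.
move=> c'; rewrite inE (chM c' Dd Dw) => /predU1P[->|c's] ne'.
  by rewrite wE subrr !mulr0.
by rewrite ds// mul0r.
Qed.

(** The arrows of a piece with the source of k have their ranges in a fibre of an
    iterate of psi, which is finite; a coefficient d that separates the range of k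
    from the other points of this fibre isolates k. *)
Lemma core_delta k : exists2 p, P p &
  forall q, src q = src k -> p q = if q == k then 1 else 0.
Proof.
have [a [b Lk]] := lag_cover k.
have [l [ul _ lP]] := at_most_exact (fibres_iter a (iter b psi (src k)) fibP).
have [d [Dd d1 d0]] := separate (rng k) l.
exists (elem (gelfand d) a b (fun=> 1)); first exact: (span_elem1 a b (GD_gelfand Dd) GD1).
move=> q qk; case: eqP => [->|ne]; first by rewrite elemE// mulr1.
have [Lq|nL] := pselect (lag a b q); last by rewrite elemN.
rewrite elemE// mulr1; apply: d0.
  by apply/lP; rewrite /= -qk; case: Lq.
by move=> e; apply: ne; apply: gpd_eq => //; case: Lq => ->; case: Lk => ->.
Qed.

Lemma core_interpolate c (M : seq (groupoid psi)) (xi : groupoid psi -> C) : uniq M ->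
  (forall q, q \in M -> src q = c) ->
  exists2 p, P p & forall q, src q = c -> p q = if q \in M then xi q else 0.
Proof.
elim: M => [|k M IH] /= uM Mc.
  exists (elem (gelfand (fun=> 0)) 0 0 (fun=> 1)).
    exact: (span_elem1 0 0 (GD_gelfand (Dcst 0)) GD1).
  move=> q _; have [Lq|nL] := pselect (lag 0 0 q); last by rewrite elemN.
  by rewrite elemE// /gelfand chcst' mul0r.
case/andP: uM => kM uM.
have [|p Pp hp] := IH uM; first by move=> q qM; apply: Mc; rewrite inE qM orbT.
have kc : src k = c by apply: Mc; rewrite mem_head.
have [r Pr hr] := core_delta k.
exists (p \+ xi k \*: r); first by apply: core_add => //; exact: core_scale.
move=> q qc; rewrite /= hp// hr ?kc// inE; case: eqP => [->|_].
  by rewrite (negPf kM) /= add0r [LHS]mulr1.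
by rewrite /= scaler0 addr0.
Qed.

(** The estimate on the source fibre of a character c is expressed as
    nonnegativity of c on an element of D, and that element is nonnegative because
    of the estimate on the source fibres of the points of X. *)
Lemma op_le_of_pull h (K : R) : P h -> 0 <= K -> op_le (pull h) K -> op_le h K.
Proof.
move=> Ph K0 oh c xi c0 vx hx l0 ul0.
have Fh := core_unif_finite Ph.
pose l := [seq g <- l0 | src g == c].
have ul : uniq l by rewrite filter_uniq.
have lc g : g \in l -> src g = c by rewrite mem_filter => /andP[/eqP].
have -> : \sum_(g <- l0) nsq (conv h xi g) = \sum_(g <- l) nsq (conv h xi g).
  rewrite big_filter [RHS]big_mkcond; apply: eq_bigr => g _.
  by case: eqP => // /(fibre_vec_conv h vx) ->; rewrite nsq0.
(* xi is replaced by the restriction of some p in core. *)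
have [M [uM Mc hM]] := conv_truncate xi Fh ul lc.
have [p Pp pE] := core_interpolate xi uM Mc.
have E1 : \sum_(g <- l) nsq (conv h xi g) = \sum_(g <- l) nsq (conv h p g).
  apply: eq_big_seq => g gl; rewrite -(hM p)// => q qM.
  by rewrite pE ?qM//; exact: Mc.
pose F := conv h p; have PF : P F by exact: core_conv.
have [d1 D1 h1] := core_unit (core_conv (core_invol PF) PF).
have [d2 D2 h2] := core_unit (core_conv (core_invol Pp) Pp).
have list_of f y : unif_finite f -> exists N : seq (groupoid psi), [/\ uniq N,
    forall k, k \in N -> src k = y & forall k, src k = y -> f k != 0 -> k \in N].
  move=> [n [s [_ cf _]]]; have [N [uN _ NP]] := at_most_exact (cf y).
  by exists N; split=> // k; [move/NP => []|move=> ky fk; apply/NP].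
(* At x this is the bound for pull h on the vector pull p. *)
have key x : exists2 r : R, 0 <= r & K%:C ^+ 2 * d2 x - d1 x = r%:C.
  have [N1 [uN1 N1y N1P]] := list_of F (eval_char' x) (core_unif_finite PF).
  have [N2 [uN2 N2y N2P]] := list_of p (eval_char' x) (core_unif_finite Pp).
  have e1 := conv_invol_unit uN1 N1y N1P; rewrite h1 (eval_charE' x D1) in e1.
  have e2 := conv_invol_unit uN2 N2y N2P; rewrite h2 (eval_charE' x D2) in e2.
  exists (K ^+ 2 * (\sum_(k <- N2) nsq (p k)) - \sum_(k <- N1) nsq (F k)); last first.
    by rewrite e1 e2 rmorphB rmorphM rmorphXn.
  rewrite subr_ge0.
  have [j [jP ocj]] := gpd_embed_partial_inverse.
  have lift_list (N : seq (groupoid psi)) (q : groupoid psi -> R) : uniq N ->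
      (forall k, k \in N -> src k = eval_char' x) ->
      exists n : seq (groupoid phi), [/\ uniq n, forall g, g \in n -> src g = x
        & N = map gpd_embed n].
    move=> uN Ny; exists (pmap j N).
    have NE : N = map gpd_embed (pmap j N).
      elim: N {uN} Ny => [|k N IH] // Ny.
      have [g kg _] : exists2 g, k = gpd_embed g & src g = x.
        by apply: gpd_embed_surj; apply: Ny; rewrite mem_head.
      rewrite /= (jP k g).2//= -kg; congr cons; apply: IH => k' k'N.
      by apply: Ny; rewrite inE k'N orbT.
    split=> //; first by apply: (pmap_uniq ocj).
    move=> g gn; apply: eval_char_inj'; apply: (Ny (gpd_embed g)).
    by rewrite NE; apply: map_f.
  have [n1 [un1 n1x N1E]] := lift_list N1 (fun=> 0) uN1 N1y.
  pose z g : C := if src g == x then pull p g else 0.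
  have vz : fibre_vec x z by move=> g /eqP/negPf gx; rewrite /z gx.
  have hz : l2_le z (\sum_(k <- N2) nsq (p k)).
    move=> m um; pose m' := map gpd_embed [seq g <- m | src g == x].
    have um' : uniq m' by rewrite map_inj_uniq ?filter_uniq//; exact: gpd_embed_inj.
    have -> : \sum_(g <- m) nsq (z g) = \sum_(k <- m') nsq (p k).
      rewrite /m' big_map big_filter [RHS]big_mkcond; apply: eq_bigr => g _.
      by rewrite /z; case: ifP => //; rewrite nsq0.
    rewrite (bigID (fun k => p k == 0))/= big1 ?add0r => [|k /eqP ->]; last exact: nsq0.
    rewrite -big_filter; apply: sum_sub_list; rewrite ?filter_uniq//.
      by move=> k; exact: nsq_ge0.
    move=> k; rewrite mem_filter => /andP[pk /mapP[g]]; rewrite mem_filter.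
    by move=> /andP[/eqP gx _] kg; apply: N2P => //; rewrite kg src_gpd_embed gx.
  have := oh x z _ vz hz n1 un1; rewrite N1E big_map; congr (_ <= _).
  apply: eq_big_seq => g gn; congr nsq; rewrite /F -[conv h p _]/(pull (conv h p) g).
  rewrite -conv_pull; apply: (@eq_conv_fibre _ _ _ _ _ _ x); first exact: n1x.
  by move=> k kx; rewrite /z kx eqxx.
have /choice[r rP] x : exists r : R, 0 <= r /\ K%:C ^+ 2 * d2 x - d1 x = r%:C.
  by have [r r0 e] := key x; exists r.
have Dr : D (fun x => (r x)%:C).
  have -> : (fun x => (r x)%:C) = ((K%:C ^+ 2) \*: d2) \- d1.
    by apply/funext => x; case: (rP x) => _ <-.
  exact: (DBB (DZ (K%:C ^+ 2) D2) D1).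
have [t t0] := ch_pos compactX continuous_phi loc_inj_phi u_inj u_sum c Dr
  (fun x => (rP x).1).
have -> : (fun x => (r x)%:C) = ((K%:C ^+ 2) \*: d2) \- d1.
  by apply/funext => x; case: (rP x) => _ <-.
rewrite (chB c (DZ (K%:C ^+ 2) D2) D1) (chZ c _ D2) -h1 -h2.
have [N [uN Nc NP]] := list_of F c (core_unif_finite PF).
(* N' contains the support of F in the fibre of c, as conv_invol_unit requires,
   and also l, over which the estimate is to be summed. *)
pose N' := undup (l ++ N).
rewrite (@conv_invol_unit _ _ _ F c N').
- rewrite (@conv_invol_unit _ _ _ p c M)//; last first.
    move=> k kc; rewrite pE//; case: ifP => //; by rewrite eqxx.
  rewrite -rmorphXn -rmorphM -rmorphB => /complexI te.
  rewrite E1; apply: (@le_trans _ _ (\sum_(k <- N') nsq (F k))).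
    apply: sum_sub_list => //; first exact: undup_uniq.
      by move=> k; exact: nsq_ge0.
    by move=> g gl; rewrite mem_undup mem_cat gl.
  apply: (@le_trans _ _ (K ^+ 2 * \sum_(k <- M) nsq (p k))).
    by rewrite -subr_ge0 te.
  rewrite ler_wpM2l ?sqr_ge0//; apply: le_trans (hx M uM).
  by rewrite big_seq [leRHS]big_seq; apply: ler_sum => k kM; rewrite pE ?kM//; exact: Mc.
- exact: undup_uniq.
- by move=> k; rewrite mem_undup mem_cat => /orP[/lc|/Nc].
- by move=> k kc Fk; rewrite mem_undup mem_cat (NP k kc Fk) orbT.
Qed.

(** A vector on the source fibre of x, transported by the embedding and extended
    by 0, is one on the source fibre of the evaluation at x. *)
Lemma op_le_pull h (K : R) : op_le h K -> op_le (pull h) K.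
Proof.
move=> oh x xi c vx hx l ul.
have [j [jP ocj]] := gpd_embed_partial_inverse.
have ji g : j (gpd_embed g) = Some g by apply/jP.
pose z k : C := if j k is Some g then xi g else 0.
have rz : xi = pull z by apply/funext => g; rewrite /pull /z /= ji.
have vz : fibre_vec (eval_char' x) z.
  move=> k kx; rewrite /z; case e : (j k) => [g|] //; apply: vx => gx.
  by apply: kx; rewrite ((jP k g).1 e) src_gpd_embed gx.
have hz : l2_le z c.
  move=> m um; have -> : \sum_(k <- m) nsq (z k) = \sum_(g <- pmap j m) nsq (xi g).
    elim: m {um} => [|k m IH]; first by rewrite !big_nil.
    by rewrite big_cons IH /= /z; case: (j k) => [g|] /=; rewrite ?big_cons// nsq0 add0r.
  by apply: hx; exact: (pmap_uniq ocj um).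
have := oh _ _ _ vz hz (map gpd_embed l) ltac:(by rewrite map_inj_uniq//; exact: gpd_embed_inj).
by rewrite big_map rz conv_pull.
Qed.

Lemma pull_units d : D d -> pull (on_units (gelfand d)) = on_units d.
Proof.
move=> Dd; rewrite on_unitsE [RHS]on_unitsE gelfand1.
exact: (pull_elem 0 0 (Dcst 1) Dd).
Qed.

Lemma core_units d : D d -> P (on_units (gelfand d)).
Proof. by move=> Dd; rewrite on_unitsE; exact: (span_elem1 0 0 GD1 (GD_gelfand Dd)). Qed.

Lemma diag_horner d (q : {poly C}) : D d -> D (fun x => q.[d x]).
Proof.
move=> Dd; elim/poly_ind: q => [|q z IH].
  have -> : (fun x => (0 : {poly C}).[d x]) = fun=> 0.
    by apply/funext => x; rewrite horner0.
  exact: (Dcst 0).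
have -> : (fun x => (q * 'X + z%:P).[d x]) = ((fun x => q.[d x]) \* d) \+ (fun=> z).
  by apply/funext => x; rewrite hornerMXaddC.
exact: (DD (DM IH Dd) (Dcst z)).
Qed.

Lemma interpolation (F : nat -> C) n : exists q : {poly C},
  forall k, (k < n)%N -> q.[k%:R] = F k.
Proof.
elim: n => [|n [q hq]]; first by exists 0.
pose w : {poly C} := \prod_(i < n) ('X - (i%:R)%:P).
have wn : w.[n%:R] != 0.
  rewrite horner_prod; apply/prodf_neq0 => i _.
  by rewrite hornerXsubC subr_eq0 eqr_nat gtn_eqF.
have wk k : (k < n)%N -> w.[k%:R] = 0.
  move=> kn; rewrite horner_prod (bigD1 (Ordinal kn))//= hornerXsubC subrr.
  by rewrite mul0r.
exists (q + ((F n - q.[n%:R]) / w.[n%:R]) *: w) => k; rewrite ltnS leq_eqVlt.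
rewrite hornerD hornerZ => /predU1P[->|kn].
  by rewrite divfK// addrC subrK.
by rewrite (wk k kn) mulr0 addr0 hq.
Qed.

Let weight x : C := ((Num.sqrt (fibre_card (phi := phi) x)%:R)^-1)%:C.
Let count x : C := (fibre_card (phi := phi) x)%:R.

Let D_count : D count.
Proof.
have -> : count = transfer (theta := phi) (fun=> 1 : C) \o phi.
  by apply/funext => x; rewrite /= (fibre_cardE R x fibM).
exact: (Dcomp (Dtr (Dcst 1))).
Qed.

(** The cardinalities of fibres take finitely many values, so the weight is a
    polynomial in them, the same one for phi and for psi. *)
Let weight_poly : exists q : {poly C}, (forall x, weight x = q.[count x]) /\
  forall c, (((Num.sqrt (fibre_card (phi := psi) c)%:R)^-1)%:C = q.[(fibre_card (phi := psi) c)%:R]).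
Proof.
have [q hq] := interpolation (fun n => ((Num.sqrt n%:R)^-1)%:C) (size L).+1.
have bound (Y : topologicalType) (theta : Y -> Y) (y : Y) :
    fibres_at_most (theta := theta) (size L) ->
    (fibre_card (phi := theta) y < (size L).+1)%N.
  move=> fib; rewrite ltnS; have [l [ul sl lP]] := at_most_exact (fib (theta y)).
  have := fibre_cardE R y fib; rewrite (transferE _ ul lP).
  by rewrite big_const_seq count_predT iter_addr_0 => /eqP; rewrite eqr_nat => /eqP <-.
exists q; split=> [x|c]; rewrite hq//; exact: bound.
Qed.

Let ch_horner c d (q : {poly C}) : D d -> sval c (fun x => q.[d x]) = q.[sval c d].
Proof.
move=> Dd; elim/poly_ind: q => [|q z IH].
  have -> : (fun x => (0 : {poly C}).[d x]) = fun=> 0.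
    by apply/funext => x; rewrite horner0.
  by rewrite chcst' horner0.
have -> : (fun x => (q * 'X + z%:P).[d x]) = ((fun x => q.[d x]) \* d) \+ (fun=> z).
  by apply/funext => x; rewrite hornerMXaddC.
have Dq := diag_horner q Dd.
by rewrite (chD c (DM Dq Dd) (Dcst z)) (chM c Dq Dd) IH chcst' hornerMXaddC.
Qed.

Let V_isomE (Y : topologicalType) (theta : Y -> Y) : V_isom =
  elem (fun y => ((Num.sqrt (fibre_card (phi := theta) y)%:R)^-1)%:C) 1 0 (fun=> 1)
  :> (groupoid theta -> C).
Proof.
apply/funext => g; rewrite /V_isom; have [Lg|nL] := pselect (lag 1 0 g).
  rewrite elemE// mulr1; case: Lg => dg /= eg; rewrite dg subr0 eqxx /= -eg eqxx.
  by [].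
rewrite elemN//; case: ifP => // /andP[/eqP e1 /eqP e2]; exfalso; apply: nL.
by split; rewrite ?e1// subr0.
Qed.

(** The cardinality of the fibre is the transfer of 1 composed with phi, hence in
    D, and characters commute with polynomials. *)
Lemma V_isom_core : P V_isom /\ pull V_isom = V_isom.
Proof.
have [q [qw qc]] := weight_poly.
have wE : weight = (fun x => q.[count x]) by apply/funext => x; exact: qw.
have Dw : D weight by rewrite wE; exact: (diag_horner q D_count).
have E : V_isom = elem (gelfand weight) 1 0 (gelfand (fun=> 1)) :> (groupoid psi -> C).
  rewrite V_isomE -gelfand1; congr elem; apply/funext => c.
  rewrite qc /gelfand wE ch_horner//.
  by rewrite (fibre_card_dual compactX continuous_phi loc_inj_phi u_cont u_inj u_sum psiE c).
split; first by rewrite E; exact: (span_elem1 1 0 (GD_gelfand Dw) (GD_gelfand (Dcst 1))).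
by rewrite E (pull_elem 1 0 Dw (Dcst 1)) V_isomE.
Qed.

End comparison.

(** * Extension to the completions *)

Section real_norm.
Context {R : realType}.
Local Notation C := R[i].

(** The norm of a module over the complex numbers is itself complex-valued; this
    is its value as a real number. *)
Definition rnorm (V : normedModType C) (x : V) : R := complex.Re `|x|.

Lemma rnormE (V : normedModType C) (x : V) : `|x| = (rnorm x)%:C.
Proof.
have := normr_ge0 x; rewrite /rnorm; case: `|x| => a b.
by rewrite lecE /= => /andP[/eqP ->].
Qed.

Lemma rnorm_ge0 (V : normedModType C) (x : V) : 0 <= rnorm x.
Proof. by rewrite -ler0c -rnormE. Qed.

Lemma rnormD (V : normedModType C) (x y : V) : rnorm (x + y) <= rnorm x + rnorm y.
Proof. by rewrite -lecR rmorphD /= -!rnormE ler_normD. Qed.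

Lemma rnormB (V : normedModType C) (x y : V) : rnorm (x - y) = rnorm (y - x).
Proof. by rewrite /rnorm distrC. Qed.

Lemma rnorm0 (V : normedModType C) (x : V) : rnorm x = 0 -> x = 0.
Proof. by move=> h; apply/eqP; rewrite -normr_eq0 rnormE h. Qed.

Lemma rnorm_tri (V : normedModType C) (x y z : V) :
  rnorm (x - z) <= rnorm (x - y) + rnorm (y - z).
Proof. by have -> : x - z = (x - y) + (y - z); [rewrite addrA subrK|exact: rnormD]. Qed.

Lemma rnormZ_le (V : normedModType C) (z : C) (x : V) (K : R) : 0 <= K ->
  nsq z <= K ^+ 2 -> rnorm (z *: x) <= K * rnorm x.
Proof.
move=> K0; rewrite -nsq_le// => h; rewrite -lecR rmorphM /= -!rnormE normrZ.
by rewrite ler_wpM2r.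
Qed.

Lemma rnorm_lt (V : normedModType C) (x : V) (e : R) : (`|x| < e%:C) = (rnorm x < e).
Proof. by rewrite rnormE ltcR. Qed.

Lemma dense_rnorm (V : normedModType C) (S : set V) (x : V) (e : R) : dense S -> 0 < e ->
  exists2 y, S y & rnorm (x - y) <= e.
Proof.
move=> dS e0; have e0' : 0 < e%:C :> C by rewrite ltcR.
have oB : open (ball x e%:C) by exact: ball_open.
have nB : ball x e%:C !=set0 by exists x; exact: ballxx.
have [y [By Sy]] := dS _ nB oB; exists y => //.
by move: By; rewrite -ball_normE /= rnorm_lt => /ltW.
Qed.

Lemma invS_small (e : R) : 0 < e ->
  exists N, forall n, (N <= n)%N -> n.+1%:R^-1 <= e.
Proof.
move=> e0; exists (Num.bound e^-1) => n Nn.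
rewrite -[leRHS]invrK lef_pV2 ?posrE ?invr_gt0//.
apply: ltW; apply: (lt_le_trans (archi_boundP _)); first by rewrite invr_ge0 ltW.
by rewrite ler_nat (leq_trans Nn).
Qed.

(** The modulus of convergence is that of a sequence in which the n-th term is
    chosen with accuracy 1 / (n + 1) in two respects. *)
Lemma complete_rnorm (V : completeNormedModType C) (x : nat -> V) :
  (forall n m, rnorm (x n - x m) <= 2 * (n.+1%:R^-1 + m.+1%:R^-1)) ->
  exists l : V, forall e : R, 0 < e -> exists N, forall n, (N <= n)%N -> rnorm (l - x n) <= e.
Proof.
move=> cx; have cF : cvg (x @ \oo).
  apply/cauchy_cvgP; apply: cauchy_exP => e e0.
  case: e e0 => e e'; rewrite ltcE /= => /andP[/eqP -> e0].
  have [N hN] := invS_small (divr_gt0 e0 (ltr0n R 8)).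
  exists (x N); exists N => // n /= Nn; rewrite -ball_normE /= rnorm_lt.
  apply: (le_lt_trans (cx _ _)); apply: (@le_lt_trans _ _ (2 * (e / 8 + e / 8))).
    by rewrite ler_wpM2l// lerD// hN.
  lra.
exists (lim (x @ \oo)) => e e0.
have /cvgrPdist_lt/(_ e%:C) := cF; rewrite ltcR => /(_ e0) [N _ hN].
by exists N => n Nn; have := hN n Nn; rewrite /= rnorm_lt => /ltW.
Qed.

(** The norm of y squared is that of star y times y, which is at most the product
    of the two norms. *)
Lemma rnorm_star (A : cstarAlgType R) (x : A) : rnorm (star x) = rnorm x.
Proof.
have le (y : A) : rnorm y <= rnorm (star y).
  have [y0|yn] := eqVneq (rnorm y) 0; first by rewrite y0 rnorm_ge0.
  have y0 : 0 < rnorm y by rewrite lt_def yn rnorm_ge0.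
  rewrite -(ler_pM2r y0) -lecR rmorphM /= -!rnormE -expr2 -cstar_norm.
  by rewrite rmorphM /= -!rnormE cstar_normM.
by apply/eqP; rewrite eq_le le andbT -{2}(starK x) le.
Qed.

Lemma starB (A : cstarAlgType R) (x y : A) : star (x - y) = star x - star y.
Proof.
rewrite starD; congr (_ + _); rewrite -scaleN1r starZ.
by rewrite rmorphN rmorph1 scaleN1r.
Qed.

Lemma rnorm_cmul (A : cstarAlgType R) (x y : A) : rnorm (cmul x y) <= rnorm x * rnorm y.
Proof. by rewrite -lecR rmorphM /= -!rnormE cstar_normM. Qed.

Lemma cmul_sub (A : cstarAlgType R) (x y x' y' : A) :
  cmul x y - cmul x' y' = cmul x (y - y') + cmul (x - x') y'.
Proof.
have N1 (a b : A) : cmul a (- b) = - cmul a b.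
  by rewrite -scaleN1r cmulZr scaleN1r.
have N2 (a b : A) : cmul (- a) b = - cmul a b.
  by rewrite -scaleN1r cmulZl scaleN1r.
by rewrite cmulDr cmulDl N1 N2 addrA subrK.
Qed.

End real_norm.

Section completion.
Context {R : realType} {X Y : topologicalType} {phi : X -> X} {psi : Y -> Y}.
Local Notation C := R[i].
Implicit Types (f : groupoid phi -> C) (h k : groupoid psi -> C).

Lemma emb_rnorm (Z : topologicalType) (theta : Z -> Z) (A : reduced_cstar R theta)
    (f : groupoid theta -> C) (K : R) :
  alg_star f -> 0 <= K -> rnorm (red_emb A f) <= K <-> op_le f K.
Proof.
move=> af K0; split=> [h|/reduced_norm_le].
  by apply/reduced_norm_le => //; rewrite -(red_emb_norm A af) lee_fin.
by move=> /(_ K0); rewrite -(red_emb_norm A af) lee_fin.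
Qed.

Lemma emb_sub (Z : topologicalType) (theta : Z -> Z) (A : reduced_cstar R theta)
    (f k : groupoid theta -> C) :
  alg_star f -> alg_star k -> red_emb A (f \- k) = red_emb A f - red_emb A k /\
    alg_star (f \- k).
Proof.
move=> af ak; have E : f \- k = f \+ (-1 : C) \*: k.
  by apply/funext => g /=; rewrite scaleN1r.
have ak' : alg_star ((-1 : C) \*: k) by exact: alg_starZ.
by rewrite E red_embD// red_embZ// scaleN1r; split=> //; exact: alg_starD.
Qed.

Variables (A : reduced_cstar R phi) (B : reduced_cstar R psi).
Variables (P : set (groupoid psi -> C)).
Variable (r : (groupoid psi -> C) -> (groupoid phi -> C)).
Hypothesis alg_star_fin : forall f, alg_star f -> unif_finite f.
Hypothesis r_fin : forall h, P h -> unif_finite (r h).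
Hypothesis Pa : forall h, P h -> alg_star h.
Hypothesis P_add : forall h k, P h -> P k -> P (h \+ k).
Hypothesis P_scale : forall (z : C) h, P h -> P (z \*: h).
Hypothesis P_conv : forall h k, P h -> P k -> P (conv h k).
Hypothesis P_invol : forall h, P h -> P (invol h).
Hypothesis rD : forall h k, r (h \+ k) = r h \+ r k.
Hypothesis rZ : forall (z : C) h, r (z \*: h) = z \*: r h.
Hypothesis rM : forall h k, r (conv h k) = conv (r h) (r k).
Hypothesis rI : forall h, r (invol h) = invol (r h).
Hypothesis r_op_le : forall h (K : R), P h -> 0 <= K -> op_le (r h) K <-> op_le h K.
Hypothesis dense_psi : forall h, alg_star h -> approx P h.
Hypothesis dense_r : forall h, P h -> approx alg_star (r h).
Hypothesis dense_phi : forall f, alg_star f -> approx (r @` P) f.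

Let P_sub (h k : groupoid psi -> C) : P h -> P k -> P (h \- k).
Proof.
move=> Ph Pk; have -> : h \- k = h \+ (-1 : C) \*: k.
  by apply/funext => g /=; rewrite scaleN1r.
by apply: P_add => //; exact: P_scale.
Qed.

Let rB (h k : groupoid psi -> C) : r (h \- k) = r h \- r k.
Proof.
have E (G : Type) (a b : G -> C) : a \- b = a \+ (-1 : C) \*: b.
  by apply/funext => g /=; rewrite scaleN1r.
by rewrite !E rD rZ.
Qed.

(** The closure of the pairs (r h, h), for h in P. The intermediate function f is
    needed because r h need not belong to alg_star, where red_emb is an
    embedding. *)
Definition transports (a : A) (b : B) := forall e : R, 0 < e ->
  exists f h, [/\ alg_star f, P h, rnorm (a - red_emb A f) <= e,
    rnorm (b - red_emb B h) <= e & op_le (f \- r h) e].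
Local Notation T := transports.

Let emb_close f f' (e : R) : alg_star f -> alg_star f' -> 0 <= e ->
  rnorm (red_emb A f - red_emb A f') <= e <-> op_le (f \- f') e.
Proof.
by move=> af af' e0; have [<- as_] := emb_sub A af af'; exact: emb_rnorm.
Qed.

Let embB_close h h' (e : R) : P h -> P h' -> 0 <= e ->
  rnorm (red_emb B h - red_emb B h') <= e <-> op_le (r h \- r h') e.
Proof.
move=> Ph Ph' e0; have [<- as_] := emb_sub B (Pa Ph) (Pa Ph').
rewrite -rB; rewrite (r_op_le (P_sub Ph Ph') e0); exact: emb_rnorm.
Qed.

Let rnorm_dist (V : normedModType C) (x y : V) : rnorm x <= rnorm (x - y) + rnorm y.
Proof. by have := rnormD (x - y) y; rewrite subrK. Qed.

Let op_le_split (f g : groupoid phi -> C) (K e : R) : unif_finite f ->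
  unif_finite g -> 0 < K -> 0 < e ->
  op_le (f \- g) e -> op_le g K -> op_le f (e + K).
Proof.
move=> Ff Fg K0 e0 o1 o2; have -> : f = (f \- g) \+ g.
  by apply/funext => x /=; rewrite subrK.
by apply: op_leD => //; exact: unif_finite_sub.
Qed.

Lemma transports_rnorm a b : T a b -> rnorm a = rnorm b.
Proof.
move=> Tab; apply/eqP; rewrite eq_le; apply/andP; split;
  apply/ler_addgt0Pr => e e0; have e4 : 0 < e / 4 by rewrite divr_gt0.
- have [f [h [af Ph ha hb o]]] := Tab _ e4.
  have K0 : 0 < rnorm (red_emb B h) + e / 4 by rewrite ltr_wpDl ?rnorm_ge0.
  have oh : op_le (r h) (rnorm (red_emb B h) + e / 4).
    apply/(r_op_le Ph (ltW K0)); apply/(emb_rnorm B (Pa Ph) (ltW K0)).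
    by rewrite lerDl ltW.
  have of_ := op_le_split (alg_star_fin af) (r_fin Ph) K0 e4 o oh.
  have K1 : 0 <= e / 4 + (rnorm (red_emb B h) + e / 4) by rewrite ltW// addr_gt0.
  have /(emb_rnorm A af K1) hf := of_.
  have h1 := rnorm_dist a (red_emb A f); have h2 := rnorm_dist (red_emb B h) b.
  rewrite (rnormB _ b) in h2; lra.
- have [f [h [af Ph ha hb o]]] := Tab _ e4.
  have K0 : 0 < rnorm (red_emb A f) + e / 4 by rewrite ltr_wpDl ?rnorm_ge0.
  have of_ : op_le f (rnorm (red_emb A f) + e / 4).
    by apply/(emb_rnorm A af (ltW K0)); rewrite lerDl ltW.
  have oh := op_le_split (r_fin Ph) (alg_star_fin af) K0 e4 (op_le_subC o) of_.
  have K1 : 0 <= e / 4 + (rnorm (red_emb A f) + e / 4) by rewrite ltW// addr_gt0.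
  have /(r_op_le Ph K1)/(emb_rnorm B (Pa Ph) K1) hh := oh.
  have h1 := rnorm_dist b (red_emb B h); have h2 := rnorm_dist (red_emb A f) a.
  rewrite (rnormB _ a) in h2; lra.
Qed.

Lemma transportsD a b a' b' : T a b -> T a' b' -> T (a + a') (b + b').
Proof.
move=> h1 h2 e e0; have e2 : 0 < e / 2 by rewrite divr_gt0.
have [f [h [af Ph ha hb o]]] := h1 _ e2; have [f' [h' [af' Ph' ha' hb' o']]] := h2 _ e2.
exists (f \+ f'), (h \+ h'); split.
- exact: alg_starD.
- exact: P_add.
- rewrite red_embD// opprD addrACA [e]splitr.
  exact: (le_trans (rnormD _ _) (lerD ha ha')).
- rewrite (red_embD B (Pa Ph) (Pa Ph')) opprD addrACA [e]splitr.
  exact: (le_trans (rnormD _ _) (lerD hb hb')).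
- have -> : (f \+ f') \- r (h \+ h') = (f \- r h) \+ (f' \- r h').
    by rewrite rD; apply/funext => x /=; rewrite opprD addrACA.
  rewrite [e]splitr; apply: op_leD => //.
    exact: (unif_finite_sub (alg_star_fin af) (r_fin Ph)).
  exact: (unif_finite_sub (alg_star_fin af') (r_fin Ph')).
Qed.

Lemma transportsZ (z : C) a b : T a b -> T (z *: a) (z *: b).
Proof.
move=> h1 e e0; have [K K0 zK] := bdd_nsq z.
have [f [h [af Ph ha hb o]]] := h1 _ (divr_gt0 e0 K0).
have E : e = K * (e / K) by rewrite [RHS]mulrC divfK// gt_eqF.
exists (z \*: f), (z \*: h); split.
- exact: alg_starZ.
- exact: P_scale.
- rewrite red_embZ// -scalerBr E; apply: (le_trans (rnormZ_le _ (ltW K0) zK)).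
  by rewrite ler_wpM2l// ltW.
- rewrite (red_embZ B z (Pa Ph)) -scalerBr E.
  apply: (le_trans (rnormZ_le _ (ltW K0) zK)).
  by rewrite ler_wpM2l// ltW.
- have -> : (z \*: f) \- r (z \*: h) = z \*: (f \- r h).
    by rewrite rZ; apply/funext => x /=; rewrite scalerBr.
  by rewrite E; exact: op_leZ.
Qed.

Lemma transports_star a b : T a b -> T (star a) (star b).
Proof.
move=> h1 e e0; have [f [h [af Ph ha hb o]]] := h1 _ e0.
exists (invol f), (invol h); split.
- exact: alg_star_invol.
- exact: P_invol.
- by rewrite red_emb_star// -starB rnorm_star.
- by rewrite (red_emb_star B (Pa Ph)) -starB rnorm_star.
- have -> : invol f \- r (invol h) = invol (f \- r h).
    by rewrite rI; apply/funext => x; rewrite /invol /= rmorphB.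
  by apply: op_le_invol => //; exact: (unif_finite_sub (alg_star_fin af) (r_fin Ph)).
Qed.

Lemma transportsM a b a' b' : T a b -> T a' b' -> T (cmul a a') (cmul b b').
Proof.
move=> h1 h2 e e0.
pose M := 1 + rnorm a + rnorm a' + rnorm b + rnorm b'.
have [na na' nb nb'] := And4 (rnorm_ge0 a) (rnorm_ge0 a') (rnorm_ge0 b) (rnorm_ge0 b').
have M1 : 1 <= M by rewrite /M; lra.
(* The factor M + 1 bounds the norms of the approximants, as d <= 1. *)
pose d := Num.min 1 (e / (2 * (M + 1))).
have M2 : 0 < 2 * (M + 1) by lra.
have d0 : 0 < d by rewrite lt_min ltr01 divr_gt0.
have d1 : d <= 1 by rewrite ge_min lexx.
have de : 2 * (M + 1) * d <= e.
  by rewrite mulrC -ler_pdivlMr// ge_min lexx orbT.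
have [f [h [af Ph ha hb o]]] := h1 _ d0; have [f' [h' [af' Ph' ha' hb' o']]] := h2 _ d0.
have bound (V : cstarAlgType R) (x y x' y' : V) : rnorm x <= M -> rnorm y <= M ->
    rnorm (x - x') <= d -> rnorm (y - y') <= d -> rnorm (cmul x y - cmul x' y') <= e.
  move=> xM yM xx yy; rewrite cmul_sub; apply: (le_trans (rnormD _ _)).
  have y'M : rnorm y' <= M + 1 by have := rnorm_dist y' y; rewrite (rnormB y'); lra.
  apply: le_trans de; apply: (@le_trans _ _ (M * d + d * (M + 1))); last by nra.
  apply: lerD; apply: (le_trans (rnorm_cmul _ _)); apply: ler_pM => //;
    by rewrite ?rnorm_ge0.
exists (conv f f'), (conv h h'); split.
- exact: alg_star_conv.
- exact: P_conv.
- by rewrite red_embM//; apply: bound => //; rewrite /M; lra.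
- by rewrite (red_embM B (Pa Ph) (Pa Ph')); apply: bound => //; rewrite /M; lra.
have of_ : op_le f (M + 1).
  apply/(emb_rnorm A af); first by lra.
  by have := rnorm_dist (red_emb A f) a; rewrite (rnormB _ a) /M; lra.
have oh : op_le (r h') (M + 1).
  apply/(r_op_le Ph'); first by lra.
  apply/(emb_rnorm B (Pa Ph')); first by lra.
  by have := rnorm_dist (red_emb B h') b'; rewrite (rnormB _ b') /M; lra.
have Ff := alg_star_fin af; have Ff' := alg_star_fin af'; have Fh := r_fin Ph; have Fh' := r_fin Ph'.
rewrite rM conv_sub//.
have MM : 0 < M + 1 by lra.
apply: (@op_le_trans _ _ _ _ ((M + 1) * d + d * (M + 1))).
- by rewrite addr_ge0// mulr_ge0// ltW.
- by apply: le_trans de; nra.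
apply: op_leD.
- by apply: unif_finite_conv => //; exact: unif_finite_sub.
- by apply: unif_finite_conv => //; exact: unif_finite_sub.
- exact: mulr_gt0.
- exact: mulr_gt0.
- by apply: op_le_conv => //; exact: unif_finite_sub.
- by apply: op_le_conv => //; exact: unif_finite_sub.
Qed.

Let inv_gt0 n : 0 < n.+1%:R^-1 :> R. Proof. by rewrite invr_gt0. Qed.

(** Functions h corresponding to better and better approximations of a form a
    Cauchy sequence, since r is isometric. *)
Lemma transports_total a : exists b, T a b.
Proof.
have /choice[fh fhP] n : exists fh : (groupoid phi -> C) * (groupoid psi -> C),
    [/\ alg_star fh.1, P fh.2, rnorm (a - red_emb A fh.1) <= n.+1%:R^-1
      & op_le (fh.1 \- r fh.2) (n.+1%:R^-1)].
  have [_ [f af <-] hf] := dense_rnorm a (red_emb_dense (r := A)) (inv_gt0 n).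
  have [_ /(_ _ (inv_gt0 n))[_ [h Ph <-] o]] := dense_phi af.
  by exists (f, h).
have cauchy_h n m : rnorm (red_emb B (fh n).2 - red_emb B (fh m).2) <=
    2 * (n.+1%:R^-1 + m.+1%:R^-1).
  have [af Ph ha o] := fhP n; have [af' Ph' ha' o'] := fhP m.
  have n0 := inv_gt0 n; have m0 := inv_gt0 m.
  have Ff := alg_star_fin af; have Ff' := alg_star_fin af'; have Fh := r_fin Ph; have Fh' := r_fin Ph'.
  have off : op_le ((fh n).1 \- (fh m).1) (n.+1%:R^-1 + m.+1%:R^-1).
    apply/(emb_close af af' (ltW (addr_gt0 n0 m0))).
    apply: (le_trans (rnorm_tri _ a _)); rewrite rnormB; exact: lerD.
  apply/(embB_close Ph Ph' (mulr_ge0 (ler0n _ 2) (ltW (addr_gt0 n0 m0)))).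
  have -> : 2 * (n.+1%:R^-1 + m.+1%:R^-1) =
    n.+1%:R^-1 + ((n.+1%:R^-1 + m.+1%:R^-1) + m.+1%:R^-1) :> R by ring.
  exact: (op_le_tri Fh Ff Fh' n0 (addr_gt0 (addr_gt0 n0 m0) m0) (op_le_subC o)
    (op_le_tri Ff Ff' Fh' (addr_gt0 n0 m0) m0 off o')).
have [b hb] := complete_rnorm cauchy_h.
exists b => e e0; have [N1 h1] := hb _ e0; have [N2 h2] := invS_small e0.
pose n := maxn N1 N2; have [af Ph ha o] := fhP n.
have hn := h2 n (leq_maxr _ _).
exists (fh n).1, (fh n).2; split=> //; first exact: le_trans hn.
  by apply: h1; exact: leq_maxl.
by apply: op_le_trans hn o; rewrite ltW.
Qed.

Lemma transports_onto b : exists a, T a b.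
Proof.
have /choice[fh fhP] n : exists fh : (groupoid phi -> C) * (groupoid psi -> C),
    [/\ alg_star fh.1, P fh.2, rnorm (b - red_emb B fh.2) <= n.+1%:R^-1
      & op_le (r fh.2 \- fh.1) (n.+1%:R^-1)].
  have e2 : 0 < n.+1%:R^-1 / 2 :> R by rewrite divr_gt0.
  have [_ [k ak <-] hk] := dense_rnorm b (red_emb_dense (r := B)) e2.
  have [_ /(_ _ e2)[h Ph o]] := dense_psi ak.
  have [_ /(_ _ (inv_gt0 n))[f af o']] := dense_r Ph.
  exists (f, h); split=> //=; rewrite [leRHS]splitr.
  apply: (le_trans (rnorm_tri _ (red_emb B k) _)); apply: lerD => //.
  have [<- as_] := emb_sub B ak (Pa Ph).
  by apply/emb_rnorm => //; exact: ltW.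
have cauchy_f n m : rnorm (red_emb A (fh n).1 - red_emb A (fh m).1) <=
    2 * (n.+1%:R^-1 + m.+1%:R^-1).
  have [af Ph ha o] := fhP n; have [af' Ph' ha' o'] := fhP m.
  have n0 := inv_gt0 n; have m0 := inv_gt0 m.
  have Ff := alg_star_fin af; have Ff' := alg_star_fin af'; have Fh := r_fin Ph; have Fh' := r_fin Ph'.
  have off : op_le (r (fh n).2 \- r (fh m).2) (n.+1%:R^-1 + m.+1%:R^-1).
    apply/(embB_close Ph Ph' (ltW (addr_gt0 n0 m0))).
    apply: (le_trans (rnorm_tri _ b _)); rewrite rnormB; exact: lerD.
  apply/(emb_close af af' (mulr_ge0 (ler0n _ 2) (ltW (addr_gt0 n0 m0)))).
  have -> : 2 * (n.+1%:R^-1 + m.+1%:R^-1) =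
    n.+1%:R^-1 + ((n.+1%:R^-1 + m.+1%:R^-1) + m.+1%:R^-1) :> R by ring.
  exact: (op_le_tri Ff Fh Ff' n0 (addr_gt0 (addr_gt0 n0 m0) m0) (op_le_subC o)
    (op_le_tri Fh Fh' Ff' (addr_gt0 n0 m0) m0 off o')).
have [a ha] := complete_rnorm cauchy_f.
exists a => e e0; have [N1 h1] := ha _ e0; have [N2 h2] := invS_small e0.
pose n := maxn N1 N2; have [af Ph hb o] := fhP n.
have hn := h2 n (leq_maxr _ _).
exists (fh n).1, (fh n).2; split=> //; last first.
- by apply: op_le_trans hn (op_le_subC o); rewrite ltW.
- exact: le_trans hn.
- by apply: h1; exact: leq_maxl.
Qed.

Lemma transportsB a b a' b' : T a b -> T a' b' -> T (a - a') (b - b').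
Proof.
move=> h1 h2; rewrite -[- a']scaleN1r -[- b']scaleN1r.
by apply: transportsD => //; exact: transportsZ.
Qed.

(** By transports_rnorm and linearity the relation transports is the graph of an
    isometric bijection, and it is compatible with all operations. *)
Theorem completion_isomorphism : exists Phi : {linear A -> B},
  star_isomorphism Phi /\
  forall h, P h -> exists2 a : A, is_function a (r h) & is_function (Phi a) h.
Proof.
have /choice[F FP] := transports_total; have /choice[F' FP'] := transports_onto.
have uniqB a b b' : T a b -> T a b' -> b = b'.
  move=> t t'; apply/eqP; rewrite -subr_eq0; apply/eqP/rnorm0.
  rewrite -(transports_rnorm (transportsB t t')) subrr.
  by rewrite /rnorm normr0.
have uniqA a a' b : T a b -> T a' b -> a = a'.
  move=> t t'; apply/eqP; rewrite -subr_eq0; apply/eqP/rnorm0.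
  rewrite (transports_rnorm (transportsB t t')) subrr.
  by rewrite /rnorm normr0.
have lin : linear F.
  move=> z x y; apply: (uniqB (z *: x + y)) => //.
  by apply: transportsD => //; exact: transportsZ.
pose Phi : {linear A -> B} := HB.pack F (GRing.isLinear.Build R[i] A B *:%R F lin).
exists Phi; split.
  split.
  - exists F' => [a|b]; first exact: (uniqA _ _ (F a)).
    exact: (uniqB (F' b)).
  - by move=> x y; apply: (uniqB (cmul x y)) => //; exact: transportsM.
  - by move=> x; apply: (uniqB (star x)) => //; exact: transports_star.
move=> h Ph; exists (F' (red_emb B h)); last first.
  have -> : Phi (F' (red_emb B h)) = red_emb B h by exact: (uniqB (F' (red_emb B h))).
  move=> e e0; exists h; first exact: Pa.
  split; last by rewrite subrr normr0 ltcR.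
  have e2 : 0 < e / 2 by rewrite divr_gt0.
  apply: (@le_lt_trans _ _ (e / 2)%:E).
    by apply/reduced_norm_le; [exact: ltW|exact: op_le_sub0].
  by rewrite lte_fin ltr_pdivrMr// ltr_pMr// ltr1n.
move=> e e0; have e4 : 0 < e / 4 by rewrite divr_gt0.
have [f [h' [af Ph' ha hb o]]] := FP' (red_emb B h) _ e4.
exists f => //; split; last by rewrite rnorm_lt (le_lt_trans ha)//; lra.
have Ff := alg_star_fin af; have Fh := r_fin Ph; have Fh' := r_fin Ph'.
have /(embB_close Ph Ph' (ltW e4)) oh := hb.
apply: (@le_lt_trans _ _ (e / 4 + e / 4)%:E); last by rewrite lte_fin; lra.
apply/reduced_norm_le; first by rewrite ltW// addr_gt0.
by apply: (op_le_tri Fh Fh' Ff) => //; exact: op_le_subC.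
Qed.

End completion.

(** * The isomorphism *)

Theorem theorem5p4 (R : realType) (X : metricType R) (phi : X -> X)
    (X_nonempty : [set: X] !=set0) (X_compact : compact [set: X])
    (phi_continuous : continuous phi)
    (phi_inj : locally_injective phi)
    (phi_surj : range phi = [set: X])
    (psi : spectrum R phi -> spectrum R phi)
    (psiE : forall (c : spectrum R phi) (d : X -> R[i]), diag phi d ->
       sval (psi c) d = sval c (d \o phi))
    (A : reduced_cstar R phi) (B : reduced_cstar R psi) :
  exists Phi : {linear A -> B},
    [/\ star_isomorphism Phi,
        forall d : X -> R[i], diag phi d ->
          exists2 a : A, is_function a (on_units d)
            & is_function (Phi a) (on_units (gelfand d))
      & exists2 a : A, is_function a V_isom & is_function (Phi a) V_isom].
Proof.
have li := (locally_injective_loc_inj (theta := phi)).1 phi_inj.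
have [L [u [uc ui us]]] := loc_inj_partition X_compact li.
pose r := @pull R X phi X_compact phi_continuous li _ L u uc ui us psi psiE.
pose P := @core R X phi psi.
have Pa : forall h, P h -> alg_star h.
  exact: (core_alg_star X_compact phi_continuous li uc ui us psiE).
have r_fin : forall h, P h -> unif_finite (r h) by move=> h; exact: unif_finite_pull.
have Pscale : forall (z : R[i]) h, P h -> P (z \*: h) by exact: core_scale.
have Pconv : forall h k, P h -> P k -> P (conv h k).
  exact: (core_conv X_compact phi_continuous li uc ui us psiE).
have Pinvol : forall h, P h -> P (invol h) by exact: core_invol.
have rM : forall h k, r (conv h k) = conv (r h) (r k) by move=> h k; apply/esym; exact: conv_pull.
have rI : forall h, r (invol h) = invol (r h) by move=> h; apply/esym; exact: invol_pull.
have r_op_le : forall h (K : R), P h -> 0 <= K -> op_le (r h) K <-> op_le h K.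
  by move=> h K Ph K0; split; [exact: op_le_of_pull|exact: op_le_pull].
have dense_psi : forall h, alg_star h -> approx P h.
  exact: (alg_star_approx_core X_compact phi_continuous li uc ui us psiE).
have dense_r : forall h, P h -> approx alg_star (r h) by move=> h; exact: approx_pull_core.
have dense_phi : forall f, alg_star f -> approx (r @` P) f.
  by move=> f; exact: approx_alg_star_pull.
have alg_star_fin : forall f : groupoid phi -> R[i], alg_star f -> unif_finite f.
  by move=> f; exact: (alg_star_unif_finite X_compact phi_continuous li ui us).
have [Phi [iso fPhi]] := @completion_isomorphism R _ _ phi psi A B P r alg_star_fin r_fin Pa
  (@span_elemD _ _ _ _) Pscale Pconv Pinvol (fun _ _ => erefl) (fun _ _ => erefl)
  rM rI r_op_le dense_psi dense_r dense_phi.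
exists Phi; split=> //.
  move=> d Dd; have [a ha hb] := fPhi _ (core_units X_compact phi_continuous li psi Dd).
  exists a; last exact: hb.
  by rewrite -(pull_units X_compact phi_continuous li uc ui us psiE Dd).
have [PV rV] := V_isom_core X_compact phi_continuous li uc ui us psiE.
have [a ha hb] := fPhi _ PV; exists a; last exact: hb.
by rewrite -rV.
Qed.
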